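(* For every integer $m$ with $1\le m\le N/2$, every fiber of $\tau_m^N:\mathrm{Hess}_m^E\to\mathcal N_1$ and every fiber of $\sigma_m^N:\mathrm{Hess}_m^O\to\mathcal N_1$ has a paving by affine spaces.
   Context: $V=\mathbb C^N$ with a non-degenerate quadratic form $Q$ and associated symmetric bilinear form $\langle\,,\rangle_Q$; $\mathfrak g_1=\{x\in\mathfrak{sl}(V):\langle xu,v\rangle_Q=\langle u,xv\rangle_Q\ \forall u,v\}$; $\mathcal N_1\subset\mathfrak g_1$ is the set of nilpotent elements; $U^\perp$ is the orthogonal complement of $U$ for $\langle\,,\rangle_Q$. $\mathrm{Hess}_m^E$ is the variety of triples $(x,V_{m-1}\subset V_m)$ with $x\in\mathfrak g_1$, $V_{m-1}\subset V_m\subset V$ isotropic subspaces, $\dim V_i=i$, such that $xV_m=0$ and $xV_m^\perp\subset V_{m-1}$. $\mathrm{Hess}_m^O$ is the variety of such triples satisfying instead $xV_m=0$ and $xV_{m-1}^\perp\subset V_{m-1}$. The maps $\tau_m^N,\sigma_m^N$ send a triple to $x$; their images consist of nilpotent elements. Fibers are considered as (reduced) varieties. A variety $Y$ has a paving by affine spaces if it has a finite filtration by closed subvarieties $\emptyset=Y_0\subset Y_1\subset\dots\subset Y_r=Y$ with each $Y_i\setminus Y_{i-1}$ isomorphic to an affine space. *)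

(* Defs.v *)
From HB Require Import structures.
From mathcomp Require Import all_boot all_order all_algebra.
From mathcomp Require Import boolp classical_sets reals complex mpoly.

Set Implicit Arguments.
Unset Strict Implicit.
Unset Printing Implicit Defensive.

Import GRing.Theory.
Local Open Scope classical_set_scope.
Local Open Scope ring_scope.

(* Reduced varieties over an algebraically closed field C are handled as      *)
(* "spaces with functions": a Zariski topology on the set of closed points,   *)
(* together with, for each open U, the functions that are regular on U (only  *)
(* the values on U of a function matter, and only open U are ever used).      *)
Section Spaces.
Variable C : fieldType.

Record space := Space {
  pt :> Type;
  zopen : set (set pt);
  regular : set pt -> (pt -> C) -> Prop }.

Definition zclosed (X : space) (Z : set X) := zopen (~` Z).

Definition zeros n (S : set {mpoly C[n]}) : set 'rV[C]_n :=
  [set a | forall p, S p -> p.@[a 0] = 0].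

Definition affine_open n : set (set 'rV[C]_n) :=
  [set U | exists S, ~` U = zeros S].

Definition affine_regular n (U : set 'rV[C]_n) (f : 'rV[C]_n -> C) :=
  forall a, U a -> exists W (p q : {mpoly C[n]}),
    [/\ affine_open W, W a &
        forall b, U b -> W b -> q.@[b 0] != 0 /\ f b = p.@[b 0] / q.@[b 0]].

Definition affine n := Space (@affine_open n) (@affine_regular n).

(* A subset with its induced reduced structure: regular functions are those   *)
(* which locally extend to regular functions of the ambient space.            *)
Section Subspace.
Variables (X : space) (Z : set X).

Definition sub_open : set (set Z) :=
  [set U | exists2 W : set X, zopen W & U = [set z | W (val z)]].

Definition sub_regular (U : set Z) (f : Z -> C) :=
  forall a, U a -> exists (W : set X) (g : X -> C),
    [/\ zopen W, regular W g, W (val a) &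
        forall b, U b -> W (val b) -> f b = g (val b)].

Definition subspace := Space sub_open sub_regular.
End Subspace.

(* The quotient structure along a map pi from a space. It is meaningful on    *)
(* the image of pi, which is an open and closed subset of it.                 *)
Section Quotient.
Variables (X : space) (T : Type) (pi : X -> T).

Definition quotient_space :=
  @Space T [set U | zopen (pi @^-1` U)]
         (fun U f => regular (pi @^-1` U) (f \o pi)).
End Quotient.

Definition morphism (X Y : space) (phi : X -> Y) :=
  forall U : set Y, zopen U ->
    zopen (phi @^-1` U) /\
    forall f, regular U f -> regular (phi @^-1` U) (f \o phi).

Definition isomorphic (X Y : space) :=
  exists (phi : X -> Y) (psi : Y -> X),
    [/\ cancel phi psi, cancel psi phi, morphism phi & morphism psi].

Definition affine_paving (X : space) :=
  exists (r : nat) (Y : nat -> set X),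
    [/\ Y 0%N = set0, Y r = setT &
        forall i, (i < r)%N ->
          [/\ zclosed (Y i.+1), Y i `<=` Y i.+1 &
              exists d, isomorphic (subspace (Y i.+1 `\` Y i)) (affine d)]].

Section Flags.
Variable N : nat.

(* Vectors of V = C^N are rows, and x : 'M_N acts on V by v |-> v *m x.       *)
Definition triple := ('M[C]_N * {vspace 'rV[C]_N} * {vspace 'rV[C]_N})%type.

Definition rowspan k (A : 'M[C]_(k, N)) : {vspace 'rV[C]_N} :=
  <<[seq row i A | i : 'I_k]>>%VS.

(* The variety gl(V) x Gr(k, V) x Gr(l, V), where Gr(k, V) is the quotient by *)
(* GL_k of the open set of k x N matrices of rank k, a matrix representing    *)
(* the span of its rows. The three matrices (x, A, B) are stored as a single  *)
(* vector of coordinates.                                                     *)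
Section Ambient.
Variables k l : nat.

Let coords := 'rV[C]_(N * N + (k * N + l * N)).
Definition endo_of (v : coords) : 'M[C]_N := vec_mx (lsubmx v).
Definition frame1_of (v : coords) : 'M[C]_(k, N) := vec_mx (lsubmx (rsubmx v)).
Definition frame2_of (v : coords) : 'M[C]_(l, N) := vec_mx (rsubmx (rsubmx v)).

Definition frames : set (affine (N * N + (k * N + l * N))) :=
  [set v : coords | row_free (frame1_of v) /\ row_free (frame2_of v)].

Definition triple_of_frames (v : subspace frames) : triple :=
  (endo_of (val v), rowspan (frame1_of (val v)), rowspan (frame2_of (val v))).

(* The carrier is the type of all triples (x, U, W); the points of the        *)
(* variety are those with dim U = k and dim W = l.                            *)
Definition endo_Gr_Gr : space := quotient_space triple_of_frames.
End Ambient.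

(* B is the symmetric bilinear form <,>_Q associated with Q. *)
Definition assoc_form (Q : 'rV[C]_N -> C) (B : {symmetric 'rV[C]_N}) :=
  forall v, Q v = B v v.

Variable B : {symmetric 'rV[C]_N}.

Definition g1 : set 'M[C]_N :=
  [set x | \tr x = 0 /\ forall u v, B (u *m x) v = B u (v *m x)].

Definition N1 : set 'M[C]_N := [set x | g1 x /\ exists n, x ^+ n = 0].

Definition isotropic (U : {vspace 'rV[C]_N}) :=
  forall u v, u \in U -> v \in U -> B u v = 0.

Definition flag_conditions m (t : triple) :=
  let: (x, U, W) := t in
  [/\ g1 x, (U <= W)%VS, isotropic U /\ isotropic W,
      \dim U = m.-1 /\ \dim W = m & forall v, v \in W -> v *m x = 0].

Definition HessE m : set triple :=
  [set t | flag_conditions m t /\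
     let: (x, U, W) := t in forall v, v \in orthov B W -> v *m x \in U].

Definition HessO m : set triple :=
  [set t | flag_conditions m t /\
     let: (x, U, W) := t in forall v, v \in orthov B U -> v *m x \in U].

Definition endo (t : triple) : 'M[C]_N := t.1.1.

(* The fibres over x of tau_m^N : HessE m -> N1 and sigma_m^N : HessO m -> N1,*)
(* with their reduced structures.                                             *)
Definition tau_fiber m x : space :=
  @subspace (endo_Gr_Gr m.-1 m) (HessE m `&` endo @^-1` [set x]).

Definition sigma_fiber m x : space :=
  @subspace (endo_Gr_Gr m.-1 m) (HessO m `&` endo @^-1` [set x]).
End Flags.
End Spaces.

(* Main.v *)
Require Import Defs.
From HB Require Import structures.
From mathcomp Require Import all_boot all_order all_algebra.
From mathcomp Require Import boolp classical_sets reals complex.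
From mathcomp Require Import fingroup perm mpoly zify ring.

(* If a fibre over x is not empty then x^3 = 0. Let K = ker x; its filtration *)
(* im x^2 <= K1 = ker x :&: im x <= K carries nondegenerate symmetric forms   *)
(* on K / K1 (induced by <u, v>) and on K1 / im x^2 (induced by               *)
(* (y x, w) := <y, w>). For subspaces U <= W of K, W is isotropic iff its     *)
(* image in K / K1 is, and x P^perp <= U holds iff U contains the orthogonal  *)
(* of P :&: K1 in K1, where P = W for Hess^E and P = U for Hess^O.            *)
(*                                                                            *)
(* In a basis of K adapted to the filtration, in which both forms are         *)
(* antidiagonal, decompose the fibre by the pivots (J', J) of the reduced     *)
(* echelon matrices of (U, W). On a nonempty piece the equations between the  *)
(* entries of the echelon matrices are triangular: the equation pairing the   *)
(* rows i <= j is linear in the entry (j, i'), i' being the index dual to i,  *)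
(* and otherwise involves free entries and entries closer to their pivot. So  *)
(* each piece is an affine space. The pieces are ordered by the sum of their  *)
(* pivots, and unions of initial ones are closed, being defined by the        *)
(* vanishing of minors.                                                       *)

Set Implicit Arguments.
Unset Strict Implicit.
Unset Printing Implicit Defensive.

Import GRing.Theory.
Local Open Scope ring_scope.

(** * Polynomial and fractional functions *)

(** A fibre is cut into pieces by the pivots of (U, W) relative to a flag of [ker x] refining the
    filtration above. Each nonempty piece is the solution set of a triangular polynomial system,
    hence an affine space, and the pieces stack into a closed filtration. If x^3 is nonzero the
    fibre is empty.

    The system is triangular for the following reason. The echelon matrix R of a subspace is
    triangular, with 1 at its pivots. For an antidiagonal form, the pairing of rows i and j is the
    sum of R i k * R j (st k), where only k between st j and i contribute. The two extreme terms are
    the entries (j, st i) and (i, st j), multiplied by pivots 1; the others are products of entries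
    closer to their pivots. So the equation is solved for (j, st i), after division by 2 if i = j.
    If i = st j the pairing is 1, and the piece is empty. This is [pairing_solE]. It serves twice:
    for the isotropy of W in K / K1, and, applied to [(1%:M - R)^T] with the order reversed, for the
    condition that a subspace contains its own orthogonal in K1. For Hess^E there remain linear
    equations ([reduced_flag_subP]), solved for the coordinates of R' in the column of the one pivot
    of W that U lacks.

    [adapted_basis_exists], [isotropic_subP] and [perp_image_subP] translate the fibre into
    matrices; [cellO_polynomial] and [cellE_polynomial] parametrize the pieces. Entries of echelon
    matrices are fractions with minors as denominators, regular on an open set of the ambient
    variety, so [cell_isomorphic] makes the parametrization an isomorphism of varieties.
    [affine_paving_cells] orders the pieces: by [minor_reduced_le], a nonvanishing minor has its
    columns at the pivots or has a smaller column sum. *)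

Section PolynomialFunctions.
Variables (C : fieldType) (d : nat).
Implicit Types f g : 'rV[C]_d -> C.

Definition polyfun f := exists p : {mpoly C[d]}, forall a, f a = p.@[a 0].

Lemma polyfunX p : polyfun (fun a => p.@[a 0]).
Proof. by exists p. Qed.

Lemma eq_polyfun f g : f =1 g -> polyfun f -> polyfun g.
Proof. by move=> fg [p fp]; exists p => a; rewrite -fg. Qed.

Lemma polyfun_const c : polyfun (fun=> c).
Proof. by exists c%:MP => a; rewrite mevalC. Qed.

Lemma polyfun_coord i : polyfun (fun a => a 0 i).
Proof. by exists 'X_i => a; rewrite mevalXU. Qed.

Lemma polyfunD f g : polyfun f -> polyfun g -> polyfun (fun a => f a + g a).
Proof. by move=> [p fp] [q gq]; exists (p + q) => a; rewrite mevalD fp gq. Qed.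

Lemma polyfunN f : polyfun f -> polyfun (fun a => - f a).
Proof. by move=> [p fp]; exists (- p) => a; rewrite mevalN fp. Qed.

Lemma polyfunB f g : polyfun f -> polyfun g -> polyfun (fun a => f a - g a).
Proof. by move=> pf pg; apply/polyfunD/polyfunN. Qed.

Lemma polyfunM f g : polyfun f -> polyfun g -> polyfun (fun a => f a * g a).
Proof. by move=> [p fp] [q gq]; exists (p * q) => a; rewrite mevalM fp gq. Qed.

Lemma polyfun_sum (I : Type) (r : seq I) (P : pred I) (F : I -> 'rV[C]_d -> C) :
  (forall i, polyfun (F i)) -> polyfun (fun a => \sum_(i <- r | P i) F i a).
Proof.
move=> pF; elim: r => [|i r IH].
  by apply: eq_polyfun (polyfun_const 0) => a; rewrite big_nil.
have [Pi|nPi] := boolP (P i); last first.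
  by apply: eq_polyfun IH => a; rewrite big_cons (negPf nPi).
by apply: eq_polyfun (polyfunD (pF i) IH) => a; rewrite big_cons Pi.
Qed.

Lemma polyfun_prod (I : Type) (r : seq I) (P : pred I) (F : I -> 'rV[C]_d -> C) :
  (forall i, polyfun (F i)) -> polyfun (fun a => \prod_(i <- r | P i) F i a).
Proof.
move=> pF; elim: r => [|i r IH].
  by apply: eq_polyfun (polyfun_const 1) => a; rewrite big_nil.
have [Pi|nPi] := boolP (P i); last first.
  by apply: eq_polyfun IH => a; rewrite big_cons (negPf nPi).
by apply: eq_polyfun (polyfunM (pF i) IH) => a; rewrite big_cons Pi.
Qed.

Lemma polyfun_det m (F : 'rV[C]_d -> 'M[C]_m) :
  (forall i j, polyfun (fun a => F a i j)) -> polyfun (fun a => \det (F a)).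
Proof.
move=> pF; apply: polyfun_sum => s; apply: polyfunM (polyfun_const _) _.
exact: polyfun_prod.
Qed.

Lemma polyfun_mulmx m n p (F : 'rV[C]_d -> 'M[C]_(m, n))
    (G : 'rV[C]_d -> 'M[C]_(n, p)) i j :
  (forall i j, polyfun (fun a => F a i j)) ->
  (forall i j, polyfun (fun a => G a i j)) ->
  polyfun (fun a => (F a *m G a) i j).
Proof.
move=> pF pG.
apply: (@eq_polyfun (fun a => \sum_k F a i k * G a k j)) => [a|].
  by rewrite mxE.
by apply: polyfun_sum => k; apply: polyfunM.
Qed.

(** The polynomial functions localized at [delta]. Nothing is asked where [delta] vanishes, so total
    functions built from [invmx] qualify. *)
Definition fracfun (delta : 'rV[C]_d -> C) f :=
  exists g k, polyfun g /\ forall a, delta a != 0 -> f a = g a / delta a ^+ k.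

Variable delta : 'rV[C]_d -> C.
Hypothesis pdelta : polyfun delta.

Lemma polyfun_exp f k : polyfun f -> polyfun (fun a => f a ^+ k).
Proof.
move=> pf; elim: k => [|k IH].
  by apply: eq_polyfun (polyfun_const 1) => a; rewrite expr0.
by apply: eq_polyfun (polyfunM pf IH) => a; rewrite exprS.
Qed.

Lemma fracfun_polyfun f : polyfun f -> fracfun delta f.
Proof.
by move=> pf; exists f, 0%N; split=> // a _; rewrite expr0 divr1.
Qed.

Lemma fracfunD f g : fracfun delta f -> fracfun delta g ->
  fracfun delta (fun a => f a + g a).
Proof.
move=> [f1 [k [pf1 fE]]] [g1 [l [pg1 gE]]].
exists (fun a => f1 a * delta a ^+ l + g1 a * delta a ^+ k), (k + l)%N; split.
  by apply: polyfunD; apply: polyfunM => //; apply: polyfun_exp.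
move=> a da; rewrite fE // gE // exprD.
have dk : delta a ^+ k != 0 by rewrite expf_neq0.
have dl : delta a ^+ l != 0 by rewrite expf_neq0.
by rewrite addf_div.
Qed.

Lemma fracfunM f g : fracfun delta f -> fracfun delta g ->
  fracfun delta (fun a => f a * g a).
Proof.
move=> [f1 [k [pf1 fE]]] [g1 [l [pg1 gE]]].
exists (fun a => f1 a * g1 a), (k + l)%N; split; first exact: polyfunM.
by move=> a da; rewrite fE // gE // exprD invfM mulrACA.
Qed.

Lemma fracfun_sum (I : Type) (r : seq I) (F : I -> 'rV[C]_d -> C) :
  (forall i, fracfun delta (F i)) -> fracfun delta (fun a => \sum_(i <- r) F i a).
Proof.
move=> pF; elim: r => [|i r IH].
  have := fracfun_polyfun (polyfun_const 0); congr fracfun.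
  by apply: funext => a; rewrite big_nil.
have := fracfunD (pF i) IH; congr fracfun.
by apply: funext => a; rewrite big_cons.
Qed.

Lemma fracfun_prod (I : Type) (r : seq I) (F : I -> 'rV[C]_d -> C) :
  (forall i, fracfun delta (F i)) -> fracfun delta (fun a => \prod_(i <- r) F i a).
Proof.
move=> pF; elim: r => [|i r IH].
  have := fracfun_polyfun (polyfun_const 1); congr fracfun.
  by apply: funext => a; rewrite big_nil.
have := fracfunM (pF i) IH; congr fracfun.
by apply: funext => a; rewrite big_cons.
Qed.

Lemma fracfun_exp f k : fracfun delta f -> fracfun delta (fun a => f a ^+ k).
Proof.
move=> pf; have := @fracfun_prod _ (index_enum 'I_k) (fun=> f) (fun=> pf).
by congr fracfun; apply: funext => a; rewrite prodr_const card_ord.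
Qed.

Lemma fracfun_meval e (g : 'rV[C]_d -> 'rV[C]_e) (p : {mpoly C[e]}) :
  (forall i, fracfun delta (fun a => g a 0 i)) ->
  fracfun delta (fun a => p.@[(g a) 0]).
Proof.
move=> pg.
have -> : (fun a => p.@[(g a) 0]) =
   (fun a => \sum_(k <- msupp p) p@_k * \prod_(i <- index_enum 'I_e) g a 0 i ^+ k i).
  by apply: funext => a; rewrite mevalE.
apply: fracfun_sum => k; apply: fracfunM.
  exact/fracfun_polyfun/polyfun_const.
by apply: fracfun_prod => i; apply: fracfun_exp.
Qed.

End PolynomialFunctions.

(** * Spaces with functions *)

Section SpacesWithFunctions.
Local Open Scope classical_set_scope.
Variable C : fieldType.

(** Principal open sets form a basis of the Zariski topology. Conversely, the complement of U is cut
    out by all polynomials whose nonvanishing locus lies in U. *)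
Lemma affine_openP d (U : set 'rV[C]_d) :
  affine_open U <-> forall a, U a -> exists f,
    [/\ polyfun f, f a != 0 & forall b, f b != 0 -> U b].
Proof.
split=> [[S US] a Ua|loc].
  have : ~ zeros S a by rewrite -US => /(_ Ua).
  move=> /existsNP[p /not_implyP[Sp /eqP pa]].
  exists (fun b => p.@[b 0]); split=> // [|b pb]; first exact: polyfunX.
  apply: contrapT => nUb; have : zeros S b by rewrite -US.
  by move=> /(_ p Sp)/eqP; rewrite (negPf pb).
exists [set p : {mpoly C[d]} | forall b : 'rV_d, p.@[b 0] != 0 -> U b].
apply/seteqP; split=> [a nUa p pU|a za Ua].
  by apply/eqP; apply: contra_notT nUa => /pU.
have [f [[p fp] fa fU]] := loc a Ua.
have : p.@[a 0] = 0 by apply: za => b; rewrite -fp => /fU.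
by rewrite -fp => /eqP; rewrite (negPf fa).
Qed.

Lemma affine_regular_local d (U : set 'rV[C]_d) (f : 'rV[C]_d -> C) :
  (forall a, U a -> exists W g, [/\ affine_open W, affine_regular W g, W a &
     forall b, U b -> W b -> f b = g b]) -> affine_regular U f.
Proof.
move=> loc a Ua; have [W [g [oW rg Wa fg]]] := loc a Ua.
have [W' [p [q [oW' W'a gpq]]]] := rg a Wa.
exists (W `&` W'), p, q; split=> // [|b Ub [Wb W'b]].
  apply/affine_openP => b [Wb W'b].
  have [h [ph hb hW]] := (affine_openP _).1 oW b Wb.
  have [h' [ph' hb' hW']] := (affine_openP _).1 oW' b W'b.
  exists (fun x => h x * h' x); split; first exact: polyfunM.
    by rewrite mulf_neq0.
  by move=> x; rewrite mulf_eq0 negb_or => /andP[/hW ? /hW' ?].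
by rewrite fg //; apply: gpq.
Qed.

Definition open_inter (X : Defs.space C) :=
  zopen (setT : set X) /\
  forall U V : set X, zopen U -> zopen V -> zopen (U `&` V).

Lemma open_inter_affine d : open_inter (affine C d).
Proof.
split=> [|U V oU oV].
  apply/affine_openP => a _; exists (fun=> 1).
  by split; [exact: polyfun_const | exact: oner_neq0 | ].
apply/affine_openP => b [Ub Vb].
have [h [ph hb hU]] := (affine_openP _).1 oU b Ub.
have [h' [ph' hb' hV]] := (affine_openP _).1 oV b Vb.
exists (fun x => h x * h' x); split; first exact: polyfunM.
  by rewrite mulf_neq0.
by move=> x; rewrite mulf_eq0 negb_or => /andP[/hU ? /hV ?].
Qed.

Lemma open_inter_subspace (X : Defs.space C) (Z : set X) :
  open_inter X -> open_inter (subspace Z).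
Proof.
move=> [oT oI]; split=> [|U V [U' oU' ->] [V' oV' ->]]; first by exists setT.
by exists (U' `&` V') => //; apply: oI.
Qed.

Lemma open_inter_quotient (X : Defs.space C) (T : Type) (pi : X -> T) :
  open_inter X -> open_inter (quotient_space pi).
Proof. by move=> [oT oI]; split=> // U V oU oV; apply: oI. Qed.

Lemma zclosedU (X : Defs.space C) (U V : set X) : open_inter X ->
  zclosed U -> zclosed V -> zclosed (U `|` V).
Proof. by move=> [_ oI] cU cV; rewrite /zclosed setCU; apply: oI. Qed.

(** For O open, this says that [phi] restricts to a morphism on O, whatever its values elsewhere. It
    suits charts, which are total functions with a meaning only where a minor is nonzero. *)
Definition morphism_on (X Y : Defs.space C) (O : set X) (phi : X -> Y) :=
  forall U : set Y, zopen U ->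
    zopen (O `&` phi @^-1` U) /\
    forall f, regular U f -> regular (O `&` phi @^-1` U) (f \o phi).

Lemma morphism_onT (X Y : Defs.space C) (O : set X) (phi : X -> Y) :
  (forall z, O z) -> morphism_on O phi -> morphism phi.
Proof.
move=> Oall mphi U oU; have [o r] := mphi U oU.
suff E : phi @^-1` U = O `&` phi @^-1` U by rewrite E.
by apply/seteqP; split=> z // [].
Qed.

Lemma morphism_on_subspace (X Y : Defs.space C) (Z O : set X) (phi : X -> Y)
    (psi : subspace Z -> Y) :
  (forall z : Z, O (val z) -> psi z = phi (val z)) ->
  morphism_on O phi ->
  morphism_on (val @^-1` O : set (subspace Z)) psi.
Proof.
move=> psiE mphi U oU; have [o r] := mphi U oU; split.
  exists (O `&` phi @^-1` U) => //; apply/seteqP.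
  by split=> z [/= Oz]; rewrite ?psiE // => Uz; split=> //=; rewrite ?psiE.
move=> f rf a [Oa Ua]; exists (O `&` phi @^-1` U), (f \o phi).
split=> //; first exact: r.
  by split=> //=; rewrite -psiE.
by move=> b [Ob Ub] _; rewrite /= psiE.
Qed.

(** Regular functions on a subspace are only locally restrictions of ambient ones, so pullbacks have
    to be glued. The source is an affine space because [affine_regular_local] provides the gluing
    there. *)
Lemma morphism_into_subspace d (X : Defs.space C) (Z : set X)
    (h : affine C d -> X) (h' : affine C d -> subspace Z) :
  (forall a, val (h' a) = h a) -> morphism h -> morphism h'.
Proof.
move=> hE mh U [W oW ->]; have [o r] := mh W oW; split.
  suff -> : h' @^-1` [set z | W (val z)] = h @^-1` W by [].
  by apply/seteqP; split=> a /=; rewrite hE.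
move=> f rf; apply: affine_regular_local => a Wa.
have [W1 [g [oW1 rg W1a fg]]] := rf _ Wa.
have [o1 r1] := mh W1 oW1.
exists (h @^-1` W1), (g \o h); split=> //.
- exact: r1.
- by rewrite /= -hE.
- by move=> b Wb W1b; rewrite /= fg //= ?hE.
Qed.

Lemma morphism_on_affine n d (delta : 'rV[C]_n -> C)
    (g : affine C n -> affine C d) :
  polyfun delta -> (forall i, fracfun delta (fun a => g a 0 i)) ->
  morphism_on ([set a | delta a != 0] : set (affine C n)) g.
Proof.
move=> pdelta pg U oU.
have opre (W : set (affine C d)) : affine_open W ->
    affine_open ([set a | delta a != 0] `&` g @^-1` W).
  move=> oW; apply/affine_openP => a [/= da Wga].
  have [h [[p hp] ha hW]] := (affine_openP _).1 oW _ Wga.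
  have [q [k [pq qE]]] := fracfun_meval pdelta p pg.
  exists (fun b => delta b * q b); split; first exact: polyfunM.
    rewrite mulf_neq0 //; apply: contraNneq ha => q0.
    by rewrite hp qE // q0 mul0r.
  move=> b; rewrite mulf_eq0 negb_or => /andP[db qb]; split=> //=.
  apply: hW; rewrite hp qE // mulf_neq0 // invr_eq0 expf_neq0 //.
split; first exact: opre.
move=> f rf a [/= da Uga].
have [W [p [q [oW Wga fpq]]]] := rf _ Uga.
have [p1 [k1 [[p2 p2E] p1E]]] := fracfun_meval pdelta p pg.
have [q1 [k2 [[q2 q2E] q1E]]] := fracfun_meval pdelta q pg.
have [D DE] := pdelta.
exists ([set a | delta a != 0] `&` g @^-1` W), (p2 * D ^+ k2), (q2 * D ^+ k1).
split=> //; first exact: opre.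
move=> b [/= db Ub] [_ Wb]; have [qb ->] := fpq _ Ub Wb.
rewrite !mevalM !rmorphXn /= -DE -p2E -q2E.
have dk k : delta b ^+ k != 0 by rewrite expf_neq0.
have q1b : q1 b != 0.
  by apply: contraNneq qb => q10; rewrite q1E // q10 mul0r.
split; first by rewrite mulf_neq0.
by rewrite p1E // q1E // invf_div mulf_div [_ * q1 b]mulrC.
Qed.

Lemma morphism_polynomial n d (g : affine C n -> affine C d) :
  (forall i, polyfun (fun a => g a 0 i)) -> morphism g.
Proof.
move=> pg; have p1 := polyfun_const n (1 : C).
apply: (@morphism_onT (affine C n) _ [set a | (fun=> 1 : C) a != 0]) => [a|] /=.
  exact: oner_neq0.
apply: morphism_on_affine => // i; exact: fracfun_polyfun.
Qed.

(** * Pavings from a ranked partition into cells *)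

(** The closed set [S l] contains the cell l and otherwise meets only cells of smaller height.
    Hence, with cells sorted by height, unions of initial segments are closed. *)
Lemma affine_paving_of_cells (X : Defs.space C) (L : finType)
    (cell S : L -> set X) (ht : L -> nat) :
  open_inter X ->
  (forall z, exists l, cell l z) ->
  (forall l, cell l `<=` S l) ->
  (forall l l' z, S l z -> cell l' z -> l' = l \/ (ht l' < ht l)%N) ->
  (forall l, zclosed (S l)) ->
  (forall l, cell l !=set0 ->
     exists d, isomorphic (subspace (cell l)) (affine C d)) ->
  affine_paving X.
Proof.
move=> iX cover cS Sht clS iso.
have disj l l' z : cell l z -> cell l' z -> l' = l.
  move=> cl cl'; have [//|lt] := Sht _ _ _ (cS _ _ cl) cl'.
  have [//|lt'] := Sht _ _ _ (cS _ _ cl') cl.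
  by have := ltn_trans lt lt'; rewrite ltnn.
pose leht := [rel l l' | (ht l <= ht l')%N].
(* Empty cells are discarded, since each step of a paving must be an affine space. *)
pose s := sort leht [seq l <- enum L | `[< cell l !=set0 >]].
have leht_total : total leht by move=> l l'; apply: leq_total.
have leht_trans : transitive leht by move=> l l' l''; apply: leq_trans.
have ss : sorted leht s by apply: sort_sorted.
have us : uniq s by rewrite sort_uniq filter_uniq ?enum_uniq.
have mem_s l : (l \in s) = `[< cell l !=set0 >].
  by rewrite mem_sort mem_filter mem_enum andbT.
pose Y i := [set z | exists2 l, l \in take i s & cell l z].
exists (size s), Y; split.
- by apply/seteqP; split=> z // [l]; rewrite take0.
- apply/seteqP; split=> z // _; have [l cl] := cover z.
  by exists l => //; rewrite take_size mem_s; apply/asboolP; exists z.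
move=> i lti; have [l0 _] : exists l0 : L, True.
  by case: s lti {ss us mem_s Y} => // l ? _; exists l.
have tS : take i.+1 s = rcons (take i s) (nth l0 s i) by rewrite (take_nth l0).
have subY : Y i `<=` Y i.+1.
  by move=> z [l li cl]; exists l => //; rewrite tS mem_rcons inE li orbT.
(* A point of [S l] outside the cell l lies in a cell of smaller height, which precedes l in the
   sorted list. *)
have YE j : Y j = \bigcup_(l in [set` take j s]) S l.
  apply/seteqP; split=> z [l lj].
    by move=> cl; exists l => //; apply: cS.
  move=> Sl; have [l' cl'] := cover z.
  have l's : l' \in s by rewrite mem_s; apply/asboolP; exists z.
  exists l' => //; have [-> //|lt] := Sht _ _ _ Sl cl'.
  move: l's; rewrite -{1}(cat_take_drop j s) mem_cat => /orP[//|l'd].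
  move: ss; rewrite (sorted_pairwise leht_trans) -(cat_take_drop j s) pairwise_cat.
  move=> /and3P[/allrelP/(_ _ _ lj l'd) /=]; by rewrite leqNgt lt.
split=> //.
  rewrite YE; elim: (take i.+1 s) => [|l t IH].
    rewrite /zclosed; suff -> : \bigcup_(l in [set` [::]]) S l = set0 by rewrite setC0; case: iX.
    by apply/seteqP; split=> z // [].
  suff -> : \bigcup_(k in [set` l :: t]) S k = S l `|` (\bigcup_(k in [set` t]) S k).
    exact: zclosedU.
  apply/seteqP; split=> z.
    move=> [k /=]; rewrite inE => /orP[/eqP->|kt] Sk; [by left|by right; exists k].
  by case=> [Sl|[k kt Sk]]; [exists l|exists k] => //=; rewrite inE ?eqxx ?kt ?orbT.
suff -> : Y i.+1 `\` Y i = cell (nth l0 s i).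
  by apply: iso; apply/asboolP; rewrite -mem_s mem_nth.
apply/seteqP; split=> z.
  move=> [[l]]; rewrite tS mem_rcons inE => /orP[/eqP-> //|li cl] nY.
  by case: nY; exists l.
move=> cz; split; first by exists (nth l0 s i) => //; rewrite tS mem_rcons inE eqxx.
move=> [l li cl]; have E := disj _ _ _ cl cz; move: us.
have -> : s = take i s ++ drop i s by rewrite cat_take_drop.
rewrite cat_uniq => /and3P[_ /hasPn/(_ (nth l0 s i)) + _].
by rewrite (drop_nth l0) // inE eqxx => /(_ isT); rewrite /= E li.
Qed.

End SpacesWithFunctions.

(** * Triangular systems of polynomial equations *)

Section TriangularSystems.
Variables (C : fieldType) (T : finType) (elim : pred T) (rk : T -> nat).
Variable f : T -> (T -> C) -> C.

Hypothesis f_poly : forall s, elim s -> forall d (y : 'rV[C]_d -> T -> C),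
  (forall t, polyfun (fun z => y z t)) -> polyfun (fun z => f s (y z)).
Hypothesis f_dep : forall s (y y' : T -> C), elim s ->
  (forall t, ~~ elim t || (rk t < rk s)%N -> y t = y' t) -> f s y = f s y'.

(** The free entries are the parameters. Substituting the equations into themselves k times settles
    all entries of rank below k. *)
Lemma triangular_system : exists d (theta : 'rV[C]_d -> T -> C) (c : 'I_d -> T),
  [/\ forall t, polyfun (fun z => theta z t),
      forall z s, elim s -> theta z s = f s (theta z),
      forall z i, theta z (c i) = z 0 i &
      forall y, (forall s, elim s -> y s = f s y) ->
        forall t, y t = theta (\row_i y (c i)) t].
Proof.
pose free := [pred t | ~~ elim t]; pose d := #|free|.
pose c (i : 'I_d) := enum_val i.
have c_free i : ~~ elim (c i) by exact: (enum_valP i).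
pose y0 (z : 'rV[C]_d) t := \sum_(i | c i == t) z 0 i.
have y0c z i : y0 z (c i) = z 0 i.
  rewrite /y0 (big_pred1 i) // => j /=.
  by apply/eqP/eqP => [/enum_val_inj|->].
pose step z (y : T -> C) t := if elim t then f t y else y0 z t.
pose y k z := iter k (step z) (y0 z).
(* One more than the largest rank, so that every entry is settled after [r] rounds. *)
pose r := (\max_t rk t).+1.
have yS k z t : y k.+1 z t = if elim t then f t (y k z) else y0 z t by [].
have y_free k z t : ~~ elim t -> y k z t = y0 z t.
  by case: k => //= k nt; rewrite /y /= /step (negPf nt).
have stable k z t : (rk t < k)%N -> y k z t = y k.+1 z t.
  elim: k t => // k IH t tk; rewrite !yS.
  case: ifP => // et; apply: f_dep => // t'.
  case/orP => [nt'|lt]; first by rewrite !y_free.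
  by apply: IH; apply: leq_trans lt _; rewrite -ltnS.
have rk_r t : (rk t < r)%N by rewrite ltnS leq_bigmax.
have fix_r z s : elim s -> y r z s = f s (y r z).
  by move=> es; rewrite (stable _ _ _ (rk_r s)) yS es.
exists d, (y r), c; split=> //.
- move=> t; elim: {fix_r rk_r} r t => [|k IH] t.
    by apply: polyfun_sum => i; apply: polyfun_coord.
  have [et|nt] := boolP (elim t).
    by apply: eq_polyfun (f_poly et IH) => z; rewrite yS et.
  apply: (@eq_polyfun _ _ (fun z => y0 z t)) => [z|]; first by rewrite y_free.
  by apply: polyfun_sum => i; apply: polyfun_coord.
- by move=> z i; rewrite y_free.
move=> w wf; pose z := \row_i w (c i).
have y0w t : ~~ elim t -> y0 z t = w t.
  move=> nt; have tf : t \in free by [].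
  by rewrite -(enum_rankK_in tf tf) -/(c _) y0c mxE.
move=> t; have [k] := ubnP (rk t); elim: k t => // k IH t tk.
have [et|nt] := boolP (elim t); last by rewrite y_free ?y0w.
rewrite fix_r // wf //; apply: f_dep => // t' /orP[nt'|lt].
  by rewrite y_free ?y0w.
by apply: IH; apply: leq_trans lt _; rewrite -ltnS.
Qed.

End TriangularSystems.

(** * Quadratic equations between the rows of a unitriangular matrix *)

Section RowPairings.
Variables (C : fieldType) (n : nat) (bl : 'I_n -> nat) (st : 'I_n -> 'I_n).
Hypothesis stK : involutive st.
Hypothesis bl_st : forall i, bl (st i) = bl i.

Definition block_form b : 'M[C]_n :=
  \matrix_(i, j) ((bl i == b) && (j == st i))%:R.

Lemma block_formE b p q (U : 'M[C]_(p, n)) (V : 'M[C]_(q, n)) i j :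
  (U *m block_form b *m V^T) i j = \sum_(k | bl k == b) U i k * V j (st k).
Proof.
rewrite -mulmxA mxE [RHS]big_mkcond; apply: eq_bigr => k _; rewrite mxE.
rewrite (bigD1 (st k)) //= !mxE eqxx andbT big1 ?addr0.
  by case: ifP; rewrite ?mul1r ?mul0r ?mulr0.
by move=> l lk; rewrite !mxE (negPf lk) andbF mul0r.
Qed.

Lemma block_form_sym b p q (U : 'M[C]_(p, n)) (V : 'M[C]_(q, n)) i j :
  (U *m block_form b *m V^T) i j = (V *m block_form b *m U^T) j i.
Proof.
rewrite !block_formE (reindex_inj (inv_inj stK)).
by apply: eq_big => [k|k _]; rewrite ?bl_st // stK mulrC.
Qed.

Definition pairing b (Z : 'M[C]_n) i j := (Z *m block_form b *m Z^T) i j.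

Section Unitriangular.
Variables (b : nat) (rho : 'I_n -> nat) (P : pred 'I_n) (Z : 'M[C]_n).
Hypothesis rho_inj : injective rho.
Hypothesis rho_st : forall i j, bl i = b -> bl j = b ->
  (rho i + rho (st i) = rho j + rho (st j))%N.
Hypothesis Z_diag : forall i, P i -> Z i i = 1.
Hypothesis Z_trig : forall i k, P i -> bl i = b -> bl k = b ->
  (rho i < rho k)%N -> Z i k = 0.

(** By triangularity a term survives only if rho (st j) <= rho k <= rho i, since rho + rho o st is
    constant on the block. Here this range is empty. *)
Lemma pairing_eq0 i j : P i -> P j -> bl i = b -> bl j = b ->
  (rho i < rho (st j))%N -> pairing b Z i j = 0.
Proof.
move=> Pi Pj bi bj lt; rewrite /pairing block_formE big1 // => k /eqP bk.
have [ik|ki] := ltnP (rho i) (rho k); first by rewrite Z_trig ?mul0r.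
rewrite [X in _ * X]Z_trig ?mulr0 ?bl_st //.
by have := rho_st bj bk; lia.
Qed.

(** The range of k is now the single index i, where both factors are pivots. This forbids two dual
    pivots in an isotropic subspace. *)
Lemma pairing_st i : P i -> P (st i) -> bl i = b -> pairing b Z i (st i) = 1.
Proof.
move=> Pi Psi bi; rewrite /pairing block_formE (bigD1 i) ?bi //=.
rewrite !Z_diag // mulr1 big1 ?addr0 // => k /andP[/eqP bk ki].
have [ik|kli] := ltnP (rho i) (rho k); first by rewrite Z_trig ?mul0r.
rewrite [X in _ * X]Z_trig ?mulr0 ?bl_st //.
have := rho_st bi bk; have : rho k != rho i by rewrite (inj_eq rho_inj).
lia.
Qed.

Lemma pairing_pivot :
  (forall i j, P i -> P j -> bl i = b -> bl j = b -> pairing b Z i j = 0) ->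
  forall i, P i -> bl i = b -> ~~ P (st i).
Proof.
move=> Z0 i Pi bi; apply/negP => Psi; have := pairing_st Pi Psi bi.
by rewrite Z0 ?bl_st // => /eqP; rewrite eq_sym oner_eq0.
Qed.

(* The equation pairing b Z i j = 0, for rho i <= rho j, solved for the       *)
(* entry Z j (st i).                                                          *)
Definition pairing_sol (Y : 'M[C]_n) j i : C :=
  - ((if i == j then 2%:R^-1 else 1) *
     ((if i == j then 0 else Y i (st j)) +
      \sum_(k | (bl k == b) && (rho (st j) < rho k < rho i)%N)
        Y i k * Y j (st k))).

Hypothesis two_neq0 : 2%:R != 0 :> C.

(** The ends k = i and k = st j of the range contribute Z j (st i) and Z i (st j); for i = j they
    are equal, whence the factor 2. By symmetry rho i <= rho j may be assumed. When rho i <= rho (st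
    j) the equation is automatic, as i = st j is excluded by hypothesis. *)
Lemma pairing_solE : (forall i, P i -> bl i = b -> ~~ P (st i)) ->
  (forall i j, P i -> P j -> bl i = b -> bl j = b -> pairing b Z i j = 0) <->
  (forall i j, P i -> P j -> bl i = b -> bl j = b -> (rho i <= rho j)%N ->
     (rho (st i) < rho j)%N -> Z j (st i) = pairing_sol Z j i).
Proof.
move=> nPst.
have expand i j : P i -> P j -> bl i = b -> bl j = b -> (rho (st j) < rho i)%N ->
    pairing b Z i j = Z j (st i) + Z i (st j) +
      \sum_(k | (bl k == b) && (rho (st j) < rho k < rho i)%N) Z i k * Z j (st k).
  move=> Pi Pj bi bj lt; rewrite /pairing block_formE (bigD1 i) ?bi //=.
  have ij : st j != i by apply: contraTneq Pi => <-; apply: nPst.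
  rewrite (bigD1 (st j)) ?bl_st ?bj ?eqxx //= stK !Z_diag // mul1r mulr1 addrA.
  congr (_ + _); rewrite big_mkcond [RHS]big_mkcond /=; apply: eq_bigr => k _.
  have [/eqP bk|//] := boolP (bl k == b) => /=.
  have [->|ki] := eqVneq k i; first by rewrite ltnn andbF.
  have [->|kj] := eqVneq k (st j); first by rewrite ltnn.
  have rki : rho k != rho i by rewrite (inj_eq rho_inj).
  have rkj : rho k != rho (st j) by rewrite (inj_eq rho_inj).
  have [//|] := boolP (rho (st j) < rho k < rho i)%N.
  rewrite negb_and -!leqNgt => /orP[le|le].
    rewrite [X in _ * X]Z_trig ?mulr0 ?bl_st //.
    by have := rho_st bj bk; lia.
  by rewrite Z_trig ?mul0r //; lia.
have solE i j : P i -> P j -> bl i = b -> bl j = b -> (rho (st j) < rho i)%N ->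
    pairing b Z i j = 0 <-> Z j (st i) = pairing_sol Z j i.
  move=> Pi Pj bi bj lt; rewrite expand // /pairing_sol.
  case: eqVneq => [<-|ij].
    set S := \sum_(_ | _) _; rewrite add0r; split=> [E|->].
      apply: (mulfI two_neq0); rewrite mulrN mulrA mulfV // mul1r.
      by apply/eqP; rewrite -subr_eq0 opprK mulr2n mulrDl !mul1r E.
    by field.
  set S := \sum_(_ | _) _; rewrite mul1r; split=> [/eqP|->].
    by rewrite -addrA addr_eq0 => /eqP.
  by rewrite -addrA addNr.
split=> [Z0 i j Pi Pj bi bj le lt|Zsol i j Pi Pj bi bj].
  apply/solE => //; last exact: Z0.
  by have := rho_st bi bj; lia.
wlog le : i j Pi Pj bi bj / (rho i <= rho j)%N => [H|].
  have [le|le] := leqP (rho i) (rho j); first exact: H.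
  by rewrite /pairing block_form_sym; apply: H => //; apply: ltnW.
have [lt|ge] := ltnP (rho (st j)) (rho i).
  apply/solE => //; apply: Zsol => //; by have := rho_st bi bj; lia.
apply: pairing_eq0 => //; rewrite ltn_neqAle ge andbT (inj_eq rho_inj).
by apply: contraTneq Pi => ->; apply: nPst.
Qed.

End Unitriangular.
End RowPairings.

(** * Reduced echelon matrices *)

Section Reduced.
Variables (C : fieldType) (n : nat).
Implicit Types (P : {set 'I_n}) (R : 'M[C]_n).

(** The echelon matrix is kept square, the vector with pivot j being row j. It is then the projector
    onto its row space along the coordinate vectors off P, so membership reads [v *m R = v]. Pivots
    are the last nonzero entries of their rows: the reference flag consists of the initial
    coordinate subspaces. *)
Record reduced P R : Prop := Reduced {
  reduced_row0 : forall j k, j \notin P -> R j k = 0;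
  reduced_pivot : forall j k, j \in P -> k \in P -> R j k = (j == k)%:R;
  reduced_trig : forall j k : 'I_n, (j < k)%N -> R j k = 0 }.

Lemma reduced_idem P R : reduced P R -> R *m R = R.
Proof.
move=> rR; apply/matrixP => j k; rewrite mxE.
have [jP|jP] := boolP (j \in P); last first.
  rewrite (reduced_row0 rR) // big1 // => p _.
  by rewrite (reduced_row0 rR) ?mul0r.
rewrite (bigD1 j) //= (reduced_pivot rR) // eqxx mul1r big1 ?addr0 // => p pj.
have [pP|pP] := boolP (p \in P).
  by rewrite (reduced_pivot rR) // eq_sym (negPf pj) mul0r.
by rewrite [R p k](reduced_row0 rR) ?mulr0.
Qed.

Lemma reduced_subP P R m (v : 'M[C]_(m, n)) :
  reduced P R -> (v <= R)%MS <-> v *m R = v.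
Proof.
move=> rR; split=> [/submxP[D ->]|<-]; last exact: submxMl.
by rewrite -mulmxA (reduced_idem rR).
Qed.

Lemma reduced_mulE P R m (v : 'M[C]_(m, n)) i k : reduced P R ->
  (v *m R) i k = \sum_(j in P) v i j * R j k.
Proof.
move=> rR; rewrite mxE [RHS]big_mkcond; apply: eq_bigr => j _ /=.
by case: ifPn => // jP; rewrite (reduced_row0 rR) ?mulr0.
Qed.

Lemma reduced_mul_pivot P R m (v : 'M[C]_(m, n)) i k : reduced P R ->
  k \in P -> (v *m R) i k = v i k.
Proof.
move=> rR kP; rewrite (reduced_mulE _ _ _ rR) (bigD1 k) //= (reduced_pivot rR) //.
rewrite eqxx mulr1 big1 ?addr0 // => j /andP[jP jk].
by rewrite (reduced_pivot rR) // (negPf jk) mulr0.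
Qed.

Lemma reduced_eq0 P R m (v : 'M[C]_(m, n)) : reduced P R -> (v <= R)%MS ->
  (forall i k, k \in P -> v i k = 0) -> v = 0.
Proof.
move=> rR /(reduced_subP _ rR) vR v0; rewrite -vR; apply/matrixP => i k.
by rewrite (reduced_mulE _ _ _ rR) mxE big1 // => j jP; rewrite v0 ?mul0r.
Qed.

(** Compare [R'] and [R' *m R] at (j, j): every term with p different from j vanishes by
    triangularity of R' or of R, so the pivot 1 requires j in P. *)
Lemma reduced_pivot_subset P P' R R' :
  reduced P' R' -> reduced P R -> (R' <= R)%MS -> P' \subset P.
Proof.
move=> rR' rR sR; apply/fintype.subsetP => j jP'; apply: contraT => jP.
have : R' j j = 0.
  rewrite -[R' in LHS]((reduced_subP _ rR).1 sR) (reduced_mulE _ _ _ rR).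
  rewrite big1 // => p pP; have [jp|pj|/val_inj E] := ltngtP j p.
  - by rewrite (reduced_trig rR') ?mul0r.
  - by rewrite (reduced_trig rR) ?mulr0.
  - by rewrite E pP in jP.
by rewrite (reduced_pivot rR') // eqxx => /eqP; rewrite oner_eq0.
Qed.

Section Flag.
Variables (P P' : {set 'I_n}) (j0 : 'I_n) (R R' : 'M[C]_n).
Hypotheses (PE : P = j0 |: P') (j0P' : j0 \notin P').
Hypotheses (rR : reduced P R) (rR' : reduced P' R').

Let P'P j : j \in P' -> j \in P.
Proof. by rewrite PE !inE => ->; rewrite orbT. Qed.

Let j0P : j0 \in P. Proof. by rewrite PE !inE eqxx. Qed.

Lemma reduced_flagP :
  (R' <= R)%MS <-> (forall j k, j \in P' -> R' j k = R j k + R' j j0 * R j0 k).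
Proof.
have mulE j k : j \in P' -> (R' *m R) j k = R j k + R' j j0 * R j0 k.
  move=> jP'; rewrite (reduced_mulE _ _ _ rR) (bigD1 j0) //= addrC; congr (_ + _).
  have jj0 : j != j0 by apply: contraNneq j0P' => <-.
  rewrite (bigD1 j) /=; last by rewrite P'P.
  rewrite (reduced_pivot rR') // eqxx mul1r big1 ?addr0 // => p /andP[/andP[]].
  rewrite PE !inE => /orP[/eqP->|pP' _ pj]; first by rewrite eqxx.
  by rewrite (reduced_pivot rR') // eq_sym (negPf pj) mul0r.
split=> [/(reduced_subP _ rR) E j k jP'|E]; first by rewrite -mulE // E.
apply/(reduced_subP _ rR)/matrixP => j k.
have [jP'|jP'] := boolP (j \in P'); first by rewrite mulE // -E.
by rewrite !mxE (reduced_row0 rR') // big1 // => p _; rewrite (reduced_row0 rR') ?mul0r.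
Qed.

(** The difference v - v R' lies in the row space of R and vanishes at the pivots in P', so only the
    pivot j0 remains to be tested. *)
Lemma reduced_flag_subP m (v : 'M[C]_(m, n)) : (R' <= R)%MS ->
  (v <= R')%MS <-> (v <= R)%MS /\ forall i, (v *m R') i j0 = v i j0.
Proof.
move=> sR; split=> [vR'|[vR vj0]].
  by split=> [|i]; [exact: submx_trans sR | rewrite ((reduced_subP _ rR').1 vR')].
apply/(reduced_subP _ rR')/eqP; rewrite -subr_eq0; apply/eqP.
apply: (reduced_eq0 rR) => [|i k].
  rewrite addmx_sub ?eqmx_opp //; exact: submx_trans (submxMl _ _) sR.
rewrite PE !inE => /orP[/eqP->|kP']; rewrite [LHS]mxE [X in _ + X]mxE.
  by rewrite vj0 subrr.
by rewrite (reduced_mul_pivot _ _ rR') // subrr.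
Qed.

End Flag.
End Reduced.

(** * The equations of a cell *)

Section CellEquations.
Variables (C : fieldType) (n : nat) (bl : 'I_n -> nat) (st : 'I_n -> 'I_n).
Hypothesis stK : involutive st.
Hypothesis bl_st : forall i, bl (st i) = bl i.
Hypothesis bl_mono : forall i j : 'I_n, (i <= j)%N -> (bl i <= bl j)%N.
Implicit Types (P : {set 'I_n}) (R : 'M[C]_n).

Local Notation D b := (block_form C bl st b).

Let bl_lt (i j : 'I_n) : (bl i < bl j)%N -> (i < j)%N.
Proof. by move=> lt; rewrite ltnNge; apply: contraL lt => /bl_mono; rewrite -leqNgt. Qed.

Definition low (y : 'rV[C]_n) := forall k, (1 < bl k)%N -> y 0 k = 0.

Definition isotropic_rows R := forall u v : 'rV[C]_n,
  (u <= R)%MS -> (v <= R)%MS -> (u *m D 2 *m v^T) 0 0 = 0.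

(** The condition [x P^perp <= U] in coordinates: X contains the orthogonal in K1 of the part of R
    lying in K1. *)
Definition perp_sub (X R : 'M[C]_n) := forall y : 'rV[C]_n, low y ->
  (forall u : 'rV[C]_n, (u <= R)%MS -> low u -> (y *m D 1 *m u^T) 0 0 = 0) ->
  (y <= X)%MS.

(** As u (1 - R) = 0 on the row space of R, the columns off P of 1 - R span its annihilator; [D 1]
    turns these functionals into vectors of block 1. *)
Definition perp_rows R := (1%:M - R)^T *m D 1.

Lemma perp_rowsE R k p :
  perp_rows R k p = if bl p == 1%N then (st p == k)%:R - R (st p) k else 0.
Proof.
rewrite mxE (bigD1 (st p)) //= !mxE stK eqxx andbT bl_st big1 ?addr0.
  by case: ifP => _; rewrite ?mulr1 ?mulr0.
move=> q qp; rewrite !mxE.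
have -> : (p == st q) = false by apply: contra_neqF qp => /eqP->; rewrite stK.
by rewrite andbF mulr0.
Qed.

(** The orthogonal is spanned by block 0, the radical, and by the perp rows at indices of block 1
    off P. The coordinates of y dual to nonpivots are the coefficients; those dual to pivots are
    then forced by orthogonality to the rows of R. *)
Lemma perp_subP P R X : reduced P R -> perp_sub X R <->
  (forall i, bl i = 0%N -> (delta_mx (0 : 'I_1) i <= X)%MS) /\
  (forall k, bl k = 1%N -> k \notin P -> (row k (perp_rows R) <= X)%MS).
Proof.
move=> rR; split=> [pX|[X0 X1] y ly yR].
  split=> [i bi|k bk kP]; apply: pX.
  - move=> k bk; rewrite mxE eqxx /=; case: eqVneq => // ki.
    by rewrite ki bi in bk.
  - move=> u _ _; rewrite block_formE big1 // => p /eqP bp; rewrite mxE eqxx /=.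
    by case: eqVneq => [pi|_]; rewrite ?mul0r //; rewrite pi bi in bp.
  - by move=> p bp; rewrite mxE perp_rowsE; case: eqP bp => // ->.
  - move=> u uR lu; rewrite block_formE.
    have : (u *m (1%:M - R)) 0 k = 0.
      by rewrite mulmxBr mulmx1 ((reduced_subP _ rR).1 uR) subrr mxE.
    rewrite mxE => E; rewrite -[RHS]E (reindex_inj (inv_inj stK)) /= big_mkcond /=.
    apply: eq_bigr => p _; rewrite mxE perp_rowsE bl_st stK.
    case: eqP => [_|/eqP bp]; first by rewrite !mxE mulrC.
    have [lp|gp] := ltnP (bl p) 1; last by rewrite lu ?mul0r //; lia.
    have pk : (p < k)%N by apply: bl_lt; rewrite bk.
    rewrite !mxE (reduced_trig rR) // subr0.
    by case: eqVneq pk => [->|_]; rewrite ?ltnn ?mulr0.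
have -> : y = \sum_(i | bl i == 0%N) y 0 i *: delta_mx 0 i +
    \sum_(k | (bl k == 1%N) && (k \notin P)) y 0 (st k) *: row k (perp_rows R).
  apply/rowP => p; rewrite mxE !summxE.
  have S0 : \sum_(i | bl i == 0%N) (y 0 i *: delta_mx (0 : 'I_1) i) 0 p =
      if bl p == 0%N then y 0 p else 0.
    rewrite big_mkcond (bigD1 p) //= !mxE !eqxx mulr1 big1 ?addr0 // => i ip.
    by rewrite !mxE [p == i]eq_sym (negPf ip) andbF mulr0; case: ifP.
  have [bp|bp] := eqVneq (bl p) 1%N; last first.
    rewrite S0 [X in _ + X]big1 ?addr0 => [|k _]; last first.
      by rewrite mxE [X in _ * X]mxE perp_rowsE (negPf bp) mulr0.
    by case: eqP => // /eqP bp0; rewrite ly //; lia.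
  rewrite S0 bp add0r.
  under eq_bigr do rewrite mxE [X in _ * X]mxE perp_rowsE bp eqxx.
  have [spP|spP] := boolP (st p \in P); last first.
    rewrite (bigD1 (st p)) /=; last by rewrite bl_st bp eqxx.
    rewrite stK eqxx (reduced_row0 rR) // subr0 mulr1 big1 ?addr0 // => k.
    move=> /andP[_ kp]; rewrite (reduced_row0 rR) // subr0.
    by rewrite eq_sym (negPf kp) mulr0.
  have : (y *m D 1 *m (row (st p) R)^T) 0 0 = 0.
    apply: yR; first exact: row_sub.
    move=> k bk; rewrite mxE (reduced_trig rR) //.
    by apply: bl_lt; rewrite bl_st bp.
  rewrite block_form_sym // block_formE (bigD1 (st p)) /=; last by rewrite bl_st bp.
  rewrite mxE (reduced_pivot rR) // eqxx mul1r stK => /eqP.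
  rewrite addr_eq0 => /eqP->; rewrite -sumrN.
  rewrite big_mkcond [RHS]big_mkcond /=; apply: eq_bigr => k _.
  case: ifP => [/andP[bk ksp]|].
    rewrite bk /= mxE; case: ifPn => [kP|].
      rewrite eq_sym (negPf ksp) sub0r mulrN mulrC //.
    rewrite negbK => kP; rewrite (reduced_pivot rR) // eq_sym (negPf ksp).
    by rewrite mul0r oppr0.
  move=> /negbT; rewrite negb_and; case: ifP => // /andP[-> kP] /=.
  rewrite negbK => /eqP ksp; rewrite ksp spP in kP; by [].
apply: addmx_sub; apply: summx_sub => k.
  by move=> /eqP bk; apply: scalemx_sub; apply: X0.
by move=> /andP[/eqP bk kP]; apply: scalemx_sub; apply: X1.
Qed.

Lemma delta_sub_reducedP P R : reduced P R ->
  (forall i, bl i = 0%N -> (delta_mx (0 : 'I_1) i <= R)%MS) <->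
  (forall i, bl i = 0%N -> i \in P).
Proof.
move=> rR; split=> [dR i bi|eP i bi].
  apply: contraT => iP; have := (reduced_subP _ rR).1 (dR i bi).
  rewrite -rowE => /rowP/(_ i); rewrite [LHS]mxE (reduced_row0 rR) //.
  by rewrite mxE !eqxx => /esym/eqP; rewrite oner_eq0.
apply/(reduced_subP _ rR)/rowP => k; rewrite -rowE !mxE eqxx /=.
have iP := eP i bi; have [ik|ki|/val_inj E] := ltngtP i k.
- by rewrite (reduced_trig rR) //; case: eqVneq ik => // ->; rewrite ltnn.
- have bk : bl k = 0%N.
    by have := bl_mono (ltnW ki); rewrite bi leqn0 => /eqP.
  by rewrite (reduced_pivot rR) ?eP // eq_sym.
- by rewrite -E (reduced_pivot rR) // eqxx.
Qed.

(** For w the k-th perp row, these pairings are the entries of w - w R. They vanish automatically at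
    pivots, which include block 0, and by triangularity beyond block 1. So the condition becomes
    isotropy of the rows off P of [(1%:M - R)^T]. *)
Lemma perp_row_subP P R k : reduced P R -> (forall i, bl i = 0%N -> i \in P) ->
  bl k = 1%N ->
  (row k (perp_rows R) <= R)%MS <->
  (forall l, bl l = 1%N -> l \notin P -> pairing bl st 1 (1%:M - R)^T k l = 0).
Proof.
move=> rR eP bk.
have E l : pairing bl st 1 (1%:M - R)^T k l =
    row k (perp_rows R) 0 l - (row k (perp_rows R) *m R) 0 l.
  rewrite /pairing trmxK -/(perp_rows R) mulmxBr mulmx1 -row_mul.
  by rewrite [LHS]mxE [X in _ + X]mxE [row k _ 0 l]mxE [row k (_ *m _) 0 l]mxE.
split=> [/(reduced_subP _ rR) wR l _ _|w0].
  by rewrite E wR subrr.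
apply/(reduced_subP _ rR)/rowP => l; apply/eqP; rewrite eq_sym -subr_eq0 -E.
have [lP|lP] := boolP (l \in P).
  by rewrite E (reduced_mul_pivot _ _ rR) // subrr.
have [bl1|bl1] := eqVneq (bl l) 1%N; first by rewrite w0.
rewrite /pairing block_formE big1 // => q /eqP bq.
have ql : (st q < l)%N.
  apply: bl_lt; rewrite bl_st bq.
  case: (bl l) bl1 (eP l) => [_ /(_ erefl)|[|]//]; by rewrite (negPf lP).
suff -> : (1%:M - R)^T l (st q) = 0 by rewrite mulr0.
rewrite !mxE (reduced_trig rR) // subr0.
by case: eqVneq ql => // ->; rewrite ltnn.
Qed.

End CellEquations.

(** * Polynomial parametrizations of sets of pairs of matrices *)

Section Parametrization.
Variables (C : fieldType) (n : nat).

Definition polymx d p q (y : 'rV[C]_d -> 'M[C]_(p, q)) :=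
  forall i j, polyfun (fun z => y z i j).

(* A set of pairs of matrices which is the graph of a polynomial map over a   *)
(* space of entries of these matrices.                                        *)
Definition polynomial_graph (V : 'M[C]_n -> 'M[C]_n -> Prop) :=
  exists d (A B : 'rV[C]_d -> 'M[C]_n) (c : 'I_d -> bool * ('I_n * 'I_n)),
    let entry (X Y : 'M[C]_n) i := (if (c i).1 then X else Y) (c i).2.1 (c i).2.2 in
    [/\ polymx A, polymx B,
        forall z, V (A z) (B z) /\ forall i, entry (A z) (B z) i = z 0 i &
        forall X Y, V X Y ->
          X = A (\row_i entry X Y i) /\ Y = B (\row_i entry X Y i)].

Variables (elim : rel 'I_n) (rk : 'I_n -> 'I_n -> nat).
Variables (F : 'I_n -> 'I_n -> 'M[C]_n -> C) (sel : rel 'I_n).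
Variables (A B : 'M[C]_n -> 'M[C]_n) (V : 'M[C]_n -> 'M[C]_n -> Prop).

Let pick (X Y : 'M[C]_n) : 'M[C]_n := \matrix_(j, k) (if sel j k then X else Y) j k.

(** [pick] gathers coordinates of the pair in a single matrix, taking each entry from one of the
    two; [A] and [B] rebuild the pair. [triangular_system] then applies to the gathered entries. *)
Lemma polynomial_graph_of_system :
  (forall p k, elim p k -> forall d (y : 'rV[C]_d -> 'M[C]_n), polymx y ->
     polyfun (fun z => F p k (y z))) ->
  (forall p k (y y' : 'M[C]_n), elim p k ->
     (forall q l, ~~ elim q l || (rk q l < rk p k)%N -> y q l = y' q l) ->
     F p k y = F p k y') ->
  (forall d (y : 'rV[C]_d -> 'M[C]_n), polymx y -> polymx (fun z => A (y z))) ->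
  (forall d (y : 'rV[C]_d -> 'M[C]_n), polymx y -> polymx (fun z => B (y z))) ->
  (forall X Y, V X Y ->
     [/\ forall p k, elim p k -> pick X Y p k = F p k (pick X Y),
         A (pick X Y) = X & B (pick X Y) = Y]) ->
  (forall y : 'M[C]_n, (forall p k, elim p k -> y p k = F p k y) ->
     V (A y) (B y) /\ pick (A y) (B y) = y) ->
  polynomial_graph V.
Proof.
move=> Fpoly Fdep Apoly Bpoly V_sys sys_V.
pose mx (y : 'I_n * 'I_n -> C) : 'M[C]_n := \matrix_(j, k) y (j, k).
have [||d [theta [c [th_poly th_sol th_c th_uniq]]]] :=
  @triangular_system C ('I_n * 'I_n)%type (fun t => elim t.1 t.2)
    (fun t => rk t.1 t.2) (fun t y => F t.1 t.2 (mx y)).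
- move=> [p k] /= e d y yp; apply: Fpoly => // i j.
  by apply: eq_polyfun (yp (i, j)) => z; rewrite mxE.
- move=> [p k] y y' /= e E; apply: Fdep => // q l /(E (q, l)).
  by rewrite !mxE.
pose M z := mx (theta z).
have M_poly : polymx M.
  by move=> i j; apply: eq_polyfun (th_poly (i, j)) => z; rewrite mxE.
have M_sol z p k : elim p k -> M z p k = F p k (M z).
  by move=> e; rewrite mxE (th_sol z (p, k)).
exists d, (fun z => A (M z)), (fun z => B (M z)).
exists (fun i => (sel (c i).1 (c i).2, c i)) => /=.
split; [exact: Apoly | exact: Bpoly | move=> z | move=> X Y VXY].
  have [VM E] := sys_V _ (M_sol z); split=> // i.
  rewrite -[X in _ = X]th_c [c i]surjective_pairing.
  have -> : theta z ((c i).1, (c i).2) = M z (c i).1 (c i).2 by rewrite mxE.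
  by move/matrixP/(_ (c i).1 (c i).2): E; rewrite mxE.
have [psys AE BE] := V_sys _ _ VXY.
suff E : pick X Y = M (\row_i (if sel (c i).1 (c i).2 then X else Y) (c i).1 (c i).2).
  by rewrite -E AE BE.
apply/matrixP => p k; rewrite [RHS]mxE.
have := th_uniq (fun t => pick X Y t.1 t.2).
have mxK : mx (fun t => pick X Y t.1 t.2) = pick X Y.
  by apply/matrixP => j l; rewrite mxE.
rewrite mxK => /(_ _ (p, k)) /= ->; last by case=> q l; apply: psys.
by congr (theta _ _); apply/rowP => i; rewrite !mxE.
Qed.

End Parametrization.

Section PairingSol.
Variables (C : fieldType) (n : nat) (bl : 'I_n -> nat) (st : 'I_n -> 'I_n).
Variables (b : nat) (rho : 'I_n -> nat).

Lemma polyfun_pairing_sol d (y : 'rV[C]_d -> 'M[C]_n) j i : polymx y ->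
  polyfun (fun z => pairing_sol bl st b rho (y z) j i).
Proof.
move=> yp; apply/polyfunN/polyfunM; first exact: polyfun_const.
apply: polyfunD; first by case: eqP => _; [exact: polyfun_const|exact: yp].
by apply: polyfun_sum => k; apply: polyfunM; apply: yp.
Qed.

Lemma eq_pairing_sol (Y Y' : 'M[C]_n) j i :
  (i != j -> Y i (st j) = Y' i (st j)) ->
  (forall k, bl k = b -> (rho (st j) < rho k < rho i)%N ->
     Y i k = Y' i k /\ Y j (st k) = Y' j (st k)) ->
  pairing_sol bl st b rho Y j i = pairing_sol bl st b rho Y' j i.
Proof.
move=> E1 E2; rewrite /pairing_sol; congr (- (_ * (_ + _))).
  by case: eqVneq E1 => // _; apply.
by apply: eq_bigr => k /andP[/eqP bk lt]; have [-> ->] := E2 k bk lt.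
Qed.

End PairingSol.

(** * The pieces of the two kinds of fibres with prescribed pivots *)

Section Cells.
Variables (C : fieldType) (n : nat) (bl : 'I_n -> nat) (st : 'I_n -> 'I_n).
Hypothesis two_neq0 : 2%:R != 0 :> C.
Hypothesis stK : involutive st.
Hypothesis bl_st : forall i, bl (st i) = bl i.
Hypothesis bl_le2 : forall i, (bl i <= 2)%N.
Hypothesis bl_mono : forall i j : 'I_n, (i <= j)%N -> (bl i <= bl j)%N.
Hypothesis st_sum : forall i j, bl i = bl j -> (i + st i = j + st j)%N.
Variables (P P' : {set 'I_n}) (j0 : 'I_n).
Hypotheses (PE : P = j0 |: P') (j0P' : j0 \notin P').

Local Notation D b := (block_form C bl st b).
Local Notation bpairing := (pairing bl st).
Local Notation isotropic_rows := (isotropic_rows bl st).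
Local Notation perp_sub := (perp_sub bl st).
Local Notation perp_rows := (perp_rows bl st).

Let P'P j : j \in P' -> j \in P.
Proof. by rewrite PE !inE => ->; rewrite orbT. Qed.

Let j0P : j0 \in P. Proof. by rewrite PE !inE eqxx. Qed.

Let inP j : (j \in P) = (j == j0) || (j \in P').
Proof. by rewrite PE !inE. Qed.

Definition cell_flag (R' R : 'M[C]_n) :=
  [/\ reduced P' R', reduced P R, (R' <= R)%MS & isotropic_rows R].

(* [perp_sub R' R'] is the condition defining Hess^O, [perp_sub R' R] the one *)
(* defining Hess^E.                                                           *)
Definition cellO R' R := cell_flag R' R /\ perp_sub R' R'.
Definition cellE R' R := cell_flag R' R /\ perp_sub R' R.

(** The places of the gathered matrix not fixed by the echelon shape. The column j0 is among them,
    j0 being no pivot of R'. *)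
Definition entry_region (p k : 'I_n) := [&& p \in P, (k < p)%N & k \notin P'].

Definition shape (y : 'M[C]_n) :=
  forall p k, ~~ entry_region p k -> y p k = ((p == k) && (p \in P))%:R.

Lemma shape_diag y p : shape y -> p \in P -> y p p = 1.
Proof. by move=> sy pP; rewrite sy ?eqxx ?pP // /entry_region ltnn andbF. Qed.

Lemma shape_row0 y p k : shape y -> p \notin P -> y p k = 0.
Proof. by move=> sy pP; rewrite sy /entry_region (negPf pP) ?andbF. Qed.

Lemma shape_trig y (p k : 'I_n) : shape y -> (p < k)%N -> y p k = 0.
Proof.
move=> sy lt; rewrite sy /entry_region; last by rewrite ltnNge (ltnW lt) andbF.
by case: eqVneq lt => // ->; rewrite ltnn.
Qed.

Lemma shape_pivot y p k : shape y -> p \in P -> k \in P' -> y p k = (p == k)%:R.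
Proof. by move=> sy pP kP'; rewrite sy /entry_region ?kP' ?pP ?andbT ?andbF. Qed.

(* Coordinates y on pairs (R', R). For O: the rows of R' and the row j0 of R. *)
(* For E: the entries of R, the slots (j, j0), which vanish in R, holding the *)
(* coefficients of the row j0 of R in the rows of R'.                         *)

Definition lowerO (y : 'M[C]_n) : 'M[C]_n :=
  \matrix_(j, k) if j \in P' then y j k else 0.
Definition upperO (y : 'M[C]_n) : 'M[C]_n :=
  \matrix_(j, k) if j \in P' then y j k - y j j0 * y j0 k else y j k.
Definition mergeO (R' R : 'M[C]_n) : 'M[C]_n :=
  \matrix_(j, k) (if j \in P' then R' else R) j k.

Definition upperE (y : 'M[C]_n) : 'M[C]_n :=
  \matrix_(j, k) if (k == j0) && (j != j0) then 0 else y j k.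
Definition lowerE (y : 'M[C]_n) : 'M[C]_n :=
  \matrix_(j, k) if j \in P' then upperE y j k + y j j0 * upperE y j0 k else 0.
Definition mergeE (R' R : 'M[C]_n) : 'M[C]_n :=
  \matrix_(j, k) (if (k == j0) && (j != j0) then R' else R) j k.

Let j0j j : j \in P' -> (j == j0) = false.
Proof. by move=> jP'; apply: contraNF j0P' => /eqP<-. Qed.

Lemma flag_of_shapeO y : shape y ->
  [/\ reduced P' (lowerO y), reduced P (upperO y), (lowerO y <= upperO y)%MS &
      mergeO (lowerO y) (upperO y) = y].
Proof.
move=> sy; have rL : reduced P' (lowerO y).
  split=> j k; rewrite mxE; first by move/negPf->.
    by move=> jP' kP'; rewrite jP' (shape_pivot sy) // P'P.
  by move=> lt; rewrite (shape_trig sy) ?if_same.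
have rU : reduced P (upperO y).
  split=> j k; rewrite mxE.
  - move=> jP; have -> : (j \in P') = false by apply: contraNF jP; apply: P'P.
    by rewrite (shape_row0 _ sy).
  - rewrite !inP; case: eqVneq => [-> _|jj0 /= jP'].
      rewrite (negPf j0P'); case: eqVneq => [-> _|kj0 /= kP'].
        by rewrite (shape_diag sy) // eqxx.
      by rewrite (shape_pivot sy) // [j0 == k]eq_sym (negPf kj0).
    rewrite jP'; case: eqVneq => [-> _|kj0 /= kP'].
      by rewrite (shape_diag sy) // mulr1 subrr (negPf jj0).
    rewrite (shape_pivot sy (P'P jP') kP') (shape_pivot sy j0P kP').
    by rewrite [j0 == k]eq_sym (negPf kj0) mulr0 subr0.
  - move=> lt; rewrite (shape_trig sy lt); case: ifP => // _.
    have [lt'|le] := ltnP j j0; first by rewrite (shape_trig sy lt') mul0r subrr.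
    by rewrite (shape_trig sy (leq_ltn_trans le lt)) mulr0 subrr.
split=> //.
  apply/(reduced_flagP PE j0P' rU rL) => j k jP'.
  by rewrite !mxE jP' (negPf j0P') subrK.
by apply/matrixP => j k; rewrite !mxE; case: ifP => jP'; rewrite mxE jP'.
Qed.

Lemma shapeO_of_flag R' R :
  reduced P' R' -> reduced P R -> (R' <= R)%MS ->
  [/\ shape (mergeO R' R), lowerO (mergeO R' R) = R' & upperO (mergeO R' R) = R].
Proof.
move=> rR' rR /(reduced_flagP PE j0P' rR rR') sR; split.
- move=> p k; rewrite mxE /entry_region; have [pP|pP] := boolP (p \in P); last first.
    move=> _; rewrite andbF ifN ?(reduced_row0 rR) //; exact: contra (@P'P p) pP.
  rewrite /= andbT negb_and negbK -leqNgt => /orP[|kP'].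
    rewrite leq_eqVlt => /orP[/eqP/val_inj <-|lt].
      by case: ifP => [pP'|_]; rewrite ?(reduced_pivot rR') ?(reduced_pivot rR).
    have pk : (p == k) = false by apply: contraTF lt => /eqP->; rewrite ltnn.
    by case: ifP => _; rewrite pk ?(reduced_trig rR') ?(reduced_trig rR).
  case: ifP => [pP'|_]; rewrite ?(reduced_pivot rR') ?(reduced_pivot rR) //.
  exact: P'P.
- apply/matrixP => j k; rewrite !mxE; have [//|jP'] := boolP (j \in P').
  by rewrite (reduced_row0 rR').
- apply/matrixP => j k; rewrite !mxE (negPf j0P').
  by have [jP'|//] := boolP (j \in P'); rewrite sR // addrK.
Qed.

Lemma flag_of_shapeE y : shape y ->
  [/\ reduced P' (lowerE y), reduced P (upperE y), (lowerE y <= upperE y)%MS &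
      mergeE (lowerE y) (upperE y) = y].
Proof.
move=> sy.
have rU : reduced P (upperE y).
  split=> j k; rewrite mxE.
  - by move=> jP; rewrite (shape_row0 _ sy) ?if_same.
  - rewrite !inP; case: (eqVneq k j0) => [->|kj0] /=.
      by case: eqVneq => //= -> _; rewrite (shape_diag sy).
    by move=> jP kP'; rewrite (shape_pivot sy) // inP.
  - by move=> lt; rewrite (shape_trig sy lt) if_same.
have rL : reduced P' (lowerE y).
  split=> j k; rewrite mxE; first by move/negPf->.
    move=> jP' kP'; rewrite jP' (reduced_pivot rU (P'P jP') (P'P kP')).
    by rewrite (reduced_pivot rU j0P (P'P kP')) [j0 == k]eq_sym j0j // mulr0 addr0.
  move=> lt; case: ifP => // _; rewrite (reduced_trig rU lt) add0r.
  have [lt'|le] := ltnP j j0; first by rewrite (shape_trig sy lt') mul0r.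
  by rewrite (reduced_trig rU (leq_ltn_trans le lt)) mulr0.
have yj0 j : j \in P' -> lowerE y j j0 = y j j0.
  move=> jP'; rewrite mxE jP' (reduced_pivot rU (P'P jP') j0P).
  by rewrite (reduced_pivot rU j0P j0P) eqxx mulr1 j0j // add0r.
split=> //.
  apply/(reduced_flagP PE j0P' rU rL) => j k jP'.
  by rewrite yj0 // [LHS]mxE jP'.
apply/matrixP => j k; rewrite mxE; case: ifPn => [/andP[/eqP-> jj0]|nj].
  have [jP'|jP'] := boolP (j \in P'); first by rewrite yj0.
  by rewrite mxE (negPf jP') (shape_row0 _ sy) // inP negb_or jj0.
by rewrite mxE (negPf nj).
Qed.

Lemma shapeE_of_flag R' R :
  reduced P' R' -> reduced P R -> (R' <= R)%MS ->
  [/\ shape (mergeE R' R), lowerE (mergeE R' R) = R' & upperE (mergeE R' R) = R].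
Proof.
move=> rR' rR /(reduced_flagP PE j0P' rR rR') sR.
have UE : upperE (mergeE R' R) = R.
  apply/matrixP => j k; rewrite !mxE.
  have [/andP[/eqP-> jj0]|//] := boolP ((k == j0) && (j != j0)).
  have [jP|jP] := boolP (j \in P); last by rewrite (reduced_row0 rR).
  by rewrite (reduced_pivot rR) // (negPf jj0).
split=> //.
- move=> p k; rewrite mxE /entry_region; have [pP|pP] := boolP (p \in P); last first.
    move=> _; rewrite andbF; case: ifP => _; rewrite ?(reduced_row0 rR) //.
    by rewrite (reduced_row0 rR') //; apply: contra (@P'P p) pP.
  rewrite /= andbT negb_and negbK -leqNgt => /orP[|kP'].
    rewrite leq_eqVlt => /orP[/eqP/val_inj <-|lt].
      by rewrite andbN (reduced_pivot rR).
    have pk : (p == k) = false by apply: contraTF lt => /eqP->; rewrite ltnn.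
    by case: ifP => _; rewrite pk ?(reduced_trig rR') ?(reduced_trig rR).
  by rewrite j0j //= (reduced_pivot rR) // P'P.
- apply/matrixP => j k; rewrite mxE UE mxE eqxx /=; case: ifPn => jP'.
    by rewrite j0j //= -sR.
  by rewrite (reduced_row0 rR').
Qed.

Let val_rho : injective (fun i : 'I_n => val i) := val_inj.

(** [(1%:M - R)^T] is triangular in the opposite sense; reversing the order makes the lemmas on
    pairings apply to it. *)
Let rev_rho (i : 'I_n) := (n - i)%N.

Let rev_rho_inj : injective rev_rho.
Proof.
move=> i j; rewrite /rev_rho => E; apply: val_inj => /=.
by have := ltn_ord i; have := ltn_ord j; lia.
Qed.

Let rho_st b (i j : 'I_n) : bl i = b -> bl j = b -> (i + st i = j + st j)%N.
Proof. by move=> bi bj; apply: st_sum; rewrite bi bj. Qed.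

Let rev_rho_st b (i j : 'I_n) : bl i = b -> bl j = b ->
  (rev_rho i + rev_rho (st i) = rev_rho j + rev_rho (st j))%N.
Proof.
move=> bi bj; have := rho_st bi bj; rewrite /rev_rho.
by move: (ltn_ord i) (ltn_ord (st i)) (ltn_ord j) (ltn_ord (st j)); lia.
Qed.

(** By triangularity, only rows with pivot in block 2 have entries in block 2, so only their
    pairings matter. *)
Lemma isotropic_rowsP (Z R : 'M[C]_n) : (Z <= R)%MS -> (R <= Z)%MS ->
  (forall j k, j \notin P -> Z j k = 0) ->
  (forall j k : 'I_n, (j < k)%N -> Z j k = 0) ->
  isotropic_rows R <->
  (forall i j, i \in P -> j \in P -> bl i = 2%N -> bl j = 2%N ->
     bpairing 2 Z i j = 0).
Proof.
move=> ZR RZ Z0 Zt; split=> [iR i j _ _ _ _|Z2 u v uR vR].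
  rewrite -(iR (row i Z) (row j Z)); first last.
  - exact: submx_trans (row_sub _ _) ZR.
  - exact: submx_trans (row_sub _ _) ZR.
  rewrite /pairing !block_formE; apply: eq_bigr => k _; by rewrite !mxE.
have ZZ : Z *m D 2 *m Z^T = 0.
  have row0 i k : bl k = 2%N -> (i \notin P) || (bl i != 2%N) -> Z i k = 0.
    move=> bk /orP[iP|bi]; first by rewrite Z0.
    apply: Zt; rewrite ltnNge; apply: contra bi => /bl_mono.
    by rewrite bk eqn_leq bl_le2.
  apply/matrixP => i j; rewrite [RHS]mxE.
  have [ij|] := boolP [&& i \in P, j \in P, bl i == 2%N & bl j == 2%N].
    by case/and4P: ij => iP jP /eqP bi /eqP bj; apply: Z2.
  have [i0 _|] := boolP ((i \notin P) || (bl i != 2%N)).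
    by rewrite block_formE big1 // => k /eqP bk; rewrite row0 ?mul0r.
  rewrite negb_or !negbK => /andP[-> ->] /= j0'.
  rewrite block_formE big1 // => k /eqP bk; rewrite [Z j _]row0 ?mulr0 ?bl_st //.
  by rewrite -negb_and.
have /submxP[a ->] := submx_trans uR RZ.
have /submxP[c ->] := submx_trans vR RZ.
rewrite trmx_mul -!mulmxA (mulmxA (D 2)) (mulmxA Z) (mulmxA Z) ZZ.
by rewrite mul0mx mulmx0 mxE.
Qed.

Lemma reduced_isotropic_pivot (R : 'M[C]_n) : reduced P R -> isotropic_rows R ->
  forall i, i \in P -> bl i = 2%N -> st i \notin P.
Proof.
move=> rR iR i iP bi.
apply: (@pairing_pivot C n bl st bl_st 2 (fun i => val i) (fun i => i \in P) R) => //.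
- exact: rho_st.
- by move=> k kP; rewrite (reduced_pivot rR) ?eqxx.
- by move=> k l _ _ _; apply: reduced_trig rR _ _.
apply/(isotropic_rowsP (submx_refl R) (submx_refl R)) => //.
  exact: reduced_row0 rR.
exact: reduced_trig rR.
Qed.

Let Zco_diag (Q : {set 'I_n}) (R : 'M[C]_n) : reduced Q R ->
  forall i, i \notin Q -> (1%:M - R)^T i i = 1.
Proof. by move=> rR i iQ; rewrite !mxE eqxx (reduced_row0 rR) ?subr0. Qed.

Let Zco_trig (Q : {set 'I_n}) (R : 'M[C]_n) : reduced Q R ->
  forall i k, i \notin Q -> bl i = 1%N -> bl k = 1%N ->
  (rev_rho i < rev_rho k)%N -> (1%:M - R)^T i k = 0.
Proof.
move=> rR i k _ _ _ lt.
have ki : (k < i)%N by move: lt; rewrite /rev_rho; lia.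
rewrite !mxE (reduced_trig rR) // subr0.
by case: eqVneq ki => // ->; rewrite ltnn.
Qed.

Lemma coisotropic_pivot (Q : {set 'I_n}) (R : 'M[C]_n) : reduced Q R ->
  (forall k l, k \notin Q -> l \notin Q -> bl k = 1%N -> bl l = 1%N ->
     bpairing 1 (1%:M - R)^T k l = 0) ->
  forall i, i \notin Q -> bl i = 1%N -> st i \in Q.
Proof.
move=> rR R0 i iQ bi; rewrite -[_ \in _]negbK.
apply: (@pairing_pivot C n bl st bl_st 1 rev_rho (fun i => i \notin Q) (1%:M - R)^T) => //.
- exact: rev_rho_st.
- exact: Zco_diag.
- exact: Zco_trig.
Qed.

(** The entry (p, k) is the one solved for in the equation pairing rows i = st k and j = p in
    [pairing_solE]. For [co_elim] the rows are i = st p and j = k of [(1%:M - R)^T], whose entry (k,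
    p) is - R p k. *)
Definition iso_elim (p k : 'I_n) :=
  [&& bl p == 2%N, bl k == 2%N, p \in P, st k \in P, (st k <= p)%N & (k < p)%N].
Definition co_elim (Q : {set 'I_n}) (p k : 'I_n) :=
  [&& bl p == 1%N, bl k == 1%N, p \in Q, k \notin Q, st p \notin Q,
      (k <= st p)%N & (k < p)%N].

Definition iso_sol (Z : 'M[C]_n) p k := pairing_sol bl st 2 (fun i => val i) Z p (st k).
Definition co_sol (R : 'M[C]_n) p k :=
  - pairing_sol bl st 1 rev_rho (1%:M - R)^T k (st p).

Lemma iso_solE (Z : 'M[C]_n) :
  (forall i, i \in P -> Z i i = 1) ->
  (forall i k : 'I_n, (i < k)%N -> Z i k = 0) ->
  (forall i, i \in P -> bl i = 2%N -> st i \notin P) ->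
  (forall i j, i \in P -> j \in P -> bl i = 2%N -> bl j = 2%N ->
     bpairing 2 Z i j = 0) <->
  (forall p k, iso_elim p k -> Z p k = iso_sol Z p k).
Proof.
move=> Z1 Zt nP.
have H := @pairing_solE C n bl st stK bl_st 2 (fun i => val i) (fun i => i \in P) Z
  val_rho (@rho_st 2) Z1 (fun i k _ _ _ => Zt i k) two_neq0 nP.
split=> [/H Zs p k|Zs].
  case/and5P=> /eqP bp /eqP bk pP skP /andP[le lt].
  by rewrite -[k in LHS]stK Zs // ?bl_st // ?stK.
apply/H => i j iP jP bi bj le lt; rewrite Zs /iso_sol ?stK //.
by rewrite /iso_elim bj bl_st bi stK jP iP le lt.
Qed.

Lemma co_solE (Q : {set 'I_n}) (R : 'M[C]_n) : reduced Q R ->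
  (forall i, i \notin Q -> bl i = 1%N -> st i \in Q) ->
  (forall k l, k \notin Q -> l \notin Q -> bl k = 1%N -> bl l = 1%N ->
     bpairing 1 (1%:M - R)^T k l = 0) <->
  (forall p k, co_elim Q p k -> R p k = co_sol R p k).
Proof.
move=> rR Qst.
have nQ i : i \notin Q -> bl i = 1%N -> ~~ (st i \notin Q).
  by move=> iQ bi; rewrite negbK Qst.
have H := @pairing_solE C n bl st stK bl_st 1 rev_rho (fun i => i \notin Q)
  (1%:M - R)^T rev_rho_inj (@rev_rho_st 1) (Zco_diag rR) (Zco_trig rR) two_neq0 nQ.
have ZE (p k : 'I_n) : (k < p)%N -> (1%:M - R)^T k p = - R p k.
  by move=> lt; rewrite !mxE; case: eqVneq lt => [->|]; rewrite ?ltnn ?sub0r.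
have revE (i j : 'I_n) : (rev_rho i <= rev_rho j)%N = (j <= i)%N.
  by rewrite /rev_rho; have := ltn_ord i; have := ltn_ord j; lia.
have rev_lt (i j : 'I_n) : (rev_rho i < rev_rho j)%N = (j < i)%N.
  by rewrite ltnNge revE -ltnNge.
split=> [/H Zs p k|Rs].
  case/and5P=> /eqP bp /eqP bk pQ kQ /and3P[spQ le lt].
  apply: oppr_inj; rewrite opprK -ZE // -[p in LHS]stK.
  by apply: Zs; rewrite ?bl_st ?revE ?rev_lt ?stK.
apply/H => i j iQ jQ bi bj; rewrite revE rev_lt => le lt.
rewrite ZE // Rs /co_sol ?opprK ?stK //.
by rewrite /co_elim bl_st bi bj stK Qst // jQ iQ le lt.
Qed.

Section EliminationRank.
Variables (Q : {set 'I_n}) (rk : 'I_n -> 'I_n -> nat).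
Hypothesis rk_le : forall p k, (rk p k <= p - k)%N.
Hypothesis rk0 : forall p k, ~~ (iso_elim p k || co_elim Q p k) -> rk p k = 0%N.
Variables (y y' : 'M[C]_n) (p k : 'I_n).
Hypothesis yE : forall q l, (rk q l < p - k)%N -> y q l = y' q l.

(** The products under the sum involve entries closer to the diagonal than (p, k). The partner (st
    k, st p) is equally far, but it could be eliminated only under the reverse inequality p <= st k.
    The two rows would then coincide, and the partner is absent from the formula. *)
Lemma eq_iso_sol : iso_elim p k -> iso_sol y p k = iso_sol y' p k.
Proof.
case/and5P=> /eqP bp /eqP bk pP skP /andP[le lt].
have S := rho_st bp bk.
apply: eq_pairing_sol => [ne|l bl2 /andP[lt1 lt2]].
  apply: yE; rewrite rk0 ?subn_gt0 //; apply/negP => /orP[]; last first.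
    by case/and5P; rewrite bl_st bk.
  case/and5P=> _ _ _ _ /andP[]; rewrite stK => le' _.
  by case/negP: ne; rewrite -val_eqE eqn_leq le le'.
have S' := rho_st bp bl2; split; apply: yE; apply: leq_ltn_trans (rk_le _ _) _.
  by move: S S' lt1 lt2 => /=; lia.
by move: S S' lt1 lt2 => /=; lia.
Qed.

Lemma eq_co_sol : co_elim Q p k -> co_sol y p k = co_sol y' p k.
Proof.
case/and5P=> /eqP bp /eqP bk pQ kQ /and3P[spQ le lt].
have S := rho_st bp bk; congr (- _).
have ZE a b : y b a = y' b a -> (1%:M - y)^T a b = (1%:M - y')^T a b.
  by move=> E; rewrite !mxE E.
apply: eq_pairing_sol => [ne|l bl1 /andP[lt1 lt2]].
  apply: ZE; apply: yE; rewrite rk0 ?subn_gt0 //; apply/negP => /orP[].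
    by case/and5P; rewrite bl_st bk.
  case/and5P=> _ _ _ _ /and3P[_]; rewrite stK => le' _.
  by case/negP: ne; rewrite -val_eqE eqn_leq le le'.
have S' := rho_st bp bl1.
have := ltn_ord (st p); have := ltn_ord (st k); have := ltn_ord l.
move=> l1 l2 l3; split; apply: ZE; apply: yE; apply: leq_ltn_trans (rk_le _ _) _.
  by move: S S' lt1 lt2; rewrite /rev_rho; lia.
by move: S S' lt1 lt2; rewrite /rev_rho; lia.
Qed.

End EliminationRank.

Lemma polyfun_iso_sol d (y : 'rV[C]_d -> 'M[C]_n) p k : polymx y ->
  polyfun (fun z => iso_sol (y z) p k).
Proof. exact: polyfun_pairing_sol. Qed.

Lemma polymx_coreduced d (y : 'rV[C]_d -> 'M[C]_n) : polymx y ->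
  polymx (fun z => (1%:M - y z)^T).
Proof.
move=> yp i j; apply: (@eq_polyfun _ _ (fun z => (j == i)%:R - y z j i)).
  by move=> z; rewrite !mxE.
by apply: polyfunB => //; apply: polyfun_const.
Qed.

Lemma polyfun_co_sol d (y : 'rV[C]_d -> 'M[C]_n) p k : polymx y ->
  polyfun (fun z => co_sol (y z) p k).
Proof.
by move=> yp; apply/polyfunN/polyfun_pairing_sol/polymx_coreduced.
Qed.

Lemma polymx_lowerO d (y : 'rV[C]_d -> 'M[C]_n) : polymx y ->
  polymx (fun z => lowerO (y z)).
Proof.
move=> yp i j; apply: (@eq_polyfun _ _ (fun z => if i \in P' then y z i j else 0)).
  by move=> z; rewrite !mxE.
by case: (i \in P') => //; apply: polyfun_const.
Qed.

Lemma polymx_upperO d (y : 'rV[C]_d -> 'M[C]_n) : polymx y ->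
  polymx (fun z => upperO (y z)).
Proof.
move=> yp i j; apply: (@eq_polyfun _ _ (fun z =>
  if i \in P' then y z i j - y z i j0 * y z j0 j else y z i j)).
  by move=> z; rewrite !mxE.
by case: (i \in P') => //; apply: polyfunB => //; apply: polyfunM.
Qed.

Lemma polymx_upperE d (y : 'rV[C]_d -> 'M[C]_n) : polymx y ->
  polymx (fun z => upperE (y z)).
Proof.
move=> yp i j; apply: (@eq_polyfun _ _ (fun z =>
  if (j == j0) && (i != j0) then 0 else y z i j)).
  by move=> z; rewrite !mxE.
by case: ((j == j0) && (i != j0)) => //; apply: polyfun_const.
Qed.

Lemma polymx_lowerE d (y : 'rV[C]_d -> 'M[C]_n) : polymx y ->
  polymx (fun z => lowerE (y z)).
Proof.
move=> yp i j; have yu := polymx_upperE yp; apply: (@eq_polyfun _ _ (fun z =>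
  if i \in P' then upperE (y z) i j + y z i j0 * upperE (y z) j0 j else 0)).
  by move=> z; rewrite [RHS]mxE.
case: (i \in P'); last exact: polyfun_const.
by apply: polyfunD => //; apply: polyfunM.
Qed.

(* So for O the pairings of W can be computed on the rows of [mergeO].        *)
Lemma mergeO_eqmx R' R : reduced P' R' -> reduced P R -> (R' <= R)%MS ->
  (mergeO R' R <= R)%MS /\ (R <= mergeO R' R)%MS.
Proof.
move=> rR' rR sR; have E := (reduced_flagP PE j0P' rR rR').1 sR.
have rowM j : row j (mergeO R' R) = row j (if j \in P' then R' else R).
  by apply/rowP => k; rewrite !mxE.
split; apply/row_subP => j.
  rewrite rowM; case: ifP => _; last exact: row_sub.
  exact: submx_trans (row_sub _ _) sR.
have [jP'|jP'] := boolP (j \in P'); last first.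
  by have := row_sub j (mergeO R' R); rewrite rowM (negPf jP').
have -> : row j R = row j (mergeO R' R) - R' j j0 *: row j0 (mergeO R' R).
  rewrite !rowM jP' (negPf j0P'); apply/rowP => k.
  by rewrite !mxE E // addrK.
by rewrite addmx_sub ?row_sub // -scaleNr scalemx_sub ?row_sub.
Qed.

Lemma cellO_equations R' R : cellO R' R <->
  [/\ reduced P' R', reduced P R, (R' <= R)%MS,
      (forall i, bl i = 0%N -> i \in P') &
      (forall i j, i \in P -> j \in P -> bl i = 2%N -> bl j = 2%N ->
         bpairing 2 (mergeO R' R) i j = 0) /\
      (forall k l, k \notin P' -> l \notin P' -> bl k = 1%N -> bl l = 1%N ->
         bpairing 1 (1%:M - R')^T k l = 0)].
Proof.
have isoE : reduced P' R' -> reduced P R -> (R' <= R)%MS -> isotropic_rows R <->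
    (forall i j, i \in P -> j \in P -> bl i = 2%N -> bl j = 2%N ->
       bpairing 2 (mergeO R' R) i j = 0).
  move=> rR' rR sR; have [s1 s2] := mergeO_eqmx rR' rR sR.
  have [sy _ _] := shapeO_of_flag rR' rR sR.
  apply: isotropic_rowsP => // [j k|j k]; [exact: shape_row0 | exact: shape_trig].
have coE : reduced P' R' -> perp_sub R' R' <->
    (forall i, bl i = 0%N -> i \in P') /\
    (forall k l, k \notin P' -> l \notin P' -> bl k = 1%N -> bl l = 1%N ->
         bpairing 1 (1%:M - R')^T k l = 0).
  move=> rR'; rewrite (perp_subP stK bl_st bl_mono R' rR').
  rewrite (delta_sub_reducedP bl_mono rR').
  split=> [[eP w]|[eP w]]; split=> // k.
    move=> l kP lP bk bl1.
    exact: (perp_row_subP bl_st bl_mono rR' eP bk).1 (w k bk kP) l bl1 lP.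
  move=> bk kP; apply/(perp_row_subP bl_st bl_mono rR' eP bk) => l bl1 lP.
  exact: w.
split=> [[[rR' rR sR /isoE iR] /coE pR]|[rR' rR sR eP [iR pR]]].
  by have [//|eP pR'] := pR; split=> //; split=> //; apply: iR.
by split; [split=> //; apply/isoE | apply/coE].
Qed.

(** A point of the piece serves only to obtain the conditions on pivots: no dual pivots in block 2,
    duals of nonpivots of block 1 in P', and block 0 inside P'. Under these, the isotropy and
    orthogonality equations solve for entries in different blocks and are triangular for the
    distance to the diagonal. *)
Theorem cellO_polynomial : (exists R' R, cellO R' R) -> polynomial_graph cellO.
Proof.
move=> [R0' [R0 /[dup] [[[rR0' rR0 sR0 iR0] _]] /cellO_equations[_ _ _ eP [_ coR0]]]].
have nP2 := reduced_isotropic_pivot rR0 iR0.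
have nP1 := coisotropic_pivot rR0' coR0.
pose special p k := iso_elim p k || co_elim P' p k.
pose F p k (y : 'M[C]_n) := if iso_elim p k then iso_sol y p k else
  if co_elim P' p k then co_sol (lowerO y) p k else ((p == k) && (p \in P))%:R.
pose rk (p k : 'I_n) := if special p k then (p - k)%N else 0%N.
have rk_le p k : (rk p k <= p - k)%N by rewrite /rk; case: ifP.
have rk0 p k : ~~ special p k -> rk p k = 0%N by rewrite /rk => /negPf->.
have special_region p k : special p k -> entry_region p k.
  rewrite /entry_region; case/orP.
    case/and5P=> /eqP bp /eqP bk pP skP /andP[_ lt]; rewrite pP lt /=.
    apply: contraL skP => kP'; apply: nP2 => //; exact: P'P.
  by case/and5P=> _ _ pP' kP' /and3P[_ _ lt]; rewrite lt P'P.
apply: (@polynomial_graph_of_system _ _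
  (fun p k => ~~ entry_region p k || special p k) rk F (fun j _ => j \in P')
  lowerO upperO).
- move=> p k _ d y yp; rewrite /F; case: (iso_elim p k); first exact: polyfun_iso_sol.
  case: (co_elim P' p k); last exact: polyfun_const.
  exact/polyfun_co_sol/polymx_lowerO.
- move=> p k y y' _ E; rewrite /F; case: ifP => [ie|_].
    apply: (eq_iso_sol rk_le rk0 _ ie) => q l lt; apply: E; apply/orP; right.
    by rewrite {2}/rk /special ie.
  case: ifP => // ce; apply: (eq_co_sol rk_le rk0 _ ce) => q l lt.
  rewrite !mxE; case: ifP => // _; apply: E; apply/orP; right.
  by rewrite {2}/rk /special ce orbT.
- exact: polymx_lowerO.
- exact: polymx_upperO.
- move=> R' R /cellO_equations[rR' rR sR _ [iR pR]].
  have [sy lE uE] := shapeO_of_flag rR' rR sR.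
  rewrite -/(mergeO R' R); split=> // p k elim_pk; rewrite /F.
  case: ifP => [ie|nie].
    apply: (iso_solE _ _ nP2).1 => // [i|i l]; [exact: shape_diag | exact: shape_trig].
  case: ifP => [ce|nce].
    rewrite lE -(co_solE rR' nP1).1 //.
    by rewrite mxE; case/and5P: ce => _ _ ->.
  by apply: sy; move: elim_pk; rewrite /special nie nce !orbF.
move=> y yF.
have sy : shape y.
  move=> p k npk; rewrite yF ?npk // /F.
  have := contra (@special_region p k) npk.
  by rewrite negb_or => /andP[/negPf-> /negPf->].
have [rL rU sLU mE] := flag_of_shapeO sy.
split=> //; apply/cellO_equations; split=> //; split.
  rewrite mE; apply/iso_solE => // [i|i l|p k ie].
  - exact: shape_diag.
  - exact: shape_trig.
  - by rewrite yF /F ?ie // /special ie orbT.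
apply/(co_solE rL nP1) => p k ce.
have nie : iso_elim p k = false by apply/negP => /andP[]; case/and5P: ce => /eqP->.
rewrite mxE; case/and5P: (ce) => _ _ -> _ _.
by rewrite yF /F ?nie ?ce // /special ce !orbT.
Qed.

Lemma cellE_equations R' R : cellE R' R <->
  [/\ reduced P' R', reduced P R, (R' <= R)%MS,
      (forall i, bl i = 0%N -> i \in P') &
      [/\ forall i j, i \in P -> j \in P -> bl i = 2%N -> bl j = 2%N ->
         bpairing 2 R i j = 0,
        forall k l, k \notin P -> l \notin P -> bl k = 1%N -> bl l = 1%N ->
         bpairing 1 (1%:M - R)^T k l = 0 &
        forall k, k \notin P -> bl k = 1%N ->
         (row k (perp_rows R) *m R') 0 j0 = perp_rows R k j0]].
Proof.
have isoE : reduced P R -> isotropic_rows R <->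
    (forall i j, i \in P -> j \in P -> bl i = 2%N -> bl j = 2%N ->
       bpairing 2 R i j = 0).
  move=> rR; apply: isotropic_rowsP => //; first exact: reduced_row0 rR.
  exact: reduced_trig rR.
have coE : reduced P' R' -> reduced P R -> (R' <= R)%MS -> perp_sub R' R <->
    (forall i, bl i = 0%N -> i \in P') /\
    ((forall k l, k \notin P -> l \notin P -> bl k = 1%N -> bl l = 1%N ->
         bpairing 1 (1%:M - R)^T k l = 0) /\
     (forall k, k \notin P -> bl k = 1%N ->
         (row k (perp_rows R) *m R') 0 j0 = perp_rows R k j0)).
  move=> rR' rR sR; rewrite (perp_subP stK bl_st bl_mono R' rR).
  rewrite (delta_sub_reducedP bl_mono rR').
  have flagP k := reduced_flag_subP PE rR rR' (row k (perp_rows R)) sR.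
  split=> [[eP w]|[eP [w c]]]; split=> //.
    have eP1 i : bl i = 0%N -> i \in P by move/eP; apply: P'P.
    split=> [k l kP lP bk bl1|k kP bk]; have [wk ck] := (flagP k).1 (w k bk kP).
      exact: (perp_row_subP bl_st bl_mono rR eP1 bk).1 wk l bl1 lP.
    by rewrite ck [LHS]mxE.
  move=> k bk kP.
  have eP1 i : bl i = 0%N -> i \in P by move/eP; apply: P'P.
  apply/flagP; split.
    by apply/(perp_row_subP bl_st bl_mono rR eP1 bk) => l bl1 lP; apply: w.
  by move=> i; rewrite ord1 (c k kP bk) [RHS]mxE.
split=> [[[rR' rR sR /isoE iR] /coE pR]|[rR' rR sR eP [iR pR cR]]].
  have [//|//|//|eP [pR' cR]] := pR; split=> //; split=> //; exact: iR.
by split; [split=> //; apply/isoE | apply/coE].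
Qed.

Let lower_sum (R : 'M[C]_n) (c : 'I_n -> C) (p : 'I_n) :=
  \sum_(j | [&& j \in P', bl j == 1%N & (j0 < j < p)%N])
    perp_rows R (st p) j * c j.

(** The terms with j < j0 vanish because R' is triangular, those with j > p because the perp row is.
    So the linear equations are triangular in the unknowns R' p j0, ordered by p. *)
Lemma perp_row_mul_j0 R' R p : reduced P' R' -> reduced P R ->
  p \in P' -> bl p = 1%N -> st p \notin P ->
  (row (st p) (perp_rows R) *m R') 0 j0 =
    R' p j0 + lower_sum R (fun j => R' j j0) p.
Proof.
move=> rR' rR pP' bp spP; rewrite (reduced_mulE _ _ _ rR') (bigD1 p) //=.
rewrite mxE perp_rowsE // bp !eqxx (reduced_row0 rR) // subr0 mul1r.
congr (_ + _); rewrite big_mkcond [RHS]big_mkcond /=; apply: eq_bigr => j _.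
have [jP' /=|//] := boolP (j \in P').
have [->|jp] /= := eqVneq j p; first by rewrite ltnn !andbF.
have [bj /=|bj] := boolP (bl j == 1%N); last first.
  by rewrite mxE perp_rowsE // (negPf bj) mul0r.
have [//|nlt] := boolP (j0 < j < p)%N; first by rewrite mxE.
move: nlt; rewrite negb_and -!leqNgt => /orP[le|le].
  rewrite (reduced_trig rR') ?mulr0 // ltn_neqAle le andbT.
  by apply: contraNneq j0P' => /val_inj <-.
have S := rho_st (eqP bj) bp.
have lt : (st j < st p)%N.
  have : val j != val p by [].
  by move: le S => /=; lia.
rewrite mxE perp_rowsE // bj (reduced_trig rR lt) subr0.
by case: eqVneq lt => [->|]; rewrite ?ltnn ?mul0r.
Qed.

Let perp_rows_small (R : 'M[C]_n) (p : 'I_n) : reduced P R -> bl p = 1%N -> (p < j0)%N ->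
  perp_rows R (st p) j0 = 0.
Proof.
move=> rR bp lt; rewrite perp_rowsE //; case: eqP => // bj0.
have S := rho_st bj0 bp.
have lt' : (st j0 < st p)%N by move: S lt => /=; lia.
rewrite (reduced_trig rR lt') subr0.
by case: eqVneq lt' => // ->; rewrite ltnn.
Qed.

(** By coisotropy st i is in P. If it were j0, the linear equation at j0 would read 0 = 1, all terms
    on the left vanishing by triangularity. *)
Lemma cellE_pivot R' R : cellE R' R ->
  forall i, i \notin P -> bl i = 1%N -> st i \in P'.
Proof.
move=> /cellE_equations[rR' rR _ _ [_ coR cR]] i iP bi.
have siP := coisotropic_pivot rR coR iP bi.
move: siP; rewrite inP => /orP[/eqP sij|//].
have := cR i iP bi; rewrite perp_rowsE // -sij bl_st bi stK !eqxx.
rewrite (reduced_row0 rR) // subr0 (reduced_mulE _ _ _ rR') big1.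
  by move/esym/eqP; rewrite oner_eq0.
move=> j jP'; have [lt|gt|/val_inj E] := ltngtP j j0.
- by rewrite sij (reduced_trig rR') ?mulr0.
- rewrite mxE perp_rowsE //; case: eqP => [bj|_]; last by rewrite mul0r.
  have lt : (st j < i)%N.
    have bj0 : bl j0 = 1%N by rewrite -sij bl_st.
    have := rho_st bj bj0; rewrite -[in st j0]sij stK.
    by move: gt => /=; lia.
  rewrite (reduced_trig rR lt) subr0.
  by case: eqVneq lt => [->|]; rewrite ?ltnn ?mul0r.
- by move: j0P'; rewrite -E jP'.
Qed.

(** Only p > j0 gives an equation; for p < j0 both sides vanish. *)
Definition lower_elim (p k : 'I_n) :=
  [&& k == j0, p \in P', bl p == 1%N, st p \notin P & (j0 < p)%N].
Definition lower_sol (y : 'M[C]_n) (p : 'I_n) :=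
  perp_rows (upperE y) (st p) j0 - lower_sum (upperE y) (fun j => y j j0) p.

Lemma polyfun_lower_sol d (y : 'rV[C]_d -> 'M[C]_n) p : polymx y ->
  polyfun (fun z => lower_sol (y z) p).
Proof.
move=> yp; have wp : polymx (fun z => perp_rows (upperE (y z))).
  move=> i j; apply: polyfun_mulmx => [|a b]; last exact: polyfun_const.
  exact/polymx_coreduced/polymx_upperE.
by apply: polyfunB => //; apply: polyfun_sum => j; apply: polyfunM.
Qed.

Lemma lower_solE y : shape y ->
  (forall i, i \notin P -> bl i = 1%N -> st i \in P') ->
  (forall k, k \notin P -> bl k = 1%N ->
     (row k (perp_rows (upperE y)) *m lowerE y) 0 j0 =
       perp_rows (upperE y) k j0) <->
  (forall p k, lower_elim p k -> y p k = lower_sol y p).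
Proof.
move=> sy Pst; have [rL rU sLU mE] := flag_of_shapeE sy.
have yj0 j : j != j0 -> lowerE y j j0 = y j j0.
  by move=> jj0; move/matrixP/(_ j j0): mE; rewrite mxE eqxx jj0.
have sumE p : lower_sum (upperE y) (fun j => lowerE y j j0) p =
    lower_sum (upperE y) (fun j => y j j0) p.
  apply: eq_bigr => j /and3P[jP' _ _]; rewrite yj0 //.
  by apply: contraNneq j0P' => <-.
split=> [c p k /and5P[/eqP-> pP' /eqP bp spP lt]|c k kP bk].
  have := c (st p) spP; rewrite bl_st perp_row_mul_j0 // /lower_sol => /(_ bp) <-.
  by rewrite sumE addrK yj0 //; apply: contraNneq j0P' => <-.
have sP' := Pst k kP bk; rewrite -[k]stK perp_row_mul_j0 // ?bl_st ?stK //.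
have skj0 : st k != j0 by apply: contraNneq j0P' => <-.
rewrite yj0 // sumE.
have [lt|le] := ltnP j0 (st k).
  by rewrite (c _ j0) ?subrK ?stK // /lower_elim eqxx sP' bl_st bk stK kP lt.
have lt : (st k < j0)%N by rewrite ltn_neqAle le andbT.
rewrite (shape_trig sy lt) add0r -{2}[k]stK perp_rows_small ?bl_st //.
rewrite /lower_sum big1 // => j /and3P[_ _ /andP[lt1 lt2]].
by have := ltn_trans (ltn_trans lt1 lt2) lt; rewrite ltnn.
Qed.

Theorem cellE_polynomial : (exists R' R, cellE R' R) -> polynomial_graph cellE.
Proof.
move=> [R0' [R0 /[dup] cell0 /[dup] [[[rR0' rR0 sR0 iR0] _]]]].
move=> /cellE_equations[_ _ _ eP [_ coR0 _]].
have nP2 := reduced_isotropic_pivot rR0 iR0.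
have nP1 := coisotropic_pivot rR0 coR0.
have nP' := cellE_pivot cell0.
pose special p k := iso_elim p k || co_elim P p k.
pose F p k (y : 'M[C]_n) := if iso_elim p k then iso_sol (upperE y) p k else
  if co_elim P p k then co_sol (upperE y) p k else
  if lower_elim p k then lower_sol y p else ((p == k) && (p \in P))%:R.
pose rk1 (p k : 'I_n) := if special p k then (p - k)%N else 0%N.
(* Entries of R have rank at most n. The slots come after them, ordered by p, since their equations
   involve R and the slots (j, j0) with j < p. *)
pose rk (p k : 'I_n) := if special p k then (p - k)%N else
  if lower_elim p k then (n.+1 + p)%N else 0%N.
have rk_le p k : (rk1 p k <= p - k)%N by rewrite /rk1; case: ifP.
have rk0 p k : ~~ special p k -> rk1 p k = 0%N by rewrite /rk1 => /negPf->.
have special_j0 p k : special p k -> k != j0.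
  case/orP=> [/and5P[_ /eqP bk _ skP _]|/and5P[_ _ _ kP _]].
    apply: contraTneq skP => kj0; apply: nP2 => //; by rewrite kj0.
  by apply: contraNneq kP => ->.
have slot q l : ~~ ((l == j0) && (q != j0)) -> rk q l = rk1 q l.
  move=> nslot; rewrite /rk /rk1; case: ifP => // _; case: ifP => //.
  case/and5P=> /eqP lj0 qP' _ _ _; move: nslot; rewrite lj0 eqxx /= negbK.
  by move=> /eqP qj0; move: j0P'; rewrite -qj0 qP'.
have special_region p k : special p k || lower_elim p k -> entry_region p k.
  rewrite /entry_region => /orP[/orP[]|].
  - case/and5P=> /eqP bp /eqP bk pP skP /andP[_ lt]; rewrite pP lt /=.
    by apply: contraL skP => kP'; apply: nP2 => //; exact: P'P.
  - case/and5P=> _ _ pP kP /and3P[_ _ lt]; rewrite lt pP.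
    by apply: contra kP; apply: P'P.
  - by case/and5P=> /eqP-> pP' _ _ lt; rewrite P'P // lt.
have upper_special y p k : special p k -> upperE y p k = y p k.
  by move=> /special_j0 kj0; rewrite mxE (negPf kj0).
apply: (@polynomial_graph_of_system _ _
  (fun p k => ~~ entry_region p k || (special p k || lower_elim p k)) rk F
  (fun j k => (k == j0) && (j != j0)) lowerE upperE).
- move=> p k _ d y yp; rewrite /F; case: (iso_elim p k).
    exact/polyfun_iso_sol/polymx_upperE.
  case: (co_elim P p k); first exact/polyfun_co_sol/polymx_upperE.
  case: (lower_elim p k); first exact: polyfun_lower_sol.
  exact: polyfun_const.
- move=> p k y y' _ E.
  have upperEq q l : (rk1 q l < rk p k)%N -> upperE y q l = upperE y' q l.
    move=> lt; rewrite !mxE; case: ifPn => // nslot.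
    by apply: E; rewrite slot // lt orbT.
  rewrite /F; case: ifP => [ie|nie].
    apply: (eq_iso_sol rk_le rk0 _ ie) => q l lt; apply: upperEq.
    by rewrite /rk /special ie.
  case: ifP => [ce|nce].
    apply: (eq_co_sol rk_le rk0 _ ce) => q l lt; apply: upperEq.
    by rewrite /rk /special ce orbT.
  case: ifP => // le.
  have rkE : rk p k = (n.+1 + p)%N by rewrite /rk /special nie nce le.
  have small (q l : 'I_n) : (rk1 q l <= n)%N.
    by apply: leq_trans (rk_le q l) (leq_trans (leq_subr _ _) (ltnW (ltn_ord q))).
  have -> : lower_sol y p = perp_rows (upperE y) (st p) j0 -
      lower_sum (upperE y) (fun j => y j j0) p by [].
  have -> : upperE y = upperE y'.
    apply/matrixP => q l; apply: upperEq; rewrite rkE addSn ltnS.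
    exact: leq_trans (small q l) (leq_addr _ _).
  congr (_ - _); apply: eq_bigr => j /and3P[_ _ /andP[_ jp]].
  rewrite E // rkE; apply/orP; right; rewrite /rk; case: ifP => _.
    by rewrite addSn ltnS; have := ltn_ord j; lia.
  by case: ifP => _; lia.
- exact: polymx_lowerE.
- exact: polymx_upperE.
- move=> R' R /cellE_equations[rR' rR sR _ [iR pR cR]].
  have [sy lE uE] := shapeE_of_flag rR' rR sR.
  rewrite -/(mergeE R' R); split=> // p k elim_pk; rewrite /F.
  case: ifP => [ie|nie].
    rewrite -(@upper_special _ p k) ?uE; last by rewrite /special ie.
    apply: (iso_solE _ _ nP2).1 => // [i iP|].
      by rewrite (reduced_pivot rR) // eqxx.
    exact: reduced_trig rR.
  case: ifP => [ce|nce].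
    rewrite -(@upper_special _ p k) ?uE; last by rewrite /special ce orbT.
    exact: (co_solE rR nP1).1.
  case: ifP => [le|nle].
    by apply: (lower_solE sy nP').1 le; rewrite uE lE.
  by apply: sy; move: elim_pk; rewrite /special nie nce nle !orbF.
move=> y yF.
have sy : shape y.
  move=> p k npk; rewrite yF ?npk // /F.
  have := contra (@special_region p k) npk.
  by rewrite !negb_or => /andP[/andP[/negPf-> /negPf->] /negPf->].
have [rL rU sLU mE] := flag_of_shapeE sy.
split=> //; apply/cellE_equations; split=> //; split.
- apply/iso_solE => // [i iP|i l|p k ie].
  + by rewrite (reduced_pivot rU) // eqxx.
  + exact: reduced_trig rU _ _.
  + have sp : special p k by rewrite /special ie.
    by rewrite upper_special // yF /F ?ie // sp orbT.
- apply/(co_solE rU nP1) => p k ce.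
  have sp : special p k by rewrite /special ce orbT.
  have nie : iso_elim p k = false by apply/negP => /andP[]; case/and5P: ce => /eqP->.
  by rewrite upper_special // yF /F ?nie ?ce // sp orbT.
apply/lower_solE => // p k le.
have nsp : special p k = false.
  by apply: contraTF le => /special_j0 kj0; rewrite /lower_elim (negPf kj0).
move: (nsp); rewrite /special => /norP[/negPf nie /negPf nce].
by rewrite yF /F ?nie ?nce ?le // ?orbT.
Qed.
End Cells.

(** * Normal forms of symmetric bilinear forms *)

Section NormalForms.
Variable C : fieldType.
Hypothesis two_neq0 : 2%:R != 0 :> C.
Hypothesis sqrt_ex : forall a : C, exists b, b ^+ 2 = a.

(** Otherwise polarization gives 2 q(u, w) = 0 for all rows u, w of X. *)
Lemma symmetric_nonisotropic N (S : 'M[C]_N) m (X : 'M[C]_(m, N)) :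
  S^T = S -> X *m S *m X^T != 0 ->
  exists2 v : 'rV_N, (v <= X)%MS & (v *m S *m v^T) 0 0 != 0.
Proof.
move=> St; apply: contraNP => iso; apply/eqP/matrixP => i j; rewrite [RHS]mxE.
pose q (u w : 'rV[C]_N) := (u *m S *m w^T) 0 0.
have q0 u : (u <= X)%MS -> q u u = 0.
  by move=> uX; apply: contrapT => /eqP qu; apply: iso; exists u.
have qC u w : q u w = q w u.
  rewrite /q; have -> : w *m S *m u^T = (u *m S *m w^T)^T.
    by rewrite !trmx_mul trmxK St mulmxA.
  by rewrite [RHS]mxE.
have -> : (X *m S *m X^T) i j = q (row i X) (row j X).
  by rewrite /q tr_row -row_mul -!row_mul !mxE; apply: eq_bigr => k _; rewrite !mxE.
have qD u w : q (u + w) (u + w) = q u u + q u w + (q w u + q w w).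
  rewrite /q raddfD /= mulmxDl mulmxDl !mulmxDr.
  by rewrite [LHS]mxE [X in X + _]mxE [X in _ + X]mxE.
have := q0 _ (addmx_sub (row_sub i X) (row_sub j X)).
rewrite qD !q0 ?row_sub // add0r addr0 [q (row j X) _]qC => /eqP.
by rewrite -mulr2n -mulr_natl mulf_eq0 (negPf two_neq0) => /eqP.
Qed.

Lemma unitmx_kerP r (G : 'M[C]_r) :
  (forall z : 'rV[C]_r, z *m G = 0 -> z = 0) -> G \in unitmx.
Proof.
move=> inj; rewrite -row_free_unit -kermx_eq0; apply/eqP/row_matrixP => i.
by rewrite row0; apply: inj; rewrite -row_mul mulmx_ker row0.
Qed.

(** Gram-Schmidt: a nonisotropic vector is normalized with a square root, and induction applies to
    its orthogonal in X, spanned by [X1]. *)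
Lemma orthonormal_basis N (S : 'M[C]_N) r (X : 'M[C]_(r, N)) : S^T = S ->
  X *m S *m X^T \in unitmx ->
  exists2 Y : 'M[C]_(r, N), (Y <= X)%MS & Y *m S *m Y^T = 1%:M.
Proof.
move=> St; elim: r X => [|r IH] X Xu.
  by exists X => //; apply/matrixP => [[]].
have Xfree : row_free X.
  rewrite /row_free eqn_leq rank_leq_row -{1}(mxrank_unit Xu) -mulmxA.
  exact: mxrankM_maxl.
have X0 : X *m S *m X^T != 0.
  apply: contraTneq Xu => ->; rewrite -row_free_unit /row_free mxrank0.
  by [].
have [v0 v0X qv0] := symmetric_nonisotropic St X0.
have [c cE] := sqrt_ex ((v0 *m S *m v0^T) 0 0)^-1.
pose v := c *: v0.
have vX : (v <= X)%MS by apply: scalemx_sub.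
have vv : v *m S *m v^T = 1%:M.
  apply/matrixP => i j; rewrite !ord1 linearZ /= -scalemxAr -!scalemxAl scalerA.
  by rewrite -expr2 cE [LHS]mxE mulVf // mxE.
pose X1 := X - X *m S *m v^T *m v.
have X1X : (X1 <= X)%MS.
  by rewrite addmx_sub ?eqmx_opp //; apply: submx_trans (submxMl _ _) vX.
have X1v : X1 *m S *m v^T = 0.
  rewrite /X1 !mulmxBl -!mulmxA [v *m _]mulmxA vv mulmx1 subrr //.
have XX1 : (X <= X1 + v)%MS.
  rewrite -[X in (X <= _)%MS](subrK (X *m S *m v^T *m v)).
  by apply: addmx_sub_adds => //; apply: submxMl.
have v_neq0 : v != 0.
  by apply: contra_eqN vv => /eqP->; rewrite !mul0mx eq_sym; apply: matrix_nonzero1.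
have [a va] := submxP vX.
have aX1 : a *m X1 = 0.
  by rewrite mulmxBr !mulmxA -va vv mul1mx subrr.
have rX1 : \rank X1 = r.
  apply/eqP; rewrite eqn_leq; apply/andP; split.
    rewrite -ltnS ltn_neqAle rank_leq_row andbT; apply: contra v_neq0 => fr.
    by rewrite va (row_free_inj fr (_ : a *m X1 = 0 *m X1)) ?mul0mx // aX1 mul0mx.
  move: (mxrankS XX1); rewrite (eqP Xfree) => le.
  rewrite -(leq_add2r 1) addn1; apply: leq_trans le _.
  apply: leq_trans (mxrank_adds_leqif _ _) _.
  by rewrite leq_add2l rank_leq_row.
pose Y1 : 'M[C]_(r, N) := castmx (rX1, erefl) (row_base X1).
have Y1X1 : (Y1 :=: X1)%MS.
  exact: eqmx_trans (eqmx_cast _ _) (eq_row_base _).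
have Y1free : row_free Y1 by rewrite /row_free Y1X1 rX1.
have Y1u : Y1 *m S *m Y1^T \in unitmx.
  apply: unitmx_kerP => z z0.
  have zv : z *m Y1 *m S *m v^T = 0.
    have /submxP[d dE] : (z *m Y1 <= X1)%MS by rewrite -Y1X1 submxMl.
    by rewrite dE -!mulmxA [X1 *m _]mulmxA X1v mulmx0.
  have [b bE] : exists b, z *m Y1 = b *m X.
    by apply/submxP; apply: submx_trans X1X; rewrite -Y1X1 submxMl.
  have zX : z *m Y1 *m S *m X^T = 0.
    have /sub_addsmxP[[e f] /= ->] : (X <= Y1 + v)%MS.
      by apply: submx_trans XX1 _; rewrite addsmxS // Y1X1.
    have z0' : z *m Y1 *m S *m Y1^T = 0 by rewrite -!mulmxA; rewrite -!mulmxA in z0.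
    by rewrite raddfD /= !trmx_mul mulmxDr !mulmxA zv z0' !mul0mx addr0.
  have b0 : b = 0.
    by rewrite -[b](mulmxK Xu) !mulmxA -bE zX mul0mx.
  apply: (row_free_inj Y1free); by rewrite mul0mx bE b0 mul0mx.
have [Y2 Y2Y1 Y2S] := IH Y1 Y1u.
have Y2v : Y2 *m S *m v^T = 0.
  have /submxP[d ->] : (Y2 <= X1)%MS by rewrite -Y1X1.
  by rewrite -!mulmxA [X1 *m _]mulmxA X1v mulmx0.
have vY2 : v *m S *m Y2^T = 0.
  by apply: trmx_inj; rewrite !trmx_mul trmxK St mulmxA Y2v trmx0.
have E : col_mx v Y2 *m S *m (col_mx v Y2)^T = 1%:M.
  rewrite tr_col_mx mul_col_mx mul_col_row vv vY2 Y2v Y2S.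
  by rewrite -scalar_mx_block.
have sub : (col_mx v Y2 <= X)%MS.
  by rewrite col_mx_sub vX; apply: submx_trans Y2Y1 _; rewrite Y1X1.
by exists (col_mx v Y2).
Qed.

Definition antidiag r : 'M[C]_r := \matrix_(i, j) (j == rev_ord i)%:R.

Lemma tr_antidiag r : (antidiag r)^T = antidiag r.
Proof.
apply/matrixP => i j; rewrite !mxE.
by rewrite -(inj_eq rev_ord_inj) rev_ordK eq_sym.
Qed.

Lemma antidiagK r : antidiag r *m antidiag r = 1%:M.
Proof.
apply/matrixP => i j; rewrite !mxE (bigD1 (rev_ord i)) //= !mxE eqxx mul1r.
rewrite rev_ordK eq_sym big1 ?addr0 // => k ki.
by rewrite mxE (negPf ki) mul0r.
Qed.

(** Both matrices are congruent to the identity. *)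
Lemma antidiag_congruent r (G : 'M[C]_r) : G^T = G -> G \in unitmx ->
  exists P : 'M[C]_r, P *m G *m P^T = antidiag r.
Proof.
have ortho (H : 'M[C]_r) : H^T = H -> H \in unitmx -> exists P : 'M[C]_r, P *m H *m P^T = 1%:M.
  move=> Ht Hu; have [|Y _ YH] := @orthonormal_basis r H r 1%:M Ht.
    by rewrite trmx1 mul1mx mulmx1.
  by exists Y.
move=> Gt Gu; have [P PG] := ortho G Gt Gu.
have Au : antidiag r \in unitmx.
  by case: (mulmx1_unit (antidiagK r)).
have [Q QA] := ortho _ (tr_antidiag r) Au.
have Qu : Q \in unitmx by have [] := mulmx1_unit (etrans (mulmxA _ _ _) QA).
exists (invmx Q *m P).
rewrite trmx_mul -!mulmxA (mulmxA G) (mulmxA P) (mulmxA P) PG mul1mx.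
rewrite -[antidiag r](mulKmx Qu) -[Q *m _]mulmx1; congr (_ *m _).
by rewrite -(mulmxV (_ : Q^T \in unitmx)) ?unitmx_tr // mulmxA QA mul1mx trmx_inv.
Qed.

(** [A] spans the radical of the form on X, so the form is nondegenerate on any complement. Symmetry
    is asked only on X, because the matrix [S1] of the form on im x need not be symmetric. *)
Lemma antidiagonal_complement N (S X : 'M[C]_N) p (A : 'M[C]_(p, N)) :
  (X *m S *m X^T)^T = X *m S *m X^T ->
  (A <= X)%MS -> row_free A -> A *m S *m X^T = 0 ->
  (forall v : 'rV_N, (v <= X)%MS -> v *m S *m X^T = 0 -> (v <= A)%MS) ->
  exists r (G : 'M[C]_(r, N)),
    [/\ G *m S *m G^T = antidiag r, (col_mx A G :=: X)%MS & row_free (col_mx A G)].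
Proof.
move=> Xt AX Afree Arad radA.
have [G0 G0E G0free] : exists2 G0 : 'M[C]_(\rank (X :\: A)%MS, N),
    (G0 :=: X :\: A)%MS & row_free G0.
  by exists (row_base (X :\: A)%MS); [exact: eq_row_base | exact: row_base_free].
have G0X : (G0 <= X)%MS by rewrite G0E diffmxSl.
have symX m1 m2 (u : 'M[C]_(m1, N)) (w : 'M[C]_(m2, N)) :
    (u <= X)%MS -> (w <= X)%MS -> u *m S *m w^T = (w *m S *m u^T)^T.
  move=> /submxP[a ->] /submxP[b ->].
  have [G Gt GE] : exists2 G, G^T = G & X *m S *m X^T = G by exists (X *m S *m X^T).
  have -> : a *m X *m S *m (b *m X)^T = a *m G *m b^T.
    by rewrite trmx_mul -GE !mulmxA.
  have -> : b *m X *m S *m (a *m X)^T = b *m G *m a^T.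
    by rewrite trmx_mul -GE !mulmxA.
  by rewrite !trmx_mul trmxK Gt mulmxA.
pose G1 := G0 *m S *m G0^T.
have G1t : G1^T = G1 by rewrite /G1 -symX.
have XAG0 : (X <= A + G0)%MS.
  have XE := addsmx_diff_cap_eq X A.
  by rewrite -{1}XE addsmxC addsmxS ?capmxSr // G0E.
have capAG0 (v : 'rV_N) : (v <= A)%MS -> (v <= G0)%MS -> v = 0.
  move=> vA; rewrite G0E => vX; apply/eqP; rewrite -submx0.
  by rewrite -(capmx_diff X A) sub_capmx vX vA.
have G1u : G1 \in unitmx.
  apply: unitmx_kerP => z z0; pose v := z *m G0.
  have vG0 : (v <= G0)%MS by apply: submxMl.
  have vX : (v <= X)%MS := submx_trans vG0 G0X.
  have vSG : v *m S *m G0^T = 0 by rewrite -!mulmxA; rewrite /G1 -!mulmxA in z0.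
  have vSA : v *m S *m A^T = 0.
    have /submxP[d dE] := vX; rewrite symX //.
    have -> : A *m S *m v^T = 0 by rewrite dE trmx_mul mulmxA Arad mul0mx.
    exact: trmx0.
  have v0 : v = 0.
    apply: capAG0 vG0; apply: radA => //.
    have /sub_addsmxP[[e f] /= ->] := XAG0.
    by rewrite raddfD /= !trmx_mul mulmxDr !mulmxA vSA vSG !mul0mx addr0.
  by apply: (row_free_inj G0free); rewrite mul0mx -/v v0.
have [P PG] := antidiag_congruent G1t G1u.
have antidiag_unit : antidiag (\rank (X :\: A)%MS) \in unitmx.
  by case: (mulmx1_unit (antidiagK (\rank (X :\: A)%MS))).
have Pfull : row_full P.
  rewrite row_full_unit.
  have : P *m (G1 *m P^T) \in unitmx by rewrite mulmxA PG.
  by rewrite unitmx_mul => /andP[].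
have GG0 : (P *m G0 :=: G0)%MS := eqmxMfull G0 Pfull.
exists (\rank (X :\: A)%MS), (P *m G0); split.
- by rewrite -PG /G1 trmx_mul !mulmxA.
- apply/eqmxP; rewrite col_mx_sub AX GG0 G0X /=.
  by rewrite -addsmxE (submx_trans XAG0) // addsmxS // GG0.
- rewrite /row_free -addsmxE mxrank_disjoint_sum.
    by rewrite (eqP Afree) GG0 (eqP G0free).
  apply/eqP; rewrite -submx0; apply/rV_subP => v.
  by rewrite sub_capmx GG0 => /andP[vA vG]; rewrite (capAG0 v) ?sub0mx.
Qed.

End NormalForms.

(** * A basis of the kernel adapted to a self-adjoint x with x^3 = 0 *)

Section AdaptedBasis.
Variables (C : fieldType) (N : nat).
Hypothesis two_neq0 : 2%:R != 0 :> C.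
Hypothesis sqrt_ex : forall a : C, exists b, b ^+ 2 = a.
Variables M x : 'M[C]_N.
Hypothesis Mt : M^T = M.
Hypothesis Mu : M \in unitmx.
Hypothesis xM : x *m M = M *m x^T.

Lemma tr_form m k (U : 'M[C]_(m, N)) (W : 'M[C]_(k, N)) :
  (U *m M *m W^T)^T = W *m M *m U^T.
Proof. by rewrite !trmx_mul trmxK Mt mulmxA. Qed.

(** A functional vanishing on ker x is a combination z x^T. Self-adjointness rewrites it as z M^-1 x
    M, so p = z M^-1 x. *)
Lemma perp_kermx m (p : 'M[C]_(m, N)) : kermx x *m M *m p^T = 0 -> (p <= x)%MS.
Proof.
move=> Kp; have sub : ((M *m p^T)^T <= x^T)%MS.
  rewrite submxE -(inj_eq trmx_inj) trmx0 trmx_mul trmxK; apply/eqP.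
  have /submxP[D ->] : ((cokermx x^T)^T <= kermx x)%MS.
    apply/sub_kermxP; apply: trmx_inj.
    by rewrite trmx_mul trmxK mulmx_coker trmx0.
  by rewrite -mulmxA [kermx x *m _]mulmxA Kp mulmx0.
have /submxP[z zE] := sub; have : p *m M = z *m x^T by rewrite -zE trmx_mul trmxK Mt.
move=> pM; have : p *m M = (z *m invmx M *m x) *m M.
  by rewrite pM -[in RHS]mulmxA xM !mulmxA mulmxKV.
by move=> /(can_inj (mulmxK Mu)) ->; apply: submxMl.
Qed.

Lemma mulmx_kermx_form m (p : 'M[C]_(m, N)) : (p <= x)%MS -> kermx x *m M *m p^T = 0.
Proof.
case/submxP=> z ->; rewrite trmx_mul -!mulmxA (mulmxA M) -xM !mulmxA.
by rewrite mulmx_ker !mul0mx.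
Qed.

(* The form (y x, w) := <y, w> on im x. *)
Let S1 := pinvmx x *m M.

Let S1E m k (y : 'M[C]_(m, N)) (w : 'M[C]_(k, N)) : (w <= x)%MS ->
  (y *m x) *m S1 *m w^T = y *m M *m w^T.
Proof.
move=> wx; pose d := y *m x *m pinvmx x - y.
have dK : (d <= kermx x)%MS.
  by apply/sub_kermxP; rewrite mulmxBl mulmxKpV ?submxMl // subrr.
apply/eqP; rewrite -subr_eq0 /S1 mulmxA -mulmxBl -mulmxBl -/d.
case/submxP: dK => e ->; rewrite -(mulmxA e) -(mulmxA e).
by rewrite mulmx_kermx_form ?mulmx0.
Qed.

(** A functional vanishing on ker x + im x is the pairing with a vector p orthogonal to both. Then p
    lies in im x and in ker x, so y is orthogonal to p. *)
Lemma perp_cap_ker (y : 'rV[C]_N) :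
  y *m M *m (x :&: kermx x)%MS^T = 0 -> (y <= kermx x + x)%MS.
Proof.
move=> y0; rewrite submxE; apply/eqP.
pose q := cokermx (kermx x + x)%MS.
have q0 : (kermx x + x)%MS *m q = 0 by apply: mulmx_coker.
have Kq : kermx x *m q = 0.
  by case/submxP: (addsmxSl (kermx x) x) => e ->; rewrite -mulmxA q0 mulmx0.
have xq : x *m q = 0.
  by case/submxP: (addsmxSr (kermx x) x) => e ->; rewrite -mulmxA q0 mulmx0.
pose p := (invmx M *m q)^T.
have Mp : M *m p^T = q by rewrite trmxK mulKVmx.
have Kp : kermx x *m M *m p^T = 0 by rewrite -(mulmxA (kermx x)) Mp.
have : (p <= x :&: kermx x)%MS.
  rewrite sub_capmx perp_kermx //=; apply/sub_kermxP.
  have : (p *m x)^T = 0.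
    apply: (can_inj (mulKmx Mu)); rewrite mulmx0 trmx_mul mulmxA -xM.
    by rewrite -mulmxA Mp.
  by move=> /(congr1 trmx); rewrite trmxK trmx0.
by case/submxP=> e pe; rewrite -/q -Mp pe trmx_mul !mulmxA y0 mul0mx.
Qed.

(* The rows of K are a basis of ker x; [bl i] is 0, 1 or 2 according to       *)
(* whether row i is in im x^2, in im x or in neither, and st reverses each    *)
(* block. On the last two blocks the forms <u, v> of ker x and (y x, w) of    *)
(* im x are antidiagonal.                                                     *)
Record adapted_basis n (bl : 'I_n -> nat) (st : 'I_n -> 'I_n)
    (K : 'M[C]_(n, N)) : Prop := AdaptedBasis {
  ab_stK : involutive st;
  ab_bl_st : forall i, bl (st i) = bl i;
  ab_bl_le2 : forall i, (bl i <= 2)%N;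
  ab_bl_mono : forall i j : 'I_n, (i <= j)%N -> (bl i <= bl j)%N;
  ab_st_sum : forall i j, bl i = bl j -> (i + st i = j + st j)%N;
  ab_free : row_free K;
  ab_ker : (K :=: kermx x)%MS;
  ab_low : forall y : 'rV[C]_n, low bl y <-> (y *m K <= x)%MS;
  ab_form : K *m M *m K^T = block_form C bl st 2;
  ab_low_form : forall (y u : 'rV[C]_n) (v : 'rV[C]_N), low bl y -> low bl u ->
    v *m x = y *m K -> v *m M *m (u *m K)^T = y *m block_form C bl st 1 *m u^T }.

(** * Index sets made of three consecutive blocks *)

Section BlockIndices.
Variables a b c : nat.

Definition block_index (i : 'I_(a + b + c)) : nat :=
  match split i with
  | inl j => if split j is inl _ then 0 else 1
  | inr _ => 2
  end.

Definition block_rev (i : 'I_(a + b + c)) : 'I_(a + b + c) :=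
  match split i with
  | inl j => lshift c (match split j with
      | inl k => lshift b (rev_ord k) | inr k => rshift a (rev_ord k) end)
  | inr k => rshift (a + b) (rev_ord k)
  end.

Variant block_spec (i : 'I_(a + b + c)) : nat -> 'I_(a + b + c) -> Prop :=
| Block0 k of i = lshift c (lshift b k) :
    block_spec i 0 (lshift c (lshift b (rev_ord k)))
| Block1 k of i = lshift c (rshift a k) :
    block_spec i 1 (lshift c (rshift a (rev_ord k)))
| Block2 k of i = rshift (a + b) k : block_spec i 2 (rshift (a + b) (rev_ord k)).

Lemma blockP i : block_spec i (block_index i) (block_rev i).
Proof.
rewrite /block_index /block_rev.
have [j ->|k ->] := split_ordP i; last by constructor.
by have [k ->|k ->] := split_ordP j; constructor.
Qed.

Lemma block0E k : block_index (lshift c (lshift b k)) = 0%N /\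
  block_rev (lshift c (lshift b k)) = lshift c (lshift b (rev_ord k)).
Proof.
by case: blockP => [k' /lshift_inj/lshift_inj->|k' /lshift_inj/eqP|k' /eqP];
   rewrite ?eq_lrshift.
Qed.

Lemma block1E k : block_index (lshift c (rshift a k)) = 1%N /\
  block_rev (lshift c (rshift a k)) = lshift c (rshift a (rev_ord k)).
Proof.
by case: blockP => [k' /lshift_inj/eqP|k' /lshift_inj/rshift_inj->|k' /eqP];
   rewrite ?eq_lrshift ?eq_rlshift.
Qed.

Lemma block2E k : block_index (rshift (a + b) k) = 2%N /\
  block_rev (rshift (a + b) k) = rshift (a + b) (rev_ord k).
Proof.
by case: blockP => [k' /eqP|k' /eqP|k' /rshift_inj->]; rewrite ?eq_rlshift.
Qed.

Lemma block_revK : involutive block_rev.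
Proof.
move=> i; case: (blockP i) => k ->.
- by rewrite (block0E _).2 rev_ordK.
- by rewrite (block1E _).2 rev_ordK.
- by rewrite (block2E _).2 rev_ordK.
Qed.

Lemma block_index_rev i : block_index (block_rev i) = block_index i.
Proof.
case: (blockP i) => k _.
- by rewrite (block0E _).1.
- by rewrite (block1E _).1.
- by rewrite (block2E _).1.
Qed.

Lemma block_index_le2 i : (block_index i <= 2)%N.
Proof. by case: (blockP i). Qed.

Lemma block_index_mono (i j : 'I_(a + b + c)) :
  (i <= j)%N -> (block_index i <= block_index j)%N.
Proof.
case: (blockP i) => k ->; case: (blockP j) => l -> //=;
  by have := ltn_ord k; have := ltn_ord l; lia.
Qed.

Lemma block_rev_sum i j : block_index i = block_index j ->
  (i + block_rev i = j + block_rev j)%N.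
Proof.
case: (blockP i) => k ->; case: (blockP j) => l -> //= _;
  by have := ltn_ord k; have := ltn_ord l; lia.
Qed.

Lemma block_form1E : block_form C block_index block_rev 1 =
  block_mx (block_mx 0 0 0 (antidiag C b)) 0 0 0.
Proof.
apply/matrixP => i j; rewrite mxE.
have [k ->|k ->|k ->] := blockP i; case: (split_ordP j) => [l ->|l ->] /=;
  rewrite ?block_mxEul ?block_mxEur ?block_mxEdl ?block_mxEdr; try by rewrite mxE.
- by case: (split_ordP l) => [p ->|p ->]; rewrite ?block_mxEul ?block_mxEur mxE.
- case: (split_ordP l) => [p ->|p ->]; rewrite ?block_mxEdl ?block_mxEdr mxE.
    by rewrite (inj_eq (@lshift_inj _ _)) eq_lrshift.
  by rewrite (inj_eq (@lshift_inj _ _)) (inj_eq (@rshift_inj _ _)).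
- by rewrite eq_rlshift mxE.
Qed.

Lemma block_form2E : block_form C block_index block_rev 2 =
  block_mx 0 0 0 (antidiag C c).
Proof.
apply/matrixP => i j; rewrite mxE.
have [k ->|k ->|k ->] := blockP i; case: (split_ordP j) => [l ->|l ->] /=;
  rewrite ?block_mxEul ?block_mxEur ?block_mxEdl ?block_mxEdr; try by rewrite mxE.
  by rewrite eq_lrshift mxE.
by rewrite (inj_eq (@rshift_inj _ _)) mxE.
Qed.

Lemma low_blockP (y : 'rV[C]_(a + b + c)) :
  low block_index y <-> exists y1, y = row_mx y1 0.
Proof.
split=> [ly|[y1 ->] k].
  exists (lsubmx y); rewrite -{1}[y]hsubmxK; congr row_mx.
  by apply/rowP => k; rewrite !mxE ly // (block2E _).1.
have [l ->|l ->|l ->] := blockP k => // _.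
by rewrite row_mxEr mxE.
Qed.

End BlockIndices.

(** [antidiagonal_complement] is used twice: on K1 with the form [S1], whose radical is im x^2, and
    on ker x with [M], whose radical is K1. *)
Lemma adapted_basis_exists : x *m x *m x = 0 ->
  exists n (bl : 'I_n -> nat) (st : 'I_n -> 'I_n) (K : 'M[C]_(n, N)),
    adapted_basis bl st K.
Proof.
move=> x3.
pose a := \rank (x *m x).
have [E EE Efree] : exists2 E : 'M[C]_(a, N), (E :=: x *m x)%MS & row_free E.
  by exists (row_base (x *m x)); [exact: eq_row_base | exact: row_base_free].
have [K1 K1E] : exists K1, K1 = (x :&: kermx x)%MS by exists (x :&: kermx x)%MS.
have K1x : (K1 <= x)%MS by rewrite K1E capmxSl.
have K1K : (K1 <= kermx x)%MS by rewrite K1E capmxSr.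
have EK1 : (E <= K1)%MS.
  by rewrite EE K1E sub_capmx submxMl; apply/sub_kermxP.
have K1_0 : K1 *m x = 0 by apply/sub_kermxP.
have S1_sym : (K1 *m S1 *m K1^T)^T = K1 *m S1 *m K1^T.
  have [Y YE] := submxP K1x.
  have T1 : K1 *m S1 *m K1^T = Y *m M *m K1^T by rewrite {1}YE S1E.
  have T2 : K1 *m S1 *m K1^T = K1 *m M *m Y^T.
    by rewrite T1 YE trmx_mul mulmxA -[Y *m M *m _]mulmxA -xM mulmxA.
  by rewrite {1}T2 T1 !trmx_mul trmxK Mt mulmxA.
have Erad : E *m S1 *m K1^T = 0.
  have /submxP[Z ->] : (E <= x *m x)%MS by rewrite EE.
  rewrite mulmxA S1E //; rewrite -[Z *m x *m M]mulmxA xM mulmxA -mulmxA.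
  by rewrite -trmx_mul K1_0 trmx0 mulmx0.
(* For v = y x orthogonal to K1, [perp_cap_ker] puts y in ker x + im x, hence v in im x^2. *)
have radE (v : 'rV_N) : (v <= K1)%MS -> v *m S1 *m K1^T = 0 -> (v <= E)%MS.
  move=> vK1; have /submxP[y vE] := submx_trans vK1 K1x.
  rewrite {1}vE S1E // K1E => /perp_cap_ker/sub_addsmxP[[d e] /= yE].
  rewrite vE yE mulmxDl -mulmxA mulmx_ker mulmx0 add0r -mulmxA EE.
  exact: submxMl.
have [b [F [FS EF EFfree]]] :=
  antidiagonal_complement two_neq0 sqrt_ex S1_sym EK1 Efree Erad radE.
pose EF0 := col_mx E F.
have M_sym : (kermx x *m M *m (kermx x)^T)^T = kermx x *m M *m (kermx x)^T.
  exact: tr_form.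
have EFK : (EF0 <= kermx x)%MS by rewrite EF.
have EFx : (EF0 <= x)%MS by rewrite EF.
have EFrad : EF0 *m M *m (kermx x)^T = 0.
  by apply: trmx_inj; rewrite tr_form trmx0 mulmx_kermx_form.
have radEF (v : 'rV_N) : (v <= kermx x)%MS -> v *m M *m (kermx x)^T = 0 ->
    (v <= EF0)%MS.
  move=> vK v0; rewrite EF K1E sub_capmx vK andbT; apply: perp_kermx.
  by apply: trmx_inj; rewrite tr_form v0 trmx0.
have [c [G [GS KE Kfree]]] :=
  antidiagonal_complement two_neq0 sqrt_ex M_sym EFK EFfree EFrad radEF.
have KxE (y1 : 'rV[C]_(a + b)) : row_mx y1 0 *m col_mx EF0 G = y1 *m EF0.
  by rewrite mul_row_col mul0mx addr0.
have EK : (E <= K1)%MS by [].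
have FK : (F <= K1)%MS by rewrite -EF -addsmxE addsmxSr.
have GK : (G <= kermx x)%MS by rewrite -KE -addsmxE addsmxSr.
have rad_sub m k (A : 'M[C]_(m, N)) (X : 'M[C]_N) (B : 'M[C]_(k, N)) (S : 'M[C]_N) :
    A *m S *m X^T = 0 -> (B <= X)%MS -> A *m S *m B^T = 0.
  by move=> A0 /submxP[D ->]; rewrite trmx_mul mulmxA A0 mul0mx.
have FE : F *m S1 *m E^T = 0.
  have Ex : (E <= x)%MS := submx_trans EK K1x.
  have /submxP[Y YE] := submx_trans FK K1x.
  have /submxP[Z ZE] : (E <= x *m x)%MS by rewrite EE.
  have F0 : F *m x = 0 by have /submxP[D ->] := FK; rewrite -mulmxA K1_0 mulmx0.
  rewrite YE S1E // ZE !trmx_mul !mulmxA -[Y *m M *m _]mulmxA -xM mulmxA -YE.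
  by rewrite -[F *m M *m _]mulmxA -xM mulmxA F0 !mul0mx.
have EFS : EF0 *m S1 *m EF0^T = block_mx 0 0 0 (antidiag C b).
  rewrite tr_col_mx mul_col_mx mul_col_row FS FE.
  by rewrite (rad_sub _ _ _ _ _ _ Erad EK) (rad_sub _ _ _ _ _ _ Erad FK).
exists (a + b + c)%N, (@block_index a b c), (@block_rev a b c), (col_mx EF0 G).
split=> //.
- exact: block_revK.
- exact: block_index_rev.
- exact: block_index_le2.
- exact: block_index_mono.
- exact: block_rev_sum.
- move=> y; split=> [/low_blockP[y1 ->]|yx].
    by rewrite KxE; apply: submx_trans (submxMl _ _) EFx.
  have /submxP[z zE] : (y *m col_mx EF0 G <= EF0)%MS.
    rewrite EF K1E sub_capmx yx; apply: submx_trans (submxMl _ _) _.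
    by rewrite KE.
  apply/low_blockP; exists z; apply: (row_free_inj Kfree).
  by rewrite KxE.
- rewrite block_form2E tr_col_mx mul_col_mx mul_col_row GS.
  rewrite (rad_sub _ _ _ _ _ _ EFrad EFK) (rad_sub _ _ _ _ _ _ EFrad GK).
  have -> : G *m M *m EF0^T = 0.
    by apply: trmx_inj; rewrite tr_form (rad_sub _ _ _ _ _ _ EFrad GK) trmx0.
  by [].
move=> y u v /low_blockP[y1 ->] /low_blockP[u1 ->]; rewrite !KxE => vx.
have u1x : (u1 *m EF0 <= x)%MS := submx_trans (submxMl _ _) EFx.
rewrite -(S1E _ u1x) vx block_form1E mul_row_block !mulmx0 !addr0.
rewrite tr_row_mx mul_row_col trmx0 mulmx0 addr0.
by rewrite trmx_mul mulmxA -(mulmxA y1) -(mulmxA y1) EFS.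
Qed.

(** * The conditions on flags in coordinates *)

Section FlagConditions.
Variables (n : nat) (bl : 'I_n -> nat) (st : 'I_n -> 'I_n) (K : 'M[C]_(n, N)).
Hypothesis abK : adapted_basis bl st K.
Hypothesis x3 : x *m x *m x = 0.

Lemma perp_image_subP (X R : 'M[C]_n) : (X <= R)%MS ->
  (forall v : 'rV[C]_N,
     (forall w : 'rV[C]_N, (w <= R *m K)%MS -> (v *m M *m w^T) 0 0 = 0) ->
     (v *m x <= X *m K)%MS) <-> perp_sub bl st X R.
Proof.
have [_ _ _ _ _ Kfree KE Klow _ Kform] := abK.
move=> XR; split=> [H y ly yR|H v vR].
  have /submxP[v0 v0E] := (Klow y).1 ly.
  (* The preimage v0 of y K under x is to be corrected by a vector of ker x so as to become
     orthogonal to R K. By duality this is possible if v0 is orthogonal to every u K with u in R and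
     u K orthogonal to ker x; such u are low, and [yR] applies. *)
  suff [k kE] : exists k, v0 *m M *m (R *m K)^T = k *m (kermx x *m M *m (R *m K)^T).
    have E : (v0 - k *m kermx x) *m M *m (R *m K)^T = 0.
      by rewrite !mulmxBl kE !mulmxA subrr.
    rewrite -(submxMfree _ _ Kfree) v0E.
    have -> : v0 *m x = (v0 - k *m kermx x) *m x.
      by rewrite mulmxBl -(mulmxA k) mulmx_ker mulmx0 subr0.
    apply: H => w /submxP[D ->]; rewrite trmx_mul mulmxA E mul0mx mxE //.
  apply/submxP; rewrite submxE; apply/eqP.
  set q := cokermx _.
  have q0 : kermx x *m M *m (R *m K)^T *m q = 0 by apply: mulmx_coker.
  pose u := q^T *m R.
  have uE : (R *m K)^T *m q = (u *m K)^T.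
    by rewrite /u -mulmxA [RHS]trmx_mul trmxK.
  have uKx : (u *m K <= x)%MS.
    by apply: perp_kermx; rewrite -uE mulmxA.
  apply/row_matrixP => i; rewrite row0 ord1.
  apply/rowP => j; rewrite mxE [RHS]mxE.
  have lu : low bl (row j u).
    by apply/Klow; rewrite -row_mul; apply: submx_trans (row_sub _ _) uKx.
  have uR : (row j u <= R)%MS by apply: submx_trans (row_sub _ _) (submxMl _ _).
  rewrite -(mulmxA (v0 *m M)) uE.
  have := yR _ uR lu; rewrite -(Kform _ _ v0) // => E.
  by rewrite -[RHS]E -row_mul tr_row !mxE; apply: eq_bigr => l _; rewrite !mxE.
(* Against z, this is the pairing of v with z x x. Every z x x lies in X K by hypothesis, hence in R
   K, to which v is orthogonal. *)
have xxv : v *m x *m x = 0.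
  apply: (can_inj (mulmxK Mu)); rewrite mul0mx.
  apply/rowP => j; rewrite [RHS]mxE.
  pose z : 'rV[C]_N := delta_mx 0 j.
  have -> : (v *m x *m x *m M) 0 j = (v *m M *m (z *m x *m x)^T) 0 0.
    rewrite !trmx_mul !mulmxA -[v *m M *m x^T]mulmxA -xM mulmxA.
    rewrite -[v *m x *m M *m x^T]mulmxA -xM mulmxA.
    by rewrite trmx_delta -colE !mxE.
  apply: vR.
  have /submxP[y yE] : (z *m x *m x <= K)%MS.
    by rewrite KE; apply/sub_kermxP; rewrite -!mulmxA (mulmxA x) x3 mulmx0.
  have ly : low bl y by apply/Klow; rewrite -yE submxMl.
  rewrite yE submxMr //; apply: submx_trans XR; apply: H => // u uR lu.
  rewrite -(Kform _ _ (z *m x)) //.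
  have uK : (u *m K <= kermx x)%MS by rewrite -KE submxMl.
  rewrite -(mulmxA z) xM !mulmxA -mulmxA -trmx_mul.
  by have /sub_kermxP -> := uK; rewrite trmx0 mulmx0 mxE.
have /submxP[y yE] : (v *m x <= K)%MS by rewrite KE; apply/sub_kermxP.
have ly : low bl y by apply/Klow; rewrite -yE submxMl.
rewrite yE submxMr //; apply: H => // u uR lu.
by rewrite -(Kform _ _ v) //; apply: vR; apply: submxMr.
Qed.

Lemma isotropic_subP (R : 'M[C]_n) :
  (forall u v : 'rV[C]_N, (u <= R *m K)%MS -> (v <= R *m K)%MS ->
     (u *m M *m v^T) 0 0 = 0) <-> isotropic_rows bl st R.
Proof.
have KMK := ab_form abK.
split=> [H u v uR vR|H u v].
  rewrite -KMK !mulmxA -mulmxA -trmx_mul; apply: H; exact: submxMr.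
move=> /submxP[a ->] /submxP[b ->].
have -> : a *m (R *m K) *m M *m (b *m (R *m K))^T =
    (a *m R) *m (K *m M *m K^T) *m (b *m R)^T by rewrite !trmx_mul !mulmxA.
rewrite KMK.
by apply: H; apply: submxMl.
Qed.

End FlagConditions.

End AdaptedBasis.

(** * Row spaces, pivots and charts *)

Section RowSpaces.
Variables (C : fieldType) (N : nat).

Lemma mem_rowspan k (A : 'M[C]_(k, N)) v : (v \in rowspan A) = (v <= A)%MS.
Proof.
apply/idP/idP => [/coord_span ->|/submxP[D ->]].
  apply: summx_sub => i _; apply: scalemx_sub.
  have : [seq row j A | j : 'I_k]`_i \in [seq row j A | j : 'I_k].
    by rewrite mem_nth // size_image.
  by case/mapP => j _ /= ->; apply: row_sub.
rewrite mulmx_sum_row; apply: memv_suml => i _; apply: memvZ.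
by apply: memv_span; apply: map_f; rewrite mem_enum.
Qed.

Definition frame_of k (U : {vspace 'rV[C]_N}) : 'M[C]_(k, N) :=
  \matrix_(i < k) (vbasis U)`_i.

Section FrameOf.
Variables (k : nat) (U : {vspace 'rV[C]_N}).
Hypothesis dimU : \dim U = k.

Lemma mem_frame_of v : (v \in U) = (v <= frame_of k U)%MS.
Proof.
subst k; apply/idP/idP => [/coord_vbasis ->|/submxP[D ->]].
  apply: summx_sub => i _; apply: scalemx_sub.
  by have := row_sub i (frame_of (\dim U) U); rewrite rowK.
rewrite mulmx_sum_row; apply: memv_suml => i _; apply: memvZ.
by rewrite rowK vbasis_mem // mem_nth // size_tuple.
Qed.

Lemma frame_of_free : row_free (frame_of k U).
Proof.
subst k; rewrite -kermx_eq0; apply/eqP/row_matrixP => i; rewrite row0.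
have /freeP free := basis_free (vbasisP U).
set z := row i _; have : z *m frame_of (\dim U) U = 0.
  by rewrite -row_mul mulmx_ker row0.
rewrite mulmx_sum_row => E; apply/rowP => j; rewrite [RHS]mxE.
apply: (free (fun j => z 0 j)); rewrite -[RHS]E; apply: eq_bigr => l _.
by rewrite rowK.
Qed.

End FrameOf.

Lemma rowspan_eqmx k l (A : 'M[C]_(k, N)) (A' : 'M[C]_(l, N)) :
  (forall v : 'rV_N, (v <= A)%MS = (v <= A')%MS) -> (A :=: A')%MS.
Proof.
move=> E; apply/eqmxP/andP; split; apply/row_subP => i.
  by rewrite -E row_sub.
by rewrite E row_sub.
Qed.

Lemma dim_rowspan k (A : 'M[C]_(k, N)) : \dim (rowspan A) = \rank A.
Proof.
have E : (frame_of (\dim (rowspan A)) (rowspan A) :=: A)%MS.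
  by apply: rowspan_eqmx => v; rewrite -mem_frame_of // mem_rowspan.
by rewrite -(eqP (frame_of_free (erefl (\dim (rowspan A))))) E.
Qed.

End RowSpaces.

Section Charts.
Variables (C : fieldType) (N n : nat) (K : 'M[C]_(n, N)).
Hypothesis Kfree : row_free K.

(** Linear in A and defined also for frames outside K, so minors and charts extend to open sets of
    the whole Grassmannian. *)
Definition coord_mx k (A : 'M[C]_(k, N)) := A *m pinvmx K.

Lemma coord_mxK k (A : 'M[C]_(k, N)) : (A <= K)%MS -> coord_mx A *m K = A.
Proof. exact: mulmxKpV. Qed.

Lemma coord_mx_mulK k (Y : 'M[C]_(k, n)) : coord_mx (Y *m K) = Y.
Proof. by rewrite /coord_mx -mulmxA mulmxVp // mulmx1. Qed.

Section Chart.
Variables (k : nat) (f : 'I_k -> 'I_n).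

Definition minor (A : 'M[C]_(k, N)) := \det (colsub f (coord_mx A)).

(** The frame normalized to the identity on the columns f, its rows then placed at the indices f i
    to match the format of [reduced]. *)
Definition chart (A : 'M[C]_(k, N)) : 'M[C]_n :=
  (rowsub f 1%:M)^T *m (invmx (colsub f (coord_mx A)) *m coord_mx A).

Lemma coord_mxM j (D : 'M[C]_(j, k)) (A : 'M[C]_(k, N)) :
  coord_mx (D *m A) = D *m coord_mx A.
Proof. by rewrite /coord_mx mulmxA. Qed.

Lemma minorM (D : 'M[C]_k) A : minor (D *m A) = \det D * minor A.
Proof. by rewrite /minor coord_mxM -det_mulmx -mulmx_colsub. Qed.

Lemma minorM_eq0 (D : 'M[C]_k) A : D \in unitmx ->
  (minor (D *m A) == 0) = (minor A == 0).
Proof.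
by rewrite unitmxE unitfE minorM mulf_eq0 => /negPf->.
Qed.

Lemma chartM (D : 'M[C]_k) A : D \in unitmx -> minor A != 0 ->
  chart (D *m A) = chart A.
Proof.
move=> Du mA; rewrite /chart coord_mxM -mulmx_colsub; congr (_ *m _).
have Gu : colsub f (coord_mx A) \in unitmx by rewrite unitmxE unitfE.
apply: (can_inj (mulKmx (_ : D *m colsub f (coord_mx A) \in unitmx))).
  by rewrite unitmx_mul Du.
by rewrite mulKVmx ?unitmx_mul ?Du // -mulmxA mulKVmx.
Qed.

Variables (P : {set 'I_n}) (R : 'M[C]_n).
Hypothesis f_inj : injective f.
Hypothesis fP : forall j, j \in P <-> exists i, f i = j.
Hypothesis rR : reduced P R.

Let fPi i : f i \in P. Proof. by apply/fP; exists i. Qed.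

Lemma sel_mul p (Y : 'M[C]_(k, p)) j : 
  (forall i, row (f i) ((rowsub f 1%:M)^T *m Y) = row i Y) /\
  (j \notin P -> row j ((rowsub f 1%:M)^T *m Y) = 0).
Proof.
split=> [i|jP]; apply/rowP => l; rewrite !mxE.
  rewrite (bigD1 i) //= !mxE eqxx mul1r big1 ?addr0 // => i' ii'.
  by rewrite !mxE (inj_eq f_inj) (negPf ii') mul0r.
rewrite big1 // => i _; rewrite !mxE; case: eqP => [E|_]; rewrite ?mul0r //.
by rewrite -E fPi in jP.
Qed.

Lemma sel_rowsub : (rowsub f 1%:M)^T *m rowsub f R = R.
Proof.
apply/row_matrixP => j; have [/fP[i <-]|jP] := boolP (j \in P).
  by rewrite (sel_mul _ (f i)).1; apply/rowP => l; rewrite !mxE.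
rewrite (sel_mul _ j).2 //; apply/rowP => l; rewrite !mxE.
by rewrite (reduced_row0 rR).
Qed.

Lemma mxsub_reduced : mxsub f f R = 1%:M.
Proof.
by apply/matrixP => i j; rewrite !mxE (reduced_pivot rR) // (inj_eq f_inj).
Qed.

Lemma reduced_rowsub_mul p (Y : 'M[C]_(p, n)) : Y *m R = colsub f Y *m rowsub f R.
Proof.
rewrite -{1}sel_rowsub mulmxA; congr (_ *m _); apply/matrixP => i j.
rewrite !mxE (bigD1 (f j)) //= !mxE eqxx mulr1 big1 ?addr0 // => l lj.
by rewrite !mxE eq_sym (negPf lj) mulr0.
Qed.

Lemma rowsub_reduced_eqmx : (rowsub f R :=: R)%MS.
Proof.
apply/eqmxP/andP; split; first exact: rowsub_sub.
by rewrite -{1}sel_rowsub submxMl.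
Qed.

Lemma rank_reduced : \rank R = k.
Proof.
rewrite -rowsub_reduced_eqmx; apply/eqP; rewrite eqn_leq rank_leq_row /=.
have : colsub f (rowsub f R) = 1%:M by rewrite -mxsub_reduced; apply/matrixP => i j; rewrite !mxE.
move=> E; rewrite -[X in (X <= _)%N](@mxrank1 C k) -E.
have -> : colsub f (rowsub f R) = rowsub f R *m colsub f 1%:M.
  by rewrite mulmx_colsub mulmx1.
exact: mxrankM_maxl.
Qed.

Lemma chart_reduced (A : 'M[C]_(k, N)) : (A :=: R *m K)%MS ->
  minor A != 0 /\ chart A = R.
Proof.
move=> AE; pose G := colsub f (coord_mx A).
have A0E : coord_mx A = G *m rowsub f R.
  rewrite -reduced_rowsub_mul; apply/esym/(reduced_subP _ rR).
  have /submxP[D ->] : (A <= R *m K)%MS by rewrite AE.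
  by rewrite mulmxA coord_mx_mulK submxMl.
have Gu : G \in unitmx.
  have /submxP[D DE] : (R *m K <= A)%MS by rewrite AE.
  have RE : R = D *m coord_mx A by rewrite -[LHS]coord_mx_mulK DE /coord_mx mulmxA.
  have E : rowsub f D *m G = 1%:M.
    rewrite -mxsub_reduced RE /G; apply/matrixP => i j; rewrite !mxE.
    by apply: eq_bigr => l _; rewrite !mxE.
  by case: (mulmx1_unit E).
split; first by move: Gu; rewrite unitmxE unitfE.
by rewrite /chart -/G A0E mulKmx // sel_rowsub.
Qed.

(** A nonzero term in the expansion of the minor of R gives a permutation s, and triangularity gives
    g (s i) <= f i for all i. *)
Lemma minor_reduced_le (g : 'I_k -> 'I_n) (A : 'M[C]_(k, N)) :
  (A :=: R *m K)%MS -> \det (colsub g (coord_mx A)) != 0 ->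
  (forall j, j \in P <-> exists i, g i = j) \/ (\sum_i g i < \sum_i f i)%N.
Proof.
move=> AE; have [] := chart_reduced AE; rewrite /minor => mA _.
have A0E : coord_mx A = colsub f (coord_mx A) *m rowsub f R.
  rewrite -reduced_rowsub_mul; apply/esym/(reduced_subP _ rR).
  have /submxP[D ->] : (A <= R *m K)%MS by rewrite AE.
  by rewrite mulmxA coord_mx_mulK submxMl.
rewrite A0E -mulmx_colsub det_mulmx mulf_eq0 negb_or => /andP[_].
move=> /eqP det0; have [s sP] : exists s : 'S_k, forall i, R (f i) (g (s i)) != 0.
  apply: contrapT => /forallNP no; apply: det0; apply: big1 => s _.
  have /existsNP[i /negP] := no s; rewrite negbK => /eqP Ri0.
  by rewrite (bigD1 i) //= !mxE Ri0 mul0r mulr0.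
have le i : (g (s i) <= f i)%N.
  rewrite leqNgt; apply/negP => lt; have /eqP := sP i; apply.
  exact: reduced_trig rR _ _ lt.
have sumE : (\sum_i g i = \sum_i g (s i))%N by rewrite (reindex_inj (@perm_inj _ s)).
have [E|ne] := pselect (forall i, g (s i) = f i :> nat).
  left=> j; rewrite fP; split=> [] [i <-].
    by exists (s i); apply: val_inj; apply: E.
  by exists ((s^-1)%g i); apply: val_inj; rewrite /= -E permKV.
right; rewrite sumE ltn_neqAle leq_sum // andbT; apply/eqP => sE; apply: ne => i.
apply/eqP; rewrite eqn_leq le /= leqNgt; apply/negP => lt.
move: sE; rewrite (bigD1 i) //= [RHS](bigD1 i) //= => sE.
have lesum : (\sum_(j | j != i) g (s j) <= \sum_(j | j != i) f j)%N.
  by apply: leq_sum => j _.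
by have := leq_add lt lesum; rewrite addSn sE ltnn.
Qed.

End Chart.

Lemma injective_enum (P : {set 'I_n}) k : #|P| = k ->
  exists f : 'I_k -> 'I_n, injective f /\ forall j, j \in P <-> exists i, f i = j.
Proof.
move=> <-; exists enum_val; split; first exact: enum_val_inj.
move=> j; split=> [jP|[i <-]]; last exact: enum_valP.
by exists (enum_rank_in jP j); rewrite enum_rankK_in.
Qed.

(** The pivots maximize the column sum among nonvanishing maximal minors. A nonzero entry beyond a
    pivot could be exchanged for it, increasing the sum. *)
Lemma reduced_exists k (A : 'M[C]_(k, N)) : row_free A -> (A <= K)%MS ->
  exists P R, reduced P R /\ (A :=: R *m K)%MS.
Proof.
move=> Afree AK; pose A0 := coord_mx A.
have A0K : A0 *m K = A := coord_mxK AK.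
have A0free : row_free A0.
  rewrite -kermx_eq0; apply/eqP/row_matrixP => i; rewrite row0.
  have /sub_kermxP := row_sub i (kermx A0) => E.
  by apply: (row_free_inj Afree); rewrite mul0mx -A0K mulmxA E mul0mx.
pose ok (g : {ffun 'I_k -> 'I_n}) := \det (colsub g A0) != 0.
have [g0 ok0] : exists g, ok g.
  have A0t : row_full A0^T by rewrite /row_full mxrank_tr.
  exists (fullrankfun A0t); rewrite /ok -unitfE -unitmxE -unitmx_tr.
  suff -> : (colsub (fullrankfun A0t) A0)^T = rowsub (fullrankfun A0t) A0^T.
    exact: fullrowsub_unit.
  by apply/matrixP => i j; rewrite !mxE.
have [f okf fmax] := arg_maxnP (fun g : {ffun 'I_k -> 'I_n} => \sum_i g i)%N ok0.
pose G := colsub f A0.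
have Gu : G \in unitmx by rewrite unitmxE unitfE.
have [R0 R0E] : exists R0, R0 = invmx G *m A0 by exists (invmx G *m A0).
have R0f i j : R0 i (f j) = (i == j)%:R.
  have : colsub f R0 = 1%:M by rewrite R0E -mulmx_colsub mulVmx.
  by move=> /matrixP/(_ i j); rewrite !mxE.
have f_inj : injective f.
  move=> i j fij; apply/eqP; have := R0f i j; rewrite -fij R0f eqxx.
  by case: eqP => // _ /eqP; rewrite oner_eq0.
pose P := [set f i | i : 'I_k].
pose R := (rowsub f 1%:M)^T *m R0.
have fP j : j \in P <-> exists i, f i = j.
  by split=> [/imsetP[i _ ->]|[i <-]]; [exists i | rewrite imset_f].
have Rf i l : R (f i) l = R0 i l.
  by have /rowP/(_ l) := (sel_mul f_inj fP R0 (f i)).1 i; rewrite !mxE.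
have R0_trig i (l : 'I_n) : (f i < l)%N -> R0 i l = 0.
  move=> lt; apply/eqP; apply: contraTT isT => R0il.
  pose g := [ffun j => if j == i then l else f j].
  have okg : ok g.
    have -> : ok g = (colsub g A0 \in unitmx) by rewrite unitmxE unitfE.
    have -> : colsub g A0 = G *m colsub g R0.
      by rewrite mulmx_colsub R0E mulKVmx.
    rewrite unitmx_mul Gu /=; apply: unitmx_kerP => z z0.
    have zj j : j != i -> z 0 j = 0.
      move=> ji; move/rowP/(_ j): z0; rewrite !mxE (bigD1 j) //= !mxE ffunE.
      rewrite (negPf ji) R0f eqxx mulr1 big1 ?addr0 // => p pj.
      by rewrite !mxE ffunE (negPf ji) R0f (negPf pj) mulr0.
    apply/rowP => j; rewrite [RHS]mxE; have [->|/zj //] := eqVneq j i.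
    move/rowP/(_ i): z0; rewrite !mxE (bigD1 i) //= !mxE ffunE eqxx big1.
      by rewrite addr0 => /eqP; rewrite mulf_eq0 (negPf R0il) orbF => /eqP.
    by move=> p pi; rewrite zj ?mul0r.
  have le : (\sum_i g i <= \sum_i f i)%N := fmax g okg.
  move: le; rewrite leqNgt => /negP[].
  rewrite (bigD1 i) //= [X in (_ < X)%N](bigD1 i) //= ffunE eqxx.
  rewrite -addSn leq_add //; apply: leq_sum => j ji.
  by rewrite ffunE (negPf ji).
exists P, R; split.
  split=> [j l jP|j l /fP[i <-] /fP[p <-]|j l lt].
  - by have /rowP/(_ l) := (sel_mul f_inj fP R0 j).2 jP; rewrite !mxE.
  - by rewrite Rf R0f (inj_eq f_inj).
  - have [/fP[i E]|jP] := boolP (j \in P).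
      by rewrite -E Rf R0_trig // E.
    by have /rowP/(_ l) := (sel_mul f_inj fP R0 j).2 jP; rewrite !mxE.
have RR0 : (R :=: R0)%MS.
  apply/eqmxP/andP; split; first exact: submxMl.
  apply/row_subP => i; rewrite -((sel_mul f_inj fP R0 (f i)).1 i).
  exact: row_sub.
apply: eqmx_sym; apply: eqmx_trans (eqmxMr K RR0) _.
have -> : R0 *m K = invmx G *m A by rewrite R0E -mulmxA A0K.
by apply: eqmxMfull; rewrite row_full_unit unitmx_inv.
Qed.

End Charts.

(** * Cells of a closed subset of the flag variety *)

Section FracChart.
Variables (C : fieldType) (N n k : nat) (K : 'M[C]_(n, N)) (f : 'I_k -> 'I_n).
Variables (d : nat) (y : 'rV[C]_d -> 'M[C]_(k, N)).
Hypothesis yp : polymx y.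

Lemma polymx_coord : polymx (fun v => coord_mx K (y v)).
Proof. by move=> i j; apply: polyfun_mulmx => // a b; apply: polyfun_const. Qed.

Let polymx_minor : polymx (fun v => colsub f (coord_mx K (y v))).
Proof.
by move=> i j; apply: eq_polyfun (polymx_coord i (f j)) => v; rewrite [RHS]mxE.
Qed.

Lemma polyfun_minor : polyfun (fun v => minor K f (y v)).
Proof. exact: polyfun_det. Qed.

(** Cramer's rule: the minor is the only denominator. *)
Lemma fracfun_chart i j :
  fracfun (fun v => minor K f (y v)) (fun v => chart K f (y v) i j).
Proof.
exists (fun v => ((rowsub f 1%:M)^T *m
  (\adj (colsub f (coord_mx K (y v))) *m coord_mx K (y v))) i j), 1%N.
split=> [|v mv].
  apply: polyfun_mulmx => [a b|a b]; first exact: polyfun_const.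
  apply: polyfun_mulmx => [p q|p q]; last exact: polymx_coord.
  apply: (@eq_polyfun _ _ (fun v => cofactor (colsub f (coord_mx K (y v))) q p)).
    by move=> v; rewrite mxE.
  apply: polyfunM; first exact: polyfun_const.
  apply: polyfun_det => r s.
  apply: eq_polyfun (polymx_minor (lift q r) (lift p s)) => v.
  by rewrite !mxE.
rewrite /chart /invmx unitmxE unitfE mv -scalemxAl -scalemxAr mxE mulrC expr1 //.
Qed.

End FracChart.

Lemma fracfunMl (C : fieldType) d (delta eps f : 'rV[C]_d -> C) :
  polyfun eps -> fracfun delta f -> fracfun (fun v => delta v * eps v) f.
Proof.
move=> pe [g [k [pg gE]]]; exists (fun v => g v * eps v ^+ k), k; split.
  by apply: polyfunM => //; apply: polyfun_exp.
move=> v; rewrite mulf_eq0 negb_or => /andP[dv ev].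
by rewrite gE // exprMn invfM mulrACA mulfV ?mulr1 // expf_neq0.
Qed.

Lemma frame_of_rowspan (C : fieldType) N k (A : 'M[C]_(k, N)) : row_free A ->
  exists2 D : 'M[C]_k, D \in unitmx & frame_of k (rowspan A) = D *m A.
Proof.
move=> Afree; have dimA : \dim (rowspan A) = k by rewrite dim_rowspan (eqP Afree).
have E : (frame_of k (rowspan A) :=: A)%MS.
  by apply: rowspan_eqmx => v; rewrite -mem_frame_of // mem_rowspan.
have /submxP[D DE] : (frame_of k (rowspan A) <= A)%MS by rewrite E.
exists D => //; rewrite -row_full_unit /row_full eqn_leq rank_leq_col /=.
by rewrite -{1}(eqP (frame_of_free dimA)) DE mxrankM_maxl.
Qed.

Section Quotients.
Local Open Scope classical_set_scope.
Variables (C : fieldType) (X Y : Defs.space C) (T : Type) (pi : X -> T).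

Lemma morphism_on_quotient (O : set T) (phi : T -> Y) :
  @morphism_on C X Y (pi @^-1` O) (phi \o pi) ->
  @morphism_on C (quotient_space pi) Y O phi.
Proof. by []. Qed.

Lemma morphism_quotient (phi : Y -> X) :
  morphism phi -> @morphism C Y (quotient_space pi) (pi \o phi).
Proof.
move=> mphi U oU; have [o r] := mphi (pi @^-1` U) oU.
by split=> // f rf; apply: (r (f \o pi)).
Qed.

End Quotients.

Section FlagCells.
Local Open Scope classical_set_scope.
Variables (C : fieldType) (N n k l : nat) (K : 'M[C]_(n, N)) (x : 'M[C]_N).
Hypothesis Kfree : row_free K.
Variable Z : set (triple C N).
Hypothesis Z_endo : forall t, Z t -> endo t = x.
Hypothesis Z_dim1 : forall t, Z t -> \dim t.1.2 = k.
Hypothesis Z_dim2 : forall t, Z t -> \dim t.2 = l.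
Hypothesis Z_sub1 : forall t v, Z t -> v \in t.1.2 -> (v <= K)%MS.
Hypothesis Z_sub2 : forall t v, Z t -> v \in t.2 -> (v <= K)%MS.

Let G := endo_Gr_Gr C N k l.
Let X := @subspace C G Z.

Lemma polymx_frame1 : polymx (@frame1_of C N k l).
Proof.
move=> i j; apply: (@eq_polyfun _ _
  (fun v => v 0 (rshift (N * N) (lshift (l * N) (mxvec_index i j))))).
  by move=> v; rewrite !mxE.
exact: polyfun_coord.
Qed.

Lemma polymx_frame2 : polymx (@frame2_of C N k l).
Proof.
move=> i j; apply: (@eq_polyfun _ _
  (fun v => v 0 (rshift (N * N) (rshift (k * N) (mxvec_index i j))))).
  by move=> v; rewrite !mxE.
exact: polyfun_coord.
Qed.

Lemma minor_frame (v : @subspace C (affine C _) (@frames C N k l)) :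
  (forall f, (minor K f (frame_of k (triple_of_frames v).1.2) == 0) =
    (minor K f (frame1_of (val v)) == 0)) /\
  (forall f, (minor K f (frame_of l (triple_of_frames v).2) == 0) =
    (minor K f (frame2_of (val v)) == 0)).
Proof.
have /set_mem[fr1 fr2] := valP v; rewrite /triple_of_frames /=.
have [D1 D1u ->] := frame_of_rowspan fr1.
have [D2 D2u ->] := frame_of_rowspan fr2.
by split=> f; rewrite minorM_eq0.
Qed.

Definition flag_of (R' R : 'M[C]_n) : triple C N :=
  (x, rowspan (R' *m K), rowspan (R *m K)).

Definition cell_matrices (J : {set 'I_n} * {set 'I_n}) (R' R : 'M[C]_n) :=
  [/\ reduced J.1 R', reduced J.2 R & Z (flag_of R' R)].

Definition cell J : set X := [set z | exists R' R,
  cell_matrices J R' R /\ val z = flag_of R' R].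

Section CellIso.
Variables (J' J : {set 'I_n}) (f1 : 'I_k -> 'I_n) (f2 : 'I_l -> 'I_n).
Hypothesis f1_inj : injective f1.
Hypothesis f2_inj : injective f2.
Hypothesis f1J : forall j, j \in J' <-> exists i, f1 i = j.
Hypothesis f2J : forall j, j \in J <-> exists i, f2 i = j.

Let U1 (t : triple C N) := frame_of k t.1.2.
Let U2 (t : triple C N) := frame_of l t.2.

Lemma chart_flag R' R : cell_matrices (J', J) R' R ->
  [/\ minor K f1 (U1 (flag_of R' R)) != 0, chart K f1 (U1 (flag_of R' R)) = R',
      minor K f2 (U2 (flag_of R' R)) != 0 & chart K f2 (U2 (flag_of R' R)) = R].
Proof.
case=> /= rR' rR Zt.
have E1 : (U1 (flag_of R' R) :=: R' *m K)%MS.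
  apply: rowspan_eqmx => v; rewrite -mem_frame_of ?mem_rowspan //; exact: Z_dim1.
have E2 : (U2 (flag_of R' R) :=: R *m K)%MS.
  apply: rowspan_eqmx => v; rewrite -mem_frame_of ?mem_rowspan //; exact: Z_dim2.
have [m1 c1] := chart_reduced Kfree f1_inj f1J rR' E1.
by have [m2 c2] := chart_reduced Kfree f2_inj f2J rR E2.
Qed.

Let Omega : set G := [set t | minor K f1 (U1 t) != 0 /\ minor K f2 (U2 t) != 0].

Variables (d : nat) (c : 'I_d -> bool * ('I_n * 'I_n)).

Let coordinates (Y' Y : 'M[C]_n) : 'rV[C]_d :=
  \row_i (if (c i).1 then Y' else Y) (c i).2.1 (c i).2.2.

Let phi0 (t : G) : affine C d :=
  coordinates (chart K f1 (U1 t)) (chart K f2 (U2 t)).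

(** Changing the frame by an invertible matrix affects neither the chart nor the nonvanishing of
    minors. So [phi0] is induced by the rational map [phi1] on frames, with the product of both
    minors as denominator. *)
Lemma morphism_on_chart : @morphism_on C G (affine C d) Omega phi0.
Proof.
apply: morphism_on_quotient.
pose delta (v : 'rV[C]_(N * N + (k * N + l * N))) :=
  minor K f1 (frame1_of v) * minor K f2 (frame2_of v).
pose phi1 (v : affine C (N * N + (k * N + l * N))) : affine C d :=
  coordinates (chart K f1 (frame1_of v)) (chart K f2 (frame2_of v)).
have pm1 := polyfun_minor K f1 polymx_frame1.
have pm2 := polyfun_minor K f2 polymx_frame2.
have mphi1 : morphism_on ([set v | delta v != 0] : set (affine C _)) phi1.
  apply: morphism_on_affine => [|i]; first exact: polyfunM.
  have -> : (fun v => phi1 v 0 i) = (fun v => (if (c i).1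
      then chart K f1 (frame1_of v) else chart K f2 (frame2_of v)) (c i).2.1 (c i).2.2).
    by apply: funext => v; rewrite mxE.
  case: (c i).1.
    exact: fracfunMl pm2 (fracfun_chart K f1 polymx_frame1 (c i).2.1 (c i).2.2).
  have -> : delta = (fun v => minor K f2 (frame2_of v) * minor K f1 (frame1_of v)).
    by apply: funext => v; rewrite mulrC.
  exact: fracfunMl pm1 (fracfun_chart K f2 polymx_frame2 (c i).2.1 (c i).2.2).
have inv (v : @subspace C (affine C _) (@frames C N k l)) :
    [/\ (minor K f1 (U1 (triple_of_frames v)) == 0) = (minor K f1 (frame1_of (val v)) == 0),
        (minor K f2 (U2 (triple_of_frames v)) == 0) = (minor K f2 (frame2_of (val v)) == 0) &
        delta (val v) != 0 -> phi0 (triple_of_frames v) = phi1 (val v)].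
  have /set_mem[fr1 fr2] := valP v.
  rewrite /U1 /U2 /triple_of_frames /=.
  have [D1 D1u E1] := frame_of_rowspan fr1.
  have [D2 D2u E2] := frame_of_rowspan fr2.
  rewrite E1 E2 !minorM_eq0 //; split=> //.
  rewrite /delta mulf_eq0 negb_or => /andP[m1 m2].
  by rewrite /phi0 /phi1 /U1 /U2 /= E1 E2 !chartM.
have -> : @triple_of_frames C N k l @^-1` Omega = val @^-1` [set v | delta v != 0].
  apply/seteqP; split=> v; have [i1 i2 _] := inv v; rewrite /Omega /= /delta.
    by rewrite i1 i2 => -[m1 m2]; rewrite mulf_neq0.
  by rewrite i1 i2 mulf_eq0 negb_or => /andP[].
apply: morphism_on_subspace mphi1 => v dv.
by have [_ _] := inv v; apply.
Qed.

Variables (A B : 'rV[C]_d -> 'M[C]_n).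
Hypotheses (polyA : polymx A) (polyB : polymx B).
Hypothesis AB_cell : forall a, cell_matrices (J', J) (A a) (B a) /\
  coordinates (A a) (B a) = a.
Hypothesis cell_AB : forall Y' Y, cell_matrices (J', J) Y' Y ->
  Y' = A (coordinates Y' Y) /\ Y = B (coordinates Y' Y).

Let frame_coords (a : affine C d) : affine C (N * N + (k * N + l * N)) :=
  row_mx (mxvec x) (row_mx (mxvec (rowsub f1 (A a) *m K))
                           (mxvec (rowsub f2 (B a) *m K))).

Let frames_coords a : @frames C N k l (frame_coords a).
Proof.
have [[/= rA rB Zt] _] := AB_cell a.
rewrite /frames /= /frame1_of /frame2_of row_mxKr row_mxKl row_mxKr !mxvecK.
split; rewrite /row_free mxrankMfree //.
  by rewrite (rowsub_reduced_eqmx f1_inj f1J rA) (rank_reduced f1_inj f1J rA).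
by rewrite (rowsub_reduced_eqmx f2_inj f2J rB) (rank_reduced f2_inj f2J rB).
Qed.

Let psi1 (a : affine C d) : @subspace C (affine C _) (@frames C N k l) :=
  exist _ (frame_coords a) (mem_set (frames_coords a)).

Let psi1E a : triple_of_frames (psi1 a) = flag_of (A a) (B a).
Proof.
have [[/= rA rB Zt] _] := AB_cell a.
rewrite /triple_of_frames /= /endo_of /frame1_of /frame2_of.
rewrite row_mxKl !row_mxKr row_mxKl !mxvecK /flag_of.
congr (_, _, _); apply/vspaceP => v; rewrite !mem_rowspan.
  by rewrite (eqmxMr K (rowsub_reduced_eqmx f1_inj f1J rA)).
by rewrite (eqmxMr K (rowsub_reduced_eqmx f2_inj f2J rB)).
Qed.

Let Z_psi a : Z (triple_of_frames (psi1 a)).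
Proof. by rewrite psi1E; have [[]] := AB_cell a. Qed.

Let psi2 (a : affine C d) : X :=
  exist _ (triple_of_frames (psi1 a)) (mem_set (Z_psi a)).

Let cell_psi a : cell (J', J) (psi2 a).
Proof.
exists (A a), (B a); split; first by have [] := AB_cell a.
exact: psi1E.
Qed.

Let psi (a : affine C d) : subspace (cell (J', J)) :=
  exist _ (psi2 a) (mem_set (cell_psi a)).

Let phi (z : subspace (cell (J', J))) : affine C d := phi0 (val (val z)).

(** Reading off the entries [c] of the charts is inverse to sending a parameter to the frames formed
    by the pivot rows of its echelon matrices. *)
Lemma cell_isomorphic : isomorphic (subspace (cell (J', J))) (affine C d).
Proof.
exists phi, psi; split.
- move=> z; have /set_mem[R' [R [cR zE]]] := valP z.
  apply: val_inj; apply: val_inj; rewrite /= psi1E /phi /phi0 zE.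
  have [_ -> _ ->] := chart_flag cR.
  by have [<- <-] := cell_AB cR.
- move=> a; rewrite /phi /psi /= /phi0 psi1E.
  have [ca Ea] := AB_cell a; have [_ -> _ ->] := chart_flag ca.
  exact: Ea.
- pose O1 : set X := val @^-1` Omega.
  apply: (@morphism_onT C (subspace (cell (J', J))) (affine C d) (val @^-1` O1)) => [z|].
    have /set_mem[R' [R [cR zE]]] := valP z.
    rewrite /O1 /= zE; have [m1 _ m2 _] := chart_flag cR.
    by split.
  apply: (@morphism_on_subspace C X _ _ O1 (phi0 \o val)) => //.
  exact: (@morphism_on_subspace C G _ _ Omega phi0 (phi0 \o val) _ morphism_on_chart).
apply: (@morphism_into_subspace C d X _ psi2) => //.
apply: (@morphism_into_subspace C d G _ (@triple_of_frames C N k l \o psi1)) => //.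
apply: morphism_quotient.
apply: (@morphism_into_subspace C d (affine C _) _ frame_coords) => //.
apply: morphism_polynomial => i; rewrite /frame_coords.
have pmx p q (Y : 'rV[C]_d -> 'M[C]_(p, q)) j :
    polymx Y -> polyfun (fun a => mxvec (Y a) 0 j).
  case/mxvec_indexP: j => r s pY.
  by apply: eq_polyfun (pY r s) => a; rewrite mxvecE.
have psub e (g : 'I_e -> 'I_n) (Y : 'rV[C]_d -> 'M[C]_n) : polymx Y ->
    polymx (fun a => rowsub g (Y a) *m K).
  move=> pY r s; apply: polyfun_mulmx => [p q|p q]; last exact: polyfun_const.
  by apply: eq_polyfun (pY (g p) q) => a; rewrite mxE.
case: (split_ordP i) => [j ->|j ->].
  apply: (@eq_polyfun _ _ (fun=> mxvec x 0 j)); last exact: polyfun_const.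
  by move=> a; rewrite row_mxEl.
case: (split_ordP j) => [r ->|r ->].
  apply: eq_polyfun (pmx _ _ _ r (psub _ f1 _ polyA)) => a.
  by rewrite row_mxEr row_mxEl.
apply: eq_polyfun (pmx _ _ _ r (psub _ f2 _ polyB)) => a.
by rewrite !row_mxEr.
Qed.

End CellIso.

Lemma frame_of_flag R' R t : Z t -> t = flag_of R' R ->
  (frame_of k t.1.2 :=: R' *m K)%MS /\ (frame_of l t.2 :=: R *m K)%MS.
Proof.
move=> Zt tE; split; apply: rowspan_eqmx => v; rewrite -mem_frame_of.
- by rewrite tE mem_rowspan.
- exact: Z_dim1.
- by rewrite tE mem_rowspan.
- exact: Z_dim2.
Qed.

Lemma card_cell_matrices J R' R : cell_matrices J R' R -> #|J.1| = k /\ #|J.2| = l.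
Proof.
case=> rR' rR Zt; split.
  have [f [f_inj fJ]] := injective_enum (erefl #|J.1|).
  by rewrite -(Z_dim1 Zt) dim_rowspan mxrankMfree // (rank_reduced f_inj fJ rR').
have [f [f_inj fJ]] := injective_enum (erefl #|J.2|).
by rewrite -(Z_dim2 Zt) dim_rowspan mxrankMfree // (rank_reduced f_inj fJ rR).
Qed.

Lemma cell_cover (z : X) : exists J, cell J z.
Proof.
have Zz : Z (val z) := set_mem (valP z).
have sub1 : (frame_of k (val z).1.2 <= K)%MS.
  apply/row_subP => i; apply: (Z_sub1 Zz).
  by rewrite (mem_frame_of (Z_dim1 Zz)) row_sub.
have sub2 : (frame_of l (val z).2 <= K)%MS.
  apply/row_subP => i; apply: (Z_sub2 Zz).
  by rewrite (mem_frame_of (Z_dim2 Zz)) row_sub.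
have [J' [R' [rR' E1]]] := reduced_exists (frame_of_free (Z_dim1 Zz)) sub1.
have [J [R [rR E2]]] := reduced_exists (frame_of_free (Z_dim2 Zz)) sub2.
have zE : val z = flag_of R' R.
  rewrite /flag_of -(Z_endo Zz) /endo.
  have -> : rowspan (R' *m K) = (val z).1.2.
    by apply/vspaceP => v; rewrite mem_rowspan (mem_frame_of (Z_dim1 Zz)) E1.
  have -> : rowspan (R *m K) = (val z).2.
    by apply/vspaceP => v; rewrite mem_rowspan (mem_frame_of (Z_dim2 Zz)) E2.
  by case: (val z) => [[]].
by exists (J', J), R', R; split=> //; split=> //=; rewrite -zE.
Qed.

Let height (J : {set 'I_n}) := (\sum_(j in J) j)%N.

(** A vanishing condition on minors, hence closed. It allows only the pivot set J and pivot sets of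
    smaller height. *)
Let minor_bound p (J : {set 'I_n}) (Y : 'M[C]_(p, N)) :=
  forall g : {ffun 'I_p -> 'I_n}, minor K g Y != 0 ->
    [set g i | i : 'I_p]%SET = J \/ (height [set g i | i : 'I_p]%SET < height J)%N.

Let height_imset p (g : 'I_p -> 'I_n) : injective g ->
  height [set g i | i : 'I_p]%SET = (\sum_i g i)%N.
Proof. by move=> g_inj; rewrite /height big_imset //= => i j _ _; apply: g_inj. Qed.

Let imsetE p (g : 'I_p -> 'I_n) (J : {set 'I_n}) :
  (forall j, j \in J <-> exists i, g i = j) <-> [set g i | i : 'I_p]%SET = J.
Proof.
split=> [gJ|<- j].
  apply/setP => j; apply/imsetP/idP => [[i _ ->]|/gJ[i <-]]; last by exists i.
  by apply/gJ; exists i.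
by split=> [/imsetP[i _ ->]|[i <-]]; [exists i | rewrite imset_f].
Qed.

Let minor_inj p (g : 'I_p -> 'I_n) (Y : 'M[C]_(p, N)) : minor K g Y != 0 -> injective g.
Proof.
move=> mg i j gij; apply: contrapT => /eqP ij; move/negP: mg; apply; apply/eqP.
rewrite /minor -det_tr; apply: (determinant_alternate ij) => m.
by rewrite !mxE gij.
Qed.

Let reduced_minor_bound p (J : {set 'I_n}) (R : 'M[C]_n) (Y : 'M[C]_(p, N)) :
  #|J| = p -> reduced J R ->
  (Y :=: R *m K)%MS -> minor_bound J Y.
Proof.
move=> cJ rR YE g mg; have [f [f_inj fJ]] := injective_enum cJ.
have [/imsetE|] := minor_reduced_le Kfree f_inj fJ rR YE mg; first by left.
rewrite -(height_imset (minor_inj mg)) -(height_imset f_inj).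
by rewrite ((imsetE f J).1 fJ); right.
Qed.

Let minor_bound_reduced p (J J1 : {set 'I_n}) (R : 'M[C]_n) (Y : 'M[C]_(p, N)) :
  #|J1| = p -> reduced J1 R ->
  (Y :=: R *m K)%MS -> minor_bound J Y -> J1 = J \/ (height J1 < height J)%N.
Proof.
move=> cJ rR YE bJ; have [f [f_inj fJ]] := injective_enum cJ.
have [mf _] := chart_reduced Kfree f_inj fJ rR YE.
have := bJ (finfun f); have -> : (finfun f : 'I_p -> 'I_n) = f.
  by apply: funext => i; rewrite ffunE.
by rewrite ((imsetE f J1).1 fJ); apply.
Qed.

Let affine_open_minor d p (y : 'rV[C]_d -> 'M[C]_(p, N)) J : polymx y ->
  affine_open [set v | ~ minor_bound J (y v)].
Proof.
move=> yp; apply/affine_openP => v /existsNP[g /not_implyP[mg bad]].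
exists (fun v => minor K g (y v)); split=> //; first exact: polyfun_minor.
by move=> w mw; apply/existsNP; exists g; apply/not_implyP.
Qed.

Theorem affine_paving_cells :
  (forall J, (exists R' R, cell_matrices J R' R) ->
     polynomial_graph (cell_matrices J)) ->
  affine_paving X.
Proof.
move=> cell_poly.
pose S (J : {set 'I_n} * {set 'I_n}) : set X := [set z |
  minor_bound J.1 (frame_of k (val z).1.2) /\ minor_bound J.2 (frame_of l (val z).2)].
apply: (@affine_paving_of_cells C X _ cell S (fun J => height J.1 + height J.2)%N).
- exact/open_inter_subspace/open_inter_quotient/open_inter_subspace/open_inter_affine.
- exact: cell_cover.
- move=> J z [R' [R [cR zE]]]; have [c1 c2] := card_cell_matrices cR.
  have [E1 E2] := frame_of_flag (set_mem (valP z)) zE; have [rR' rR _] := cR.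
  by split; [exact: reduced_minor_bound rR' E1 | exact: reduced_minor_bound rR E2].
- move=> [J' J] [I' I] z [/= b1 b2] [R' [R [cR zE]]].
  have [/= c1 c2] := card_cell_matrices cR.
  have [E1 E2] := frame_of_flag (set_mem (valP z)) zE; have [/= rR' rR _] := cR.
  case: (minor_bound_reduced c1 rR' E1 b1) => [->|lt1];
    case: (minor_bound_reduced c2 rR E2 b2) => [->|lt2].
  + by left.
  + by right; rewrite ltn_add2l.
  + by right; rewrite ltn_add2r.
  + by right; rewrite -addSn leq_add // ltnW.
- move=> J; exists [set t : G | ~ (minor_bound J.1 (frame_of k t.1.2) /\
    minor_bound J.2 (frame_of l t.2))]; last by [].
  pose W : set (affine C (N * N + (k * N + l * N))) :=
    [set v | ~ (minor_bound J.1 (frame1_of v) /\ minor_bound J.2 (frame2_of v))].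
  exists W.
    apply/affine_openP => v /not_andP[nb|nb].
      have [f [pf fv fW]] := (affine_openP _).1
        (affine_open_minor J.1 polymx_frame1) v nb.
      by exists f; split=> // w /fW nbw [].
    have [f [pf fv fW]] := (affine_openP _).1
      (affine_open_minor J.2 polymx_frame2) v nb.
    by exists f; split=> // w /fW nbw [].
  have boundE v : (minor_bound J.1 (frame_of k (@triple_of_frames C N k l v).1.2) /\
      minor_bound J.2 (frame_of l (triple_of_frames v).2)) =
    (minor_bound J.1 (frame1_of (val v)) /\ minor_bound J.2 (frame2_of (val v))).
    have [m1 m2] := minor_frame v.
    apply/propext; split=> -[b1 b2]; split=> g mg.
    - by apply: b1; rewrite m1.
    - by apply: b2; rewrite m2.
    - by apply: b1; rewrite -m1.
    - by apply: b2; rewrite -m2.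
  by apply/seteqP; split=> v /=; rewrite boundE.
move=> [J' J] [z [R' [R [cR zE]]]].
have [/= c1 c2] := card_cell_matrices cR.
have [f1 [f1_inj f1J]] := injective_enum c1.
have [f2 [f2_inj f2J]] := injective_enum c2.
have [|d [A [B [c /= [pA pB AB ABu]]]]] := cell_poly (J', J); first by exists R', R.
exists d; apply: (@cell_isomorphic J' J f1 f2 f1_inj f2_inj f1J f2J d c A B pA pB).
  move=> a; have [cA Ea] := AB a; split=> //.
  by apply/rowP => i; rewrite mxE Ea.
by move=> Y' Y /ABu.
Qed.

End FlagCells.

(** * The fibres *)

Lemma affine_paving_empty (C : fieldType) (X : Defs.space C) :
  (forall z : X, False) -> affine_paving X.
Proof.
move=> X0; exists 0%N, (fun=> set0); split=> //.
by apply/seteqP; split=> z //; case: (X0 z).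
Qed.

Section Fibres.
Local Open Scope classical_set_scope.
Variables (C : fieldType) (N : nat).
Hypothesis two_neq0 : 2%:R != 0 :> C.
Hypothesis sqrt_ex : forall a : C, exists b, b ^+ 2 = a.
Variables (B : {symmetric 'rV[C]_N}) (ndB : nondegenerate B).
Variables (m : nat) (m_gt0 : (0 < m)%N) (x : 'M[C]_N) (g1x : g1 B x).

Definition gram : 'M[C]_N := \matrix_(i, j) B (delta_mx 0 i) (delta_mx 0 j).
Local Notation M := gram.

Lemma gramE u v : B u v = (u *m M *m v^T) 0 0.
Proof.
rewrite {1}[u]row_sum_delta linear_sumlz mxE.
under [RHS]eq_bigr do rewrite !mxE mulr_suml.
rewrite [RHS]exchange_big /=; apply: eq_bigr => i _.
rewrite linearZl_LR /= {1}[v]row_sum_delta linear_sumr mulr_sumr.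
by apply: eq_bigr => j _; rewrite linearZr_LR /= !mxE mulrCA mulrC.
Qed.

Lemma gram_sym : M^T = M.
Proof. by apply/matrixP => i j; rewrite !mxE hermC expr0 mul1r. Qed.

Lemma gram_unit : M \in unitmx.
Proof.
apply: unitmx_kerP => z z0; apply/eqP; rewrite -memv0 -(eqP ndB).
by apply/mem_orthovP => v _; rewrite gramE z0 mul0mx mxE.
Qed.

Lemma self_adjoint_gram : x *m M = M *m x^T.
Proof.
have [_ adj] := g1x.
have entry (A : 'M[C]_N) i j : A i j =
    (delta_mx (0 : 'I_1) i *m A *m (delta_mx (0 : 'I_1) j)^T) 0 0.
  by rewrite trmx_delta -colE -rowE !mxE.
apply/matrixP => i j; rewrite [LHS]entry [RHS]entry !mulmxA.
by rewrite -gramE adj gramE trmx_mul !mulmxA.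
Qed.

Let Mt := gram_sym.
Let Mu := gram_unit.
Let xM := self_adjoint_gram.

Lemma mem_orthov_rowspan k (A : 'M[C]_(k, N)) v :
  v \in orthov B (rowspan A) <->
  (forall w : 'rV[C]_N, (w <= A)%MS -> (v *m M *m w^T) 0 0 = 0).
Proof.
split=> [/mem_orthovP H w wA|H]; first by rewrite -gramE H // mem_rowspan.
by apply/mem_orthovP => w; rewrite mem_rowspan gramE; apply: H.
Qed.

(* As im x is orthogonal to ker x, it lies in the orthogonal of a subspace of *)
(* ker x, so both conditions force x^3 = 0.                                   *)
Lemma perp_image_cube (X P : {vspace 'rV[C]_N}) :
  (forall v, v \in P -> v *m x = 0) -> (X <= P)%VS ->
  (forall v, v \in orthov B P -> v *m x \in X) -> x *m x *m x = 0.
Proof.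
move=> P0 XP H; apply/row_matrixP => i; rewrite row0 !row_mul.
set v := row i x; have : v *m x \in X.
  apply/H/mem_orthovP => w wP; have [_ adj] := g1x.
  rewrite /v rowE adj P0 // linear0r //.
by move/(subvP XP)/P0.
Qed.

Section AdaptedCells.
Variables (n : nat) (bl : 'I_n -> nat) (st : 'I_n -> 'I_n) (K : 'M[C]_(n, N)).
Hypothesis abK : adapted_basis M x bl st K.
Hypothesis x3 : x *m x *m x = 0.

Let Kfree := ab_free abK.

Lemma rowspan_sub p q (Y' : 'M[C]_(p, n)) (Y : 'M[C]_(q, n)) :
  (rowspan (Y' *m K) <= rowspan (Y *m K))%VS = (Y' <= Y)%MS.
Proof.
rewrite -(submxMfree _ _ Kfree); apply/subvP/idP => [H|H v].
  by apply/row_subP => i; rewrite -mem_rowspan; apply: H; rewrite mem_rowspan row_sub.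
by rewrite !mem_rowspan => /submx_trans; apply.
Qed.

Lemma flag_conditions_flag_of (J' J : {set 'I_n}) (Y' Y : 'M[C]_n) :
  #|J'| = m.-1 -> #|J| = m -> reduced J' Y' -> reduced J Y ->
  flag_conditions B m (flag_of K x Y' Y) <->
  (Y' <= Y)%MS /\ isotropic_rows bl st Y.
Proof.
move=> cJ' cJ rY' rY.
have isoE : isotropic B (rowspan (Y *m K)) <-> isotropic_rows bl st Y.
  rewrite -(isotropic_subP abK); split=> H u v.
    by move=> uY vY; rewrite -gramE; apply: H; rewrite mem_rowspan.
  by rewrite !mem_rowspan gramE; apply: H.
split=> [[_ sub [_ iW] _ _]|[sub iso]].
  by rewrite rowspan_sub in sub; split=> //; apply/isoE.
have subV : (rowspan (Y' *m K) <= rowspan (Y *m K))%VS by rewrite rowspan_sub.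
have iW := isoE.2 iso; split=> //.
- by split=> // u v uU vU; apply: iW; apply: (subvP subV).
- split; rewrite dim_rowspan mxrankMfree //.
    by have [f [fi fJ]] := injective_enum cJ'; rewrite (rank_reduced fi fJ rY').
  by have [f [fi fJ]] := injective_enum cJ; rewrite (rank_reduced fi fJ rY).
move=> v; rewrite mem_rowspan => /submxP[D ->]; rewrite -!mulmxA.
have -> : K *m x = 0 by apply/sub_kermxP; rewrite (ab_ker abK).
by rewrite !mulmx0.
Qed.

Lemma perp_imageP (X P : 'M[C]_n) : (X <= P)%MS ->
  (forall v, v \in orthov B (rowspan (P *m K)) -> v *m x \in rowspan (X *m K)) <->
  perp_sub bl st X P.
Proof.
move=> XP; rewrite -(perp_image_subP Mt Mu xM abK x3 XP).
split=> H v vP; first by rewrite -mem_rowspan; apply/H/mem_orthov_rowspan.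
by rewrite mem_rowspan; apply/H/mem_orthov_rowspan.
Qed.

Lemma affine_paving_fiber (H : set (triple C N))
    (V : {set 'I_n} -> {set 'I_n} -> 'M[C]_n -> 'M[C]_n -> Prop) :
  (forall t, H t -> flag_conditions B m t) ->
  (forall (J J' : {set 'I_n}) (Y' Y : 'M[C]_n), #|J'| = m.-1 -> #|J| = m ->
     [/\ reduced J' Y', reduced J Y & H (flag_of K x Y' Y)] <-> V J J' Y' Y) ->
  (forall (J J' : {set 'I_n}) j0, J = (j0 |: J')%SET -> j0 \notin J' ->
     (exists Y' Y, V J J' Y' Y) -> polynomial_graph (V J J')) ->
  affine_paving (@subspace C (endo_Gr_Gr C N m.-1 m) (H `&` @endo C N @^-1` [set x])).
Proof.
move=> Hflag HV Vpoly.
have KE := ab_ker abK.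
have flagW t v : H t -> endo t = x -> v \in t.2 -> (v <= K)%MS.
  case: t => [[y U] W] /Hflag[_ _ _ _ W0] /= yx vW.
  by rewrite KE; apply/sub_kermxP; rewrite -yx; apply: W0.
have flagU t v : H t -> v \in t.1.2 -> v \in t.2.
  by case: t => [[y U] W] /Hflag[_ /subvP UW _ _ _] /UW.
apply: (@affine_paving_cells C N n m.-1 m K x Kfree) => [t [_ tx]|t [/Hflag]|t [/Hflag]|t v|t v|].
- exact: tx.
- by case: t => [[y U] W] [_ _ _ [? ?] _] _.
- by case: t => [[y U] W] [_ _ _ [? ?] _] _.
- by move=> [Ht tx] /(flagU _ _ Ht); apply: flagW.
- by move=> [Ht tx]; apply: flagW.
move=> [J' J] cne; have [Y' [Y cY]] := cne.
have [/= c1 c2] : #|J'| = m.-1 /\ #|J| = m.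
  apply: (@card_cell_matrices C N n m.-1 m K x Kfree _ _ _ (J', J) Y' Y cY) => t [/Hflag].
    by case: t => [[y U] W] [_ _ _ [? ?] _] _.
  by case: t => [[y U] W] [_ _ _ [? ?] _] _.
have VE Z' Z : cell_matrices K x (H `&` @endo C N @^-1` [set x]) (J', J) Z' Z <->
    V J J' Z' Z.
  rewrite -HV //; split=> [[rZ' rZ [HZ _]]|[rZ' rZ HZ]]; first by split.
  by split.
have sub : J' \subset J.
  case: cY => /= rY' rY [/Hflag[_ + _ _ _] _]; rewrite rowspan_sub.
  exact: reduced_pivot_subset.
(* U has codimension 1 in W, so its pivots are those of W with one removed. *)
have [j0 j0E] : exists j0, (J :\: J')%SET = [set j0]%SET.
  apply/cards1P; rewrite cardsD (finset.setIidPr sub) c1 c2.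
  by case: (m) m_gt0 => // p _; rewrite subSnn.
have JE : J = (j0 |: J')%SET.
  by rewrite -(finset.setID J J') (finset.setIidPr sub) j0E finset.setUC.
have j0J' : j0 \notin J'.
  have : j0 \in (J :\: J')%SET by rewrite j0E set11.
  by rewrite inE => /andP[].
have [|d [A [B' [c [pA pB AB ABu]]]]] := Vpoly J J' j0 JE j0J'.
  by exists Y', Y; apply/VE.
exists d, A, B', c; split=> // [a|Z' Z /VE]; last exact: ABu.
by have [/VE] := AB a.
Qed.

Lemma affine_paving_tau : affine_paving (tau_fiber B m x).
Proof.
apply: (affine_paving_fiber (V := fun J J' => cellE bl st J J')).
- by move=> t [].
- move=> J J' Y' Y c1 c2; split.
    move=> [rY' rY [fl H]]; have [sub iso] := (flag_conditions_flag_of c1 c2 rY' rY).1 fl.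
    by split=> //; apply/(perp_imageP sub).
  move=> [[rY' rY sub iso] H]; split=> //; split.
    exact/(flag_conditions_flag_of c1 c2 rY' rY).
  exact/(perp_imageP sub).
move=> J J' j0; have [stK bl_st bl_le2 bl_mono st_sum _ _ _ _ _] := abK.
exact: cellE_polynomial.
Qed.

Lemma affine_paving_sigma : affine_paving (sigma_fiber B m x).
Proof.
apply: (affine_paving_fiber (V := fun J J' => cellO bl st J J')).
- by move=> t [].
- move=> J J' Y' Y c1 c2; split.
    move=> [rY' rY [fl H]]; have [sub iso] := (flag_conditions_flag_of c1 c2 rY' rY).1 fl.
    by split=> //; apply/(perp_imageP (submx_refl Y')).
  move=> [[rY' rY sub iso] H]; split=> //; split.
    exact/(flag_conditions_flag_of c1 c2 rY' rY).
  exact/(perp_imageP (submx_refl Y')).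
move=> J J' j0; have [stK bl_st bl_le2 bl_mono st_sum _ _ _ _ _] := abK.
exact: cellO_polynomial.
Qed.

End AdaptedCells.

Theorem affine_paving_fibers :
  affine_paving (tau_fiber B m x) /\ affine_paving (sigma_fiber B m x).
Proof.
have [x3|x3] := pselect (x *m x *m x = 0).
  have [n [bl [st [K abK]]]] := adapted_basis_exists two_neq0 sqrt_ex Mt Mu xM x3.
  by split; [exact: affine_paving_tau abK x3 | exact: affine_paving_sigma abK x3].
split; apply: affine_paving_empty => -[[[y U] W] /set_mem[[[_ UW _ _ W0] H] /= yx]];
  rewrite /endo /= in yx; subst y; apply: x3.
  exact: perp_image_cube W0 UW H.
by apply: (perp_image_cube (X := U) (P := U)) => // v /(subvP UW)/W0.
Qed.

End Fibres.

Theorem mainTheorem7 (R : realType) (N : nat)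
    (Q : 'rV[R[i]]_N -> R[i]) (B : {symmetric 'rV[R[i]]_N})
    (QB : assoc_form Q B) (ndB : nondegenerate B)
    (m : nat) (m_gt0 : (0 < m)%N) (m_le : (m.*2 <= N)%N)
    (x : 'M[R[i]]_N) (Nx : N1 B x) :
  affine_paving (tau_fiber B m x) /\ affine_paving (sigma_fiber B m x).
Proof.
have [g1x _] := Nx; apply: affine_paving_fibers => //.
  by rewrite Num.Theory.pnatr_eq0.
by move=> a; exists (Num.Theory.sqrtC a); rewrite Num.Theory.sqrtCK.
Qed.
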